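(* Let $\nu\in M(K\times B_{E^*})$ be arbitrary, let $\mathbf h:K\to B_{E^*}$ be a density function for $T^*\nu$ with respect to $\pi_1(|\nu|)$, and let $F_0\subset E$ be a separable subspace with $\int_K\|\mathbf h(t)|_{F_0}\|\,d\pi_1(|\nu|)(t)=\|T^*\nu\|$. Define $\mathbf g(t)=\mathbf h(t)/\|\mathbf h(t)|_{F_0}\|$ if $\mathbf h(t)|_{F_0}\neq0$ and $\mathbf g(t)=0$ otherwise. Let $\widetilde\nu$ be the unique measure in $M(K\times B_{E^*})$ carried by $K\times(B_{E^*}\setminus\{0\})$ such that $$\int_{K\times B_{E^*}}f\,d\widetilde\nu=\int_K f(t,\mathbf g(t))\,d|T^*\nu|(t)$$ for every continuous scalar function $f$ on $K\times B_{E^*}$ vanishing on $K\times\{0\}$. Then $\widetilde\nu=WT^*\nu$.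
   Context: $\mathbb F\in\{\mathbb R,\mathbb C\}$ is the scalar field, $K$ is a compact Hausdorff space, $E$ is a Banach space over $\mathbb F$, and $B_{E^*}$ is the closed unit ball of $E^*$ with the weak$^*$ topology. For a compact space $X$, $M(X)$ is the space of $\mathbb F$-valued Radon measures on $X$ with the total variation norm. $C(K,E)$ is the space of continuous functions $K\to E$ with the sup norm. $M(K,E^* )$ is the space of regular $\sigma$-additive $E^*$-valued Borel measures $\mu$ on $K$ of bounded variation; $|\mu|$ is the variation and $\|\mu\|=|\mu|(K)$. For $\mathbf f\in C(K,E)$, $\int\mathbf f\,d\mu$ is the extension by uniform limits of $\int\sum_j\chi_{A_j}x_j\,d\mu=\sum_j\mu(A_j)(x_j)$; this identifies $M(K,E^* )$ isometrically with $C(K,E)^*$. The map $T:C(K,E)\to C(K\times B_{E^*})$ is $T\mathbf f(t,x^* )=x^*(\mathbf f(t))$, and $T^*:M(K\times B_{E^*})\to M(K,E^* )$ is its adjoint: $\int\mathbf f\,dT^*\nu=\int x^*(\mathbf f(t))\,d\nu(t,x^* )$. $\pi_1(|\nu|)$ is the image of the variation $|\nu|$ under the projection to $K$. A density function for $T^*\nu$ with respect to $\pi_1(|\nu|)$ is a function $\mathbf h:K\to B_{E^*}$ such that $\int_K\mathbf f\,dT^*\nu=\int_K\mathbf h(t)(\mathbf f(t))\,d\pi_1(|\nu|)(t)$ for all $\mathbf f\in C(K,E)$ (with the integrand $\pi_1(|\nu|)$-measurable); then also $T^*\nu(A)(x)=\int_A\mathbf h(t)(x)\,d\pi_1(|\nu|)(t)$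 for all Borel $A\subset K$ and $x\in E$. Such $\mathbf h$ exist, and for each such $\mathbf h$ the functions $t\mapsto\|\mathbf h(t)|_F\|$, $F\subset E$ separable, are $\pi_1(|\nu|)$-measurable and $\|T^*\nu\|=\max\{\int_K\|\mathbf h(t)|_F\|\,d\pi_1(|\nu|)(t): F\subset E\text{ separable}\}$. Definition of $W$. Let $\mathcal D$ be the set of all $f:K\times E^*\to\mathbb R$ such that $f|_{K\times B_{E^*}}$ is upper semicontinuous and bounded and $f(t,\cdot)$ is superlinear (superadditive and positively homogeneous) for each $t\in K$. For $f\in\mathcal D$ and $\mu\in M(K,E^* )$ put $$p_f(\mu)=\inf\Big\{\operatorname{Re}\int\mathbf u\,d\mu:\ \mathbf u\in C(K,E),\ \operatorname{Re}x^*(\mathbf u(t))\ge f(t,x^* )\text{ for all }(t,x^* )\in K\times E^*\Big\}.$$ For $\mu\in M(K,E^* )$, $W\mu$ is the unique positive Radon measure on $K\times B_{E^*}$ with $\|W\mu\|=\|\mu\|$ and $\int f\,dW\mu=p_f(\mu)$ for all $f\in\mathcal D$ (existence and uniqueness are a theorem of Batty). It satisfies $T^*W\mu=\mu$.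
   Formalization: For nonseparable E the functional g(t) can leave the unit ball B_{E*}, so f(t,g(t)) is undefined; it is read as the value at (t,g(t)) of a continuous extension of f to K×E* (weak* topology), which agrees with f(t,g(t)) whenever g(t) lies in B_{E*}. *)

(* Defs.v *)
From HB Require Import structures.
From mathcomp Require Import all_boot all_order all_algebra.
From mathcomp Require Import all_classical all_reals all_analysis.
From mathcomp Require Import measurable_realfun complex.

Set Implicit Arguments.
Unset Strict Implicit.
Unset Printing Implicit Defensive.
Import Order.TTheory GRing.Theory Num.Theory.
Import numFieldNormedType.Exports.

Local Open Scope classical_set_scope.
Local Open Scope ring_scope.

Inductive scalar_kind := RealScalars | ComplexScalars.

Definition sfield (R : realType) (k : scalar_kind) : numFieldType :=
  match k with RealScalars => R | ComplexScalars => R[i]%C end.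

Definition sre {R : realType} {k} : sfield R k -> R :=
  match k with
  | RealScalars => fun x => x
  | ComplexScalars => fun z => complex.Re z
  end.

Definition sim {R : realType} {k} : sfield R k -> R :=
  match k with
  | RealScalars => fun=> 0
  | ComplexScalars => fun z => complex.Im z
  end.

(* x + iy over the complex scalars; over the real ones, y is dropped. *)
Definition smk {R : realType} {k} : R -> R -> sfield R k :=
  match k with
  | RealScalars => fun x _ => x
  | ComplexScalars => fun x y => (x +i* y)%C
  end.

Definition sreal {R : realType} {k} (x : R) : sfield R k := smk x 0.

(* The norm of a [normedModType] over [sfield R k] lives in [sfield R k]. *)
Definition rnorm {R : realType} {k} {V : normedModType (sfield R k)} (x : V) : R :=
  sre `|x|.

Section Dual.
Context {R : realType} {k : scalar_kind} (E : normedModType (sfield R k)).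
Let F := sfield R k.

Definition functional : {pred E -> F^o} :=
  fun f => `[< linear f /\ continuous f >].

Fact functional_submod : submod_closed functional.
Proof.
split=> [|a f g]; rewrite !unfold_in /=.
  apply/asboolP; split; first by move=> b x y; rewrite scaler0 addr0.
  by move=> x; exact: cvg_cst.
move=> /asboolP[lf cf] /asboolP[lg cg]; apply/asboolP; split.
  move=> b x y.
  rewrite -[LHS]/(a *: f (b *: x + y) + g (b *: x + y)) lf lg.
  rewrite -[RHS]/(b *: (a *: f x + g x) + (a *: f y + g y)).
  by rewrite !scalerDr !scalerA [a * b]mulrC !addrA; congr (_ + _); rewrite addrAC.
move=> x; apply: (@cvgD _ F^o); last exact: cg.
by apply: (@cvgZl_tmp _ F^o); exact: cf.
Qed.

HB.instance Definition _ := GRing.isSubmodClosed.Build F (E -> F^o) functional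
  functional_submod.

Record dual := Dual { dual_fun :> E -> F^o; _ : dual_fun \in functional }.
HB.instance Definition _ := [isSub for dual_fun].
HB.instance Definition _ := [Choice of dual by <:].
HB.instance Definition _ := [SubChoice_isSubLmodule of dual by <:].
HB.instance Definition _ := isPointed.Build dual 0.
(* The weak* topology *)
HB.instance Definition _ := Topological.copy dual
  (initial_topology (dual_fun : dual -> {ptws E -> F^o})).

(* The norm of the restriction of a functional to the subspace S *)
Definition dnorm_on (S : set E) (f : dual) : R :=
  sup [set rnorm (f x) | x in S `&` [set x | rnorm x <= 1]].
Definition dnorm (f : dual) : R := dnorm_on setT f.

Definition dball := set_type [set f : dual | dnorm f <= 1].
Definition dball_val (f : dball) : dual := set_val f.

Fact dnorm0 : dnorm 0 <= 1.
Proof.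
rewrite (_ : dnorm 0 = 0) ?ler01 //.
rewrite /dnorm /dnorm_on (_ : [set _ | _ in _] = [set 0]) ?sup1 //.
have r0 (V : normedModType F) : rnorm (0 : V) = 0.
  by rewrite /rnorm normr0; case: (k).
apply/seteqP; split=> [_ [x _ <-]|_ ->] /=; first exact: r0.
by exists 0; [split=> //=; rewrite r0 ler01|exact: r0].
Qed.

HB.instance Definition _ := Topological.on dball.
HB.instance Definition _ := isPointed.Build dball
  (exist _ 0 (mem_set dnorm0) : set_type [set f : dual | dnorm f <= 1]).
End Dual.

HB.instance Definition _ (X Y : ptopologicalType) := Topological.on (X * Y)%type.

Definition borel (X : ptopologicalType) := g_sigma_algebraType (@open X).
HB.instance Definition _ (X : ptopologicalType) := Measurable.on (borel X).

Section Measures.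
Context {R : realType}.

(* [n A] is the norm of the value at A of a scalar or vector measure. Using
   disjoint pieces inside A rather than partitions of A gives the same
   supremum. *)
Definition variation d {T : measurableType d} (n : set T -> R) (A : set T)
    : \bar R :=
  ereal_sup [set s | exists m (B : nat -> set T),
    [/\ forall i, (i < m)%N -> measurable (B i), trivIset `I_m B,
        \bigcup_(i in `I_m) B i `<=` A & s = (\sum_(i < m) n (B i))%:E]].

Definition regular {X : ptopologicalType} (m : set (borel X) -> \bar R) :=
  forall A : set (borel X), measurable A -> forall e : R, 0 < e ->
  exists C U : set X,
    [/\ compact C, open U, C `<=` A, A `<=` U & (m (U `\` C) < e%:E)%E].

(* Regular countably additive Borel measures of bounded variation, with values
   in the module V whose norm is n. *)
Definition is_regular_measure {X : ptopologicalType} {V : zmodType} (n : V -> R)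
    (mu : set (borel X) -> V) :=
  [/\ forall A : nat -> set (borel X), (forall i, measurable (A i)) ->
        trivIset setT A ->
        n (mu (\bigcup_i A i) - \sum_(i < m) mu (A i)) @[m --> \oo] --> (0 : R),
      (variation (n \o mu) setT < +oo)%E &
      regular (variation (n \o mu))].

Context {k : scalar_kind}.
Let F := sfield R k.

Definition scalar_measure {X : ptopologicalType} (nu : set (borel X) -> F) :=
  is_regular_measure (fun z : F => rnorm (z : F^o)) nu.

Definition dual_measure {X : ptopologicalType} {E : normedModType F}
    (mu : set (borel X) -> dual E) :=
  is_regular_measure (@dnorm _ _ E) mu.

Definition svar {X : ptopologicalType} (nu : set (borel X) -> F) :
    set (borel X) -> \bar R :=
  variation (fun A => rnorm (nu A : F^o)).
Definition dvar {X : ptopologicalType} {E : normedModType F}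
    (mu : set (borel X) -> dual E) : set (borel X) -> \bar R :=
  variation (fun A => dnorm (mu A)).

(* The integral of f : X -> W against a V-valued measure, for a pairing of V and
   W: the limit of the integrals \sum_j <mu(A_j), x_j> of simple functions
   \sum_j \1_(A_j) x_j converging uniformly to f. *)
Definition is_integral {X : ptopologicalType} {V : Type} {W : normedModType F}
    (pair : V -> W -> F) (mu : set (borel X) -> V) (f : X -> W) (v : F) :=
  exists (m : nat -> nat) (A : nat -> nat -> set (borel X))
         (x : nat -> nat -> W),
    [/\ forall n j, measurable (A n j),
        forall e : R, 0 < e -> \forall n \near \oo, forall t : X,
          rnorm (f t - \sum_(j < m n) (\1_(A n j) t : F) *: x n j) <= e &
        (\sum_(j < m n) pair (mu (A n j)) (x n j) : F^o) @[n --> \oo]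
          --> (v : F^o)].

Definition sintegral_of {X : ptopologicalType} (nu : set (borel X) -> F)
    (f : X -> F) : F :=
  xget 0 [set v | is_integral (W := F^o) *%R nu f v].

Definition dintegral_of {X : ptopologicalType} {E : normedModType F}
    (mu : set (borel X) -> dual E) (f : X -> E) : F :=
  xget 0 [set v | is_integral (fun phi x => phi x) mu f v].

(* m-measurability, with respect to the completion of the positive measure m *)
Definition completed_measurable {X : ptopologicalType}
    (m : set (borel X) -> \bar R) (f : X -> F) :=
  forall U : set F^o, open U -> completed_algebra_gen m (f @^-1` U).

(* Integral of a scalar function against a positive measure m. As the Lebesgue
   integral of a nonnegative function is the supremum of the integrals of the
   Borel simple functions below it, it agrees on m-measurable functions with the
   integral with respect to the completion of m. *)
Definition cintegral {X : ptopologicalType} (m : set (borel X) -> \bar R)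
    (f : X -> F) : F :=
  smk (fine (\int[m]_t (sre (f t))%:E)) (fine (\int[m]_t (sim (f t))%:E)).

Context {K : ptopologicalType} {E : normedModType F}.

Definition Tmap (f : K -> E) : K * dball E -> F :=
  fun p => dball_val p.2 (f p.1).

(* mu = T^* nu, under the identification of C(K, E)^* with the regular dual
   measures *)
Definition is_Tadjoint (nu : set (borel (K * dball E)%type) -> F)
    (mu : set (borel K) -> dual E) :=
  dual_measure mu /\
  forall f : K -> E, continuous f ->
    dintegral_of mu f = sintegral_of nu (Tmap f).

Definition pi1_var (nu : set (borel (K * dball E)%type) -> F) :
    set (borel K) -> \bar R :=
  pushforward (svar nu) (fst : borel (K * dball E)%type -> borel K).

Definition is_density (m : set (borel K) -> \bar R) (mu : set (borel K) -> dual E)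
    (h : K -> dball E) :=
  forall f : K -> E, continuous f ->
    completed_measurable m (fun t => dball_val (h t) (f t)) /\
    dintegral_of mu f = cintegral m (fun t => dball_val (h t) (f t)).

Definition batty_class (f : K * dual E -> R) :=
  [/\ lower_semicontinuous
        (fun p : K * dball E => (- f (p.1, dball_val p.2))%:E),
      exists M : R, forall p : K * dball E, `|f (p.1, dball_val p.2)| <= M,
      forall t x y, f (t, x) + f (t, y) <= f (t, x + y) &
      forall t (r : R) x, 0 <= r -> f (t, sreal r *: x) = r * f (t, x)].

Definition batty_p (f : K * dual E -> R) (mu : set (borel K) -> dual E) : \bar R :=
  ereal_inf [set (sre (dintegral_of mu u))%:E | u in
    [set u : K -> E | continuous u /\
       forall t (x : dual E), f (t, x) <= sre (x (u t))]].

(* N = W mu: by a theorem of Batty exactly one Radon measure N has these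
   properties. Positivity and countable additivity are in the type of N. *)
Definition is_batty_W (mu : set (borel K) -> dual E)
    (N : {measure set (borel (K * dball E)%type) -> \bar R}) :=
  [/\ regular N, N setT = dvar mu setT &
      forall f, batty_class f ->
        (\int[N]_p (f (p.1, dball_val p.2))%:E)%E = batty_p f mu].

Definition separable_subspace (S : set E) :=
  [/\ S 0, forall a x y, S x -> S y -> S (a *: x + y) &
      exists D : set E, [/\ countable D, D `<=` S & S `<=` closure D]].

Definition normalized_density (S : set E) (h : K -> dball E) (t : K) : dual E :=
  if `[< exists2 x, S x & dball_val (h t) x != 0 >]
  then sreal (dnorm_on S (dball_val (h t)))^-1 *: dball_val (h t) else 0.

(* [normalized_density S h t] has norm at most 1 on S, but it may leave the unit
   ball of E^* (on a set of t that need not be negligible when E is not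
   separable). So the value f(t, g(t)) of a continuous f on K x B is read through
   a continuous extension [fe] of f to K x E^*, with E^* in its weak* topology:
   such extensions exist as K x B is compact, the resulting integral does not
   depend on the choice of fe, and fe(t, g(t)) = f(t, g(t)) whenever g(t) lies in
   B. *)
Definition is_lifted_measure (mu : set (borel K) -> dual E) (g : K -> dual E)
    (nut : set (borel (K * dball E)%type) -> F) :=
  [/\ scalar_measure nut,
      svar nut [set p | dball_val p.2 = 0] = 0%E &
      forall (f : K * dball E -> F^o) (fe : K * dual E -> F^o),
        continuous f -> (forall p, dball_val p.2 = 0 -> f p = 0) ->
        continuous fe -> (forall t x, fe (t, dball_val x) = f (t, x)) ->
        sintegral_of nut f = cintegral (dvar mu) (fun t => fe (t, g t))].

End Measures.

(* Main.v *)
(* Let P be the image of |nu| on K, rho(t) = ||h(t)|_F0|| and g = h / rho.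
   Approximating indicators by continuous functions, one gets \int_A Re
   h(t)(u(t)) dP <= |mu|(A) sup ||u|| for Borel A, whence rho P <= |mu|; the
   total masses agree, so |mu| = rho P, and Re h(t)(u(t)) = 0 for almost all
   t with rho(t) = 0.

   If f is a minimum of finitely many functions phi(t) Re x(e), then p_f(mu)
   = \int f(t, h(t)) dP: the constraint Re x(u(t)) >= f(t, x) integrates to
   one inequality; for the other, a continuous convex combination u of the
   phi e nearly selects the smallest term at x = h(t). So W mu integrates
   every difference f of such minima to \int f(t, h(t)) dP, and these
   positively homogeneous functions form a vector lattice.

   Constants are reached through s_n(x) = max(0, max_{i < n} Re x(d_i)) with
   (d_i) norming for F0: s_n <= 1 on the ball, s_n(h(t)) increases to rho(t)
   and \int s_n dW mu = \int s_n(h) dP tends to the mass of W mu, so that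
   s_n tends to 1 in L^1(W mu). Replacing the constant c = 1 by s_n in a
   lattice expression f(t, x, c) and passing to the limit, \int f(t, x, 1)
   dW mu = \int f(t, h, rho) dP = \int f(t, g, 1) d|mu|, which is the
   integral of f(., ., 1) against nut when f(., ., 1) vanishes at x = 0.
   Such functions separate compact from closed subsets of the complement of
   K x {0}, a null set for both measures, and regularity concludes. *)

Require Import Defs.
From HB Require Import structures.
From mathcomp Require Import all_boot all_order all_algebra.
From mathcomp Require Import all_classical all_reals all_analysis.
From mathcomp Require Import measurable_realfun complex.
From mathcomp Require Import ring lra zify.

Set Implicit Arguments.
Unset Strict Implicit.
Unset Printing Implicit Defensive.

Import Order.TTheory GRing.Theory Num.Theory.
Import numFieldNormedType.Exports.

Local Open Scope classical_set_scope.
Local Open Scope ring_scope.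

(** * Scalars and dual spaces *)

(** The obstacle is measurability. E need not be separable and h is known only through the functions
    t -> Re h(t)(u(t)), each equal to a Borel function off its own null set; the norm of h(t) may
    fail to be measurable. Test functions are therefore built by lattice operations from the values
    Re x(e) at finitely many e, and the norm on F0 enters only as the limit of the s_n. The constant
    is made a variable c for two reasons. Joint homogeneity in x and c gives f(t, h, rho) = rho f(t,
    g, 1), and the factor rho is the density of |mu|; and a Lipschitz bound in c, uniform in t and x
    and stable under lattice operations, lets the single number \int (1 - s_n) dW mu control the
    error on both sides of the limit. Since g(t) may leave the unit ball, the test functions are
    formulas on all of K x E^*, continuous and with values in [0, 1] there at c = 1. Each is thus
    its own extension [fe] in the definition of the lifted measure. *)

Section Scalars.
Context {R : realType} {k : scalar_kind}.
Local Notation F := (sfield R k).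
Implicit Types (z w : F) (r s : R).

Lemma sreD z w : sre (z + w) = sre z + sre w.
Proof. by clear; case: k z w => //= -[? ?] [? ?]. Qed.

Lemma sreN z : sre (- z) = - sre z.
Proof. by clear; case: k z => //= -[? ?]. Qed.

Lemma sre0 : sre (0 : F) = 0. Proof. by clear; case: k. Qed.

Lemma simD z w : sim (z + w) = sim z + sim w.
Proof. by clear; case: k z w => //= [_ _|[? ?] [? ?]//]; rewrite addr0. Qed.

Lemma simN z : sim (- z) = - sim z.
Proof. by clear; case: k z => //= [_|[? ?]//]; rewrite oppr0. Qed.

Lemma sreK r : sre (sreal r : F) = r.
Proof. by clear; case: k. Qed.

Lemma sim_sreal r : sim (sreal r : F) = 0.
Proof. by clear; case: k. Qed.

Lemma scalarP z w : sre z = sre w -> sim z = sim w -> z = w.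
Proof. by clear; case: k z w => //= -[? ?] [? ?] /= -> ->. Qed.

Lemma sre_smk r s : sre (smk r s : F) = r.
Proof. by clear; case: k. Qed.

(** An inequality rather than an equality because [smk] drops [s] over the real scalars, where the
    left side is 0. *)
Lemma normr_sim_smkB r s z : `|sim (smk r s - z)| <= `|s - sim z|.
Proof. by clear; case: k z => //= [_|[]//]; rewrite normr0 normr_ge0. Qed.

Lemma sreMreal r z : sre (sreal r * z) = r * sre z.
Proof. by clear; case: k z => //= -[a b] /=; rewrite mul0r subr0. Qed.

Lemma sreal0 : sreal 0 = 0 :> F. Proof. by clear; case: k. Qed.
Lemma sreal1 : sreal 1 = 1 :> F. Proof. by clear; case: k. Qed.

Lemma srealD r s : sreal (r + s) = sreal r + sreal s :> F.
Proof.
by clear; case: k => //=; rewrite /sreal /=; apply/eqP;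
    rewrite eq_complex /= addr0 !eqxx.
Qed.

Lemma srealM r s : sreal (r * s) = sreal r * sreal s :> F.
Proof.
clear; case: k => //=; rewrite /sreal /=; apply/eqP; rewrite eq_complex /=.
by rewrite !mulr0 mul0r subr0 addr0 !eqxx.
Qed.

Lemma srealN r : sreal (- r) = - sreal r :> F.
Proof. by apply: scalarP; rewrite ?sreN ?simN ?sreK ?sim_sreal ?oppr0. Qed.

Lemma ler_sreal r s : (sreal r <= sreal s :> F) = (r <= s).
Proof. by clear; case: k => //=; rewrite /sreal /= lecE /= eqxx. Qed.

Lemma ltr_sreal r s : (sreal r < sreal s :> F) = (r < s).
Proof. by clear; case: k => //=; rewrite /sreal /= ltcE /= eqxx. Qed.

Lemma ge0_sreal z : 0 <= z -> z = sreal (sre z).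
Proof. by clear; case: k z => //= -[a b]; rewrite lecE /= => /andP[/eqP-> _].
    Qed.

Lemma rnormE (V : normedModType F) (x : V) : `|x| = sreal (rnorm x).
Proof. exact: ge0_sreal. Qed.

Lemma rnorm_ge0 (V : normedModType F) (x : V) : 0 <= rnorm x.
Proof. by rewrite -ler_sreal -rnormE sreal0. Qed.

Lemma ler_rnormD (V : normedModType F) (x y : V) :
  rnorm (x + y) <= rnorm x + rnorm y.
Proof. by rewrite -ler_sreal srealD -!rnormE ler_normD. Qed.

Lemma rnormN (V : normedModType F) (x : V) : rnorm (- x) = rnorm x.
Proof. by rewrite /rnorm normrN. Qed.

Lemma rnorm0 (V : normedModType F) : rnorm (0 : V) = 0.
Proof. by rewrite /rnorm normr0 sre0. Qed.

Lemma rnorm_eq0 (V : normedModType F) (x : V) : rnorm x = 0 -> x = 0.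
Proof. by move=> x0; apply/eqP; rewrite -normr_eq0 rnormE x0 sreal0. Qed.

Lemma rnormZ (V : normedModType F) z (x : V) :
  rnorm (z *: x) = rnorm (z : F^o) * rnorm x.
Proof.
rewrite {1}/rnorm normrZ (rnormE x) (ge0_sreal (normr_ge0 z)) -srealM.
by rewrite sreK.
Qed.

Lemma rnormM z w : rnorm (z * w : F^o) = rnorm (z : F^o) * rnorm (w : F^o).
Proof. exact: (rnormZ (z : F) (w : F^o)). Qed.

Lemma rnorm_sreal r : rnorm (sreal r : F^o) = `|r|.
Proof.
clear; rewrite /rnorm /sreal; case: k => //=.
by rewrite expr0n /= addr0 sqrtr_sqr.
Qed.

Lemma normr_sre z : `|sre z| <= rnorm (z : F^o).
Proof.
clear; rewrite /rnorm; case: k z => //= -[a b] /=.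
by rewrite -sqrtr_sqr ler_wsqrtr// lerDl sqr_ge0.
Qed.

Lemma normr_sim z : `|sim z| <= rnorm (z : F^o).
Proof.
clear; rewrite /rnorm; case: k z => /= [z|[a b] /=].
  by rewrite normr0 normr_ge0.
by rewrite -sqrtr_sqr ler_wsqrtr// lerDr sqr_ge0.
Qed.

Lemma ler_rnorm_resim z : rnorm (z : F^o) <= `|sre z| + `|sim z|.
Proof.
clear; rewrite /rnorm; case: k z => /= [z|[a b] /=].
  by rewrite normr0 addr0.
rewrite -[leRHS]ger0_norm ?addr_ge0// -sqrtr_sqr ler_wsqrtr//.
rewrite sqrrD -[a ^+ 2]real_normK ?num_real// -[b ^+ 2]real_normK ?num_real//.
by rewrite lerD2r lerDl mulrn_wge0 // mulr_ge0.
Qed.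

(** Turns moduli into real parts: |x(e)| = Re x(w e) for a suitable [w]. The bound is not an
    equality because z = 0 is served by w = 0. *)
Lemma rotate_rnorm z : exists2 w, rnorm (w : F^o) <= 1 &
  w * z = sreal (rnorm (z : F^o)).
Proof.
have [->|z0] := eqVneq z 0.
  exists 0; first by rewrite (rnorm0 F^o) ler01.
  by rewrite (rnorm0 F^o) sreal0 mul0r.
have nz : rnorm (z : F^o) != 0 by apply: contra_neq z0; exact: (@rnorm_eq0 F^o).
have [w wE] : exists w : F, w * z = sreal (rnorm (z : F^o)).
  by exists (sreal (rnorm (z : F^o)) / z); rewrite divfK.
exists w => //; have := congr1 (fun x : F => rnorm (x : F^o)) wE.
rewrite /= rnormM rnorm_sreal (ger0_norm (rnorm_ge0 (z : F^o))) => e.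
by rewrite -[leLHS](mulfK nz) e divff.
Qed.

Lemma sreal_gt0 r : (0 < sreal r :> F) = (0 < r).
Proof. by rewrite -(ltr_sreal 0) sreal0. Qed.

Lemma sre_gt0 z : 0 < z -> 0 < sre z.
Proof. by move=> z0; rewrite -sreal_gt0 -ge0_sreal// ltW. Qed.

Lemma cvg_rnormP (V : normedModType F) (T : Type) (G : set_system T)
    (FG : Filter G) (f : T -> V) (y : V) :
  f @ G --> y <-> (forall e : R, 0 < e -> \forall t \near G, rnorm (y - f t) <
      e).
Proof.
split=> [/cvgrPdist_lt h e e0|h].
  have e0' : 0 < sreal e :> F by rewrite sreal_gt0.
  by apply: filterS (h _ e0') => t; rewrite rnormE ltr_sreal.
apply/cvgrPdist_lt => e e0; rewrite (ge0_sreal (ltW e0)).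
by apply: filterS (h _ (sre_gt0 e0)) => t; rewrite rnormE ltr_sreal.
Qed.

Lemma near_rnorm (V : normedModType F) (x : V) (e : R) : 0 < e ->
  \forall t \near x, rnorm (x - t) < e.
Proof. by apply: (cvg_rnormP (nbhs_filter x) id x).1; exact: cvg_id. Qed.

Lemma continuous_sre : continuous (sre : F^o -> R).
Proof.
move=> z; apply/(@cvgrPdist_lt _ _ _ _ (nbhs_filter (z : F^o))) => e e0.
have := near_rnorm (z : F^o) e0.
apply: (@filterS _ (nbhs (z : F^o)) (nbhs_filter (z : F^o))) => t;
    apply: le_lt_trans.
rewrite -sreN -sreD; exact: normr_sre.
Qed.

Lemma continuous_sreal : continuous (sreal : R -> F^o).
Proof.
move=> r; apply/cvg_rnormP => e e0.
have /cvgrPdist_lt/(_ _ e0) := @cvg_id _ (nbhs r).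
by apply: (@filterS _ (nbhs r)) => t; rewrite -srealN -srealD rnorm_sreal.
Qed.

Lemma continuous_rnorm (V : normedModType F) : continuous (rnorm : V -> R).
Proof.
move=> x; apply/cvgrPdist_lt => e e0.
have := near_rnorm x e0; apply: filterS => t; apply: le_lt_trans.
have h1 := ler_rnormD (x - t) t; have h2 := ler_rnormD (t - x) x.
rewrite subrK in h1; rewrite subrK -opprB rnormN in h2.
by rewrite ler_norml; apply/andP; split; lra.
Qed.

End Scalars.

Lemma cvg_initial (S : choiceType) (T : topologicalType) (f : S -> T)
    (U : Type) (G : set_system U) (FG : Filter G) (h : U -> S) (s : S) :
  (f \o h) @ G --> f s -> h @ G --> (s : initial_topology f).
Proof.
move=> fh A; rewrite nbhsE => -[B [[V oV <-] /= Vfs] sA].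
have gV : G (h @^-1` (f @^-1` V)) := fh _ (open_nbhs_nbhs (conj oV Vfs)).
by apply: (filterS _ gV) => u /=; exact: sA.
Qed.

Section DualFacts.
Context {R : realType} {k : scalar_kind} {E : normedModType (sfield R k)}.
Local Notation F := (sfield R k).
Implicit Types (f g : dual E) (x y : E) (r : R).

Lemma dual_linear f : linear f.
Proof. by case: f => f /= /[dup] /asboolP[]. Qed.

Lemma dual_continuous f : continuous (f : E -> F^o).
Proof. by case: f => f /= /[dup] /asboolP[]. Qed.

Lemma dualZD f (a : F) x y : f (a *: x + y) = a * f x + f y.
Proof. exact: dual_linear. Qed.

Lemma dual0 f : f 0 = 0.
Proof. by have := dualZD f (-1) 0 0; rewrite scaler0 addr0 mulN1r addNr. Qed.

Lemma dualD f x y : f (x + y) = f x + f y.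
Proof. by have := dualZD f 1 x y; rewrite scale1r mul1r. Qed.

Lemma dualZ f (a : F) x : f (a *: x) = a * f x.
Proof. by have := dualZD f a x 0; rewrite !addr0 dual0 addr0. Qed.

Lemma dualN f x : f (- x) = - f x.
Proof. by rewrite -scaleN1r dualZ mulN1r. Qed.

Lemma dual_addE f g x : (f + g) x = f x + g x. Proof. by []. Qed.
Lemma dual_oppE f x : (- f) x = - f x. Proof. by []. Qed.
Lemma dual_zeroE x : (0 : dual E) x = 0. Proof. by []. Qed.

Lemma dual_bounded f : exists2 M : R, 0 <= M & forall x, rnorm (f x) <= M *
    rnorm x.
Proof.
have /cvg_rnormP/(_ _ ltr01) := @dual_continuous f 0.
rewrite dual0 => h.
have {h} : \forall t \near (0 : E), rnorm (f t) < 1.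
  by apply: filterS h => t; rewrite sub0r rnormN.
move=> /nbhs_ballP[d /= d0 hd].
have d0' : 0 < sre d by rewrite -(@ltr_sreal _ k) sreal0 -ge0_sreal// ltW.
exists (2 / sre d); first by rewrite divr_ge0// ltW.
move=> x; have [->|x0] := eqVneq x 0; first by rewrite dual0 !rnorm0 mulr0.
have nx : 0 < rnorm x.
  rewrite lt_neqAle rnorm_ge0 andbT eq_sym; apply: contra_neq x0.
  exact: rnorm_eq0.
(* The vector [sreal c *: x] has norm d/2, hence lies in the ball of radius d on which |f| < 1. *)
pose c := sre d / 2 / rnorm x.
have c0 : 0 < c by rewrite !divr_gt0.
have : rnorm (f (sreal c *: x)) < 1.
  apply: hd; rewrite -ball_normE /= sub0r normrN rnormE.
  rewrite (ge0_sreal (ltW d0)) ltr_sreal rnormZ rnorm_sreal gtr0_norm//.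
  by rewrite /c divfK ?gt_eqF// ltr_pdivrMr//; lra.
rewrite dualZ rnormM rnorm_sreal gtr0_norm// => h.
have -> : 2 / sre d * rnorm x = c^-1 by rewrite /c; field; rewrite !gt_eqF.
by rewrite -[leRHS]mul1r ler_pdivlMr// mulrC ltW.
Qed.

Lemma dnorm_on_ubound (S : set E) f :
  has_ubound [set rnorm (f x) | x in S `&` [set x | rnorm x <= 1]].
Proof.
have [M M0 hM] := dual_bounded f.
exists M => _ [x [_ /= x1] <-]; apply: le_trans (hM x) _.
by rewrite ler_piMr.
Qed.

Lemma dnorm_on_ge (S : set E) f x : S x -> rnorm x <= 1 ->
  rnorm (f x) <= dnorm_on S f.
Proof.
by move=> Sx x1; apply: ub_le_sup; [exact: dnorm_on_ubound|exists x].
Qed.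

Lemma dnorm_on_le (S : set E) f (c : R) : S 0 ->
  (forall x, S x -> rnorm x <= 1 -> rnorm (f x) <= c) -> dnorm_on S f <= c.
Proof.
move=> S0 h; apply: ge_sup; first by exists (rnorm (f 0)); exists 0 => //;
    split=> //=; rewrite rnorm0.
by move=> _ [x [Sx /= x1] <-]; exact: h.
Qed.

Lemma dnorm_on_ge0 (S : set E) f : S 0 -> 0 <= dnorm_on S f.
Proof.
move=> S0; apply: le_trans (@dnorm_on_ge S f 0 S0 _); first exact: rnorm_ge0.
by rewrite rnorm0.
Qed.

Lemma dnorm_ge0 f : 0 <= dnorm f. Proof. exact: dnorm_on_ge0. Qed.

Lemma ler_dnorm f x : rnorm (f x) <= dnorm f * rnorm x.
Proof.
have [->|x0] := eqVneq x 0; first by rewrite dual0 !rnorm0 mulr0.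
have nx : 0 < rnorm x.
  rewrite lt_neqAle rnorm_ge0 andbT eq_sym; apply: contra_neq x0.
  exact: rnorm_eq0.
have := @dnorm_on_ge setT f (sreal (rnorm x)^-1 *: x) I.
rewrite rnormZ rnorm_sreal gtr0_norm ?invr_gt0// mulVf ?gt_eqF// => /(_ (lexx
    _)).
by rewrite dualZ rnormM rnorm_sreal gtr0_norm ?invr_gt0// mulrC ler_pdivrMr.
Qed.

Lemma ler_dnormD f g : dnorm (f + g) <= dnorm f + dnorm g.
Proof.
apply: dnorm_on_le => // x _ x1; rewrite dual_addE.
apply: le_trans (ler_rnormD (_ : F^o) _) _.
by apply: lerD; exact: dnorm_on_ge.
Qed.

Lemma dnormN f : dnorm (- f) = dnorm f.
Proof.
by rewrite /dnorm /dnorm_on; congr sup; apply: eq_imagel => x _;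
    rewrite dual_oppE (rnormN (f x : F^o)).
Qed.

Lemma dnorm_zero : dnorm (0 : dual E) = 0.
Proof.
apply/eqP; rewrite eq_le dnorm_ge0 andbT; apply: dnorm_on_le => // x _ _.
by rewrite dual_zeroE (rnorm0 F^o).
Qed.

Lemma dball_le (f : dball E) x : rnorm (dball_val f x) <= rnorm x.
Proof.
apply: le_trans (ler_dnorm _ _) _; rewrite ler_piMl ?rnorm_ge0//.
by have := set_valP f.
Qed.

Lemma dball_sre (f : dball E) x : `|sre (dball_val f x)| <= rnorm x.
Proof. exact: le_trans (normr_sre _) (dball_le f x). Qed.

Lemma continuous_eval x : continuous (fun f : dual E => f x : F^o).
Proof.
move=> f; have /pointwise_cvgP : {ptws, (@dual_fun R k E) @ nbhs f --> dual_fun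
    f}.
  exact: (@initial_continuous _ {ptws E -> F^o} (@dual_fun R k E : dual E ->
      {ptws E -> F^o})).
exact.
Qed.

Lemma continuous_dball_val : continuous (@dball_val R k E).
Proof. exact: initial_continuous. Qed.

Lemma cvg_dualP (T : Type) (G : set_system T) (FG : Filter G)
    (h : T -> dual E) f :
  (forall x, (h t x : F^o) @[t --> G] --> (f x : F^o)) -> h @ G --> f.
Proof.
move=> hx; apply: (cvg_initial (T := {ptws E -> F^o}) (f := @dual_fun R k E)).
by apply/pointwise_cvgP => x; exact: hx.
Qed.

Lemma cvg_dballP (T : Type) (G : set_system T) (FG : Filter G)
    (h : T -> dball E) (f : dball E) :
  (forall x, (dball_val (h t) x : F^o) @[t --> G] --> (dball_val f x : F^o)) ->
  h @ G --> f.
Proof.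
by move=> hx; apply: (cvg_initial (f := set_val)); exact: cvg_dualP.
Qed.

End DualFacts.

(** * Variation of a vector measure *)

(** Variations and [Wmu] come as bare set functions or plain measures; a bundled finite measure with
    the same underlying function carries the integrability lemmas. *)
Lemma finite_measure_of d (T : measurableType d) (R : realType)
    (m : {measure set T -> \bar R}) : (m setT < +oo)%E ->
  exists M : {finite_measure set T -> \bar R}, M = m :> (set T -> \bar R).
Proof.
move=> mT.
have mfin : fin_num_fun m.
  move=> A mA; rewrite ge0_fin_numE//; apply: le_lt_trans mT.
  by apply: le_measure; rewrite ?inE.
have msigma : sigma_finite setT m.
  by apply: fin_num_fun_sigma_finite mfin; rewrite measure0.
pose H1 := isFinite.Build _ _ _ m mfin.
pose H2 := isSFinite.Build _ _ _ m (sfinite_measure_sigma_finite msigma).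
pose H3 := isSigmaFinite.Build _ _ _ m msigma.
by exists (HB.pack_for (FiniteMeasure.type T R) (Measure.sort m) H1 H2 H3).
Qed.

Section Variation.
Context {R : realType} d {T : measurableType d} {V : zmodType}.
Variables (n : V -> R) (nu : set T -> V).
Hypothesis nD : forall v w, n (v + w) <= n v + n w.
Hypothesis nN : forall v, n (- v) = n v.
Hypothesis n_eq0 : forall v, n v = 0 <-> v = 0.
Hypothesis nu_sigma : forall A : nat -> set T, (forall i, measurable (A i)) ->
  trivIset setT A ->
  n (nu (\bigcup_i A i) - \sum_(i < m) nu (A i)) @[m --> \oo] --> (0 : R).
Let w := Defs.variation (n \o nu).
Hypothesis w_fin : (w setT < +oo)%E.

Lemma seminorm0 : n 0 = 0. Proof. exact/n_eq0. Qed.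

Lemma seminorm_ge0 v : 0 <= n v.
Proof.
have := nD v (- v); rewrite subrr seminorm0 nN; lra.
Qed.

(** Countable additivity along the constant sequence of empty sets: two consecutive remainders are
    both small and differ by [nu set0]. *)
Lemma vmeasure0 : nu set0 = 0.
Proof.
have h := nu_sigma (fun=> @measurable0 _ T) (@trivIset_set0 _ _ setT).
rewrite bigcup0// in h.
apply/n_eq0/eqP; rewrite eq_le seminorm_ge0 andbT.
apply/ler_addgt0Pr => e e0; rewrite add0r.
have e20 : 0 < e / 2 by rewrite divr_gt0.
have /cvgrPdist_lt/(_ _ e20)[N _ hN] := h.
have := hN N (leqnn N); have := hN N.+1 (leqnSn N) => /=.
rewrite !sub0r !normrN !ger0_norm ?seminorm_ge0// big_ord_recr /= => h1 h2.
set s := \sum_(i < N) _ in h1 h2.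
have -> : nu set0 = (nu set0 - s) - (nu set0 - (s + nu set0)).
  by rewrite opprB addrK subrK.
by apply: (le_trans (nD _ _)); rewrite nN; lra.
Qed.

Lemma vmeasureU A B : measurable A -> measurable B -> A `&` B = set0 ->
  nu (A `|` B) = nu A + nu B.
Proof.
rewrite trivIset_bigcup2 => mA mB AB.
have mAB i : measurable (bigcup2 A B i) by case: i => [|[|i]] /=.
have := nu_sigma mAB AB; rewrite bigcup2E => h.
apply/eqP; rewrite -subr_eq0; apply/eqP/n_eq0/eqP.
rewrite eq_le seminorm_ge0 andbT.
apply/ler_addgt0Pr => e e0; rewrite add0r.
(* The index [N.+2] is past N and past the two sets A and B; all later terms are empty. *)
have /cvgrPdist_lt/(_ _ e0)[N _ /(_ N.+2)] := h.
rewrite /= sub0r normrN ger0_norm ?seminorm_ge0//.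
have -> : \sum_(i < N.+2) nu (bigcup2 A B i) = nu A + nu B.
  rewrite !big_ord_recl /= big1 ?addr0// => i _.
  by rewrite vmeasure0.
by move=> /(_ (ltnW (leqnSn N.+1)))/ltW.
Qed.

Lemma vmeasure_split A B : measurable A -> measurable B ->
  nu A = nu (A `&` B) + nu (A `\` B).
Proof.
move=> mA mB; rewrite -vmeasureU ?setUIDK//; first exact: measurableI.
  exact: measurableD.
by apply/seteqP; split=> // t [[_ Bt] [_ /(_ Bt)]].
Qed.

Lemma variation_ge A : measurable A -> ((n (nu A))%:E <= w A)%E.
Proof.
move=> mA; apply: ereal_sup_ubound; exists 1%N, (fun=> A); split=> //.
- by move=> i j /=; rewrite !ltnS !leqn0 => /eqP-> /eqP->.
- by move=> t [].
- by rewrite big_ord1.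
Qed.

Lemma variation_ge0 A : (0 <= w A)%E.
Proof.
apply: ereal_sup_ubound; exists 0%N, (fun=> set0); split=> //.
- by move=> t [].
- by rewrite big_ord0.
Qed.

Lemma le_variation A B : A `<=` B -> (w A <= w B)%E.
Proof.
move=> AB; apply: ereal_sup_le => _ [m [C [mC tC CA ->]]].
by exists m, C; split=> //; exact: subset_trans AB.
Qed.

Lemma variation_fin A : w A \is a fin_num.
Proof.
rewrite ge0_fin_numE ?variation_ge0//.
exact: le_lt_trans (le_variation (@subsetT _ A)) w_fin.
Qed.

Lemma variation_superadd A B : A `&` B = set0 -> (w A + w B <= w (A `|` B))%E.
Proof.
move=> AB; rewrite -leeBrDr ?variation_fin//.
apply: ge_ereal_sup => _ [m [C [mC tC CA ->]]].
rewrite leeBrDr ?variation_fin// addeC -leeBrDr//.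
apply: ge_ereal_sup => _ [p [D [mD tD DB ->]]].
rewrite leeBrDr// -EFinD; apply: ereal_sup_ubound.
exists (m + p)%N, (fun i => if (i < m)%N then C i else D (i - m)%N); split.
- move=> i; case: (ltnP i m) => [im _|mi imp]; first exact: mC.
  by apply: mD; rewrite ltn_subLR.
- have CD i j : (i < m)%N -> (m <= j)%N -> (j < m + p)%N ->
      C i `&` D (j - m)%N !=set0 -> False.
    move=> im mj jmp [t [Ct Dt]].
    rewrite -[False]/((set0 : set T) t) -AB; split.
      by apply: CA; exists i.
    by apply: DB; exists (j - m)%N => //=; rewrite ltn_subLR.
  move=> i j /= imp jmp; case: (ltnP i m) => im; case: (ltnP j m) => jm h.
  + exact: tC.
  + by have := CD _ _ im jm jmp h.
  + by rewrite setIC in h; have := CD _ _ jm im imp h.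
  + have := tD (i - m)%N (j - m)%N.
    by rewrite /= !ltn_subLR// => /(_ imp jmp h); lia.
- move=> t [i /= imp]; case: (ltnP i m) => im h; [left; apply: CA|right;
    apply: DB].
    by exists i.
  by exists (i - m)%N => //=; rewrite ltn_subLR.
- rewrite big_split_ord /= addrC; congr (_ + _)%:E; apply: eq_bigr => i _ //=.
    by rewrite ltnNge leq_addr /= addKn.
  by rewrite ltn_ord.
Qed.

Lemma variation_set0 : w set0 = 0%E.
Proof.
apply/eqP; rewrite eq_le variation_ge0 andbT.
apply: ge_ereal_sup => _ [m [C [mC tC CA ->]]].
rewrite lee_fin big1// => i _ /=.
have -> : C i = set0 by rewrite -subset0 => t Ct; apply: CA; exists i => //=.
by rewrite vmeasure0 seminorm0.
Qed.

Lemma variation_bigcup_ge (A : nat -> set T) m : trivIset setT A ->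
  (\sum_(i < m) w (A i) <= w (\bigcup_i A i))%E.
Proof.
move=> tA; apply: (@le_trans _ _ (w (\bigcup_(i < m) A i))); last first.
  by by apply: le_variation => t [i _ Ait]; exists i.
elim: m => [|m ih]; first by rewrite big_ord0 variation_ge0.
rewrite big_ord_recr /= bigcup_mkord big_ord_recr -bigcup_mkord /=.
apply: le_trans (variation_superadd _); first exact: leeD2r.
rewrite -subset0 => t [[i /= im Ait] Amt].
have := tA i m I I (ex_intro _ t (conj Ait Amt)); lia.
Qed.

(** Each piece C j of a finite family is cut along the A i: the norms of the cut pieces are counted
    by the variations of the A i, and what countable additivity leaves over tends to 0. *)
Lemma variation_bigcup_le (A : nat -> set T) : (forall i, measurable (A i)) ->
  trivIset setT A -> (w (\bigcup_i A i) <= \sum_(i <oo) w (A i))%E.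
Proof.
move=> mA tA; apply: ge_ereal_sup => _ [m [C [mC tC CA ->]]].
have [S SE] : exists S : R, (\sum_(i <oo) w (A i))%E = S%:E.
  exists (fine (\sum_(i <oo) w (A i))%E); rewrite fineK// ge0_fin_numE;
      last first.
    by apply: nneseries_ge0 => *; exact: variation_ge0.
  apply: le_lt_trans w_fin; apply: le_trans (le_variation (@subsetT _
      (\bigcup_i A i))).
  apply: lime_le; first by apply: is_cvg_nneseries => *; exact: variation_ge0.
  by apply: nearW => N; rewrite big_mkord; exact: variation_bigcup_ge.
rewrite SE lee_fin; apply/ler_addgt0Pr => e e0.
(* Only finitely many C j occur, so one N makes the sum of all their remainders smaller than e. *)
have hN : \forall N \near \oo, \sum_(j < m)
    n (nu (C j) - \sum_(i < N) nu (C j `&` A i)) < e.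
  have : \sum_(j < m) n (nu (C j) - \sum_(i < N) nu (C j `&` A i)) @[N --> \oo]
      --> \sum_(j < m) (0 : R).
    apply: cvg_big => [|j _]; first exact: (@add_continuous R).
    have jm := mC j (ltn_ord j).
    have := @nu_sigma (fun i => C j `&` A i) _ _.
    rewrite -setI_bigcupr setIidl; last first.
      by apply: subset_trans CA => t Ct; exists j => //=.
    apply; first by move=> i; exact: measurableI.
    exact: trivIset_setIl.
  rewrite big1// => /cvgrPdist_lt/(_ _ e0).
  apply: filterS => N; rewrite sub0r normrN; exact: le_lt_trans (ler_norm _).
near \oo => N.
have hNe : \sum_(j < m) n (nu (C j) - \sum_(i < N) nu (C j `&` A i)) < e.
  by near: N; exact: hN.
have S_ge : \sum_(i < N) \sum_(j < m) n (nu (C j `&` A i)) <= S.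
  rewrite -lee_fin -SE; apply: le_trans (nneseries_lim_ge N _); last first.
    by move=> *; exact: variation_ge0.
  rewrite big_mkord -sumEFin; apply: lee_sum => i _.
  apply: ereal_sup_ubound; exists m, (fun j => C j `&` A i); split=> //.
  - by move=> j jm; apply: measurableI => //; exact: mC.
  - exact: trivIset_setIr.
  - by move=> t [j _ []].
rewrite exchange_big /= in S_ge.
apply: (le_trans _ (lerD S_ge (ltW hNe))); rewrite -big_split /=.
apply: ler_sum => j _.
set s := \sum_(i < N) nu (C j `&` A i).
have /= -> : n (nu (C j)) = n (s + (nu (C j) - s)) by rewrite addrC subrK.
apply: le_trans (nD _ _) _; rewrite lerD2r {}/s.
apply: (big_ind2 (fun v r => n v <= r)) => [|x1 x2 y1 y2 h1 h2|i _ //].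
  by rewrite seminorm0.
exact: le_trans (nD _ _) (lerD h1 h2).
Unshelve. all: by end_near. Qed.

Lemma variation_measure :
  exists M : {finite_measure set T -> \bar R}, M = w :> (set T -> \bar R).
Proof.
have w_sigma : semi_sigma_additive w.
  move=> A mA tA _.
  have -> : w (\bigcup_i A i) = (\sum_(i <oo) w (A i))%E.
    apply/eqP; rewrite eq_le variation_bigcup_le//=.
    apply: lime_le; first by apply: is_cvg_nneseries => *; exact: variation_ge0.
    by apply: nearW => N; rewrite big_mkord; exact: variation_bigcup_ge.
  by apply: is_cvg_nneseries => *; exact: variation_ge0.
pose H1 := isMeasure.Build _ _ _ _ variation_set0 variation_ge0 w_sigma.
pose M := HB.pack_for (Measure.type T R) w H1.
exact: (@finite_measure_of _ _ _ M).
Qed.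

End Variation.

(** * Bounded almost everywhere measurable functions *)

Section AeIntegral.
Context d {T : measurableType d} {R : realType}.
Variable m : {measure set T -> \bar R}.
Local Open Scope ereal_scope.
Import HBNNSimple.

(* No measurability is assumed: the integral of a nonnegative function is the
   supremum of the integrals of the measurable simple functions below it. *)
Lemma ge0_ae_le_integral (f g : T -> \bar R) :
  (forall t, 0 <= f t) -> (forall t, 0 <= g t) ->
  {ae m, forall t, f t = g t} -> \int[m]_t f t <= \int[m]_t g t.
Proof.
move=> f0 g0 [N [mN N0 fgN]].
rewrite [leLHS]ge0_integralTE//; apply: ge_ereal_sup => _ [h hf <-].
rewrite [leRHS]ge0_integralTE//; apply: ereal_sup_ubound.
(* Multiplying [h] by the indicator of the complement of the null set N keeps its integral and puts
   it below [g] everywhere. *)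
exists (proj_nnsfun h (measurableC mN)).
  move=> t /=; have [Nt|Nt] := pselect (N t).
    by rewrite mindicE memNset ?mulr0 ?g0//= => /(_ Nt).
  rewrite mindicE mem_set// mulr1; apply: le_trans (hf t) _.
  suff -> : f t = g t by [].
  by apply: contrapT => fgt; apply: Nt; exact: fgN.
rewrite -!integralT_nnsfun; apply: ge0_ae_eq_integral => //.
- by apply/measurable_EFinP; exact: measurable_funPT.
- by apply/measurable_EFinP; exact: measurable_funPT.
- by move=> x _; rewrite lee_fin.
- by move=> x _; rewrite lee_fin.
- exists N; split=> // t /= ht; apply: contrapT => Nt; apply: ht => _ /=.
  by rewrite mindicE mem_set// mulr1.
Qed.

Lemma ae_eq_integralT (f g : T -> \bar R) :
  {ae m, forall t, f t = g t} -> \int[m]_t f t = \int[m]_t g t.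
Proof.
move=> fg; have gf : {ae m, forall t, g t = f t} by apply: filterS fg.
rewrite integralE [RHS]integralE; congr (_ - _); apply/eqP; rewrite eq_le.
  apply/andP; split; apply: ge0_ae_le_integral => //;
      [apply: filterS fg|apply: filterS gf].
    by move=> t; rewrite !funeposE => ->.
  by move=> t; rewrite !funeposE => ->.
apply/andP; split; apply: ge0_ae_le_integral => //;
    [apply: filterS fg|apply: filterS gf].
  by move=> t; rewrite !funenegE => ->.
by move=> t; rewrite !funenegE => ->.
Qed.

End AeIntegral.

Section BoundedAeMeasurable.
Context d {T : measurableType d} {R : realType}.
Variable m : {finite_measure set T -> \bar R}.
Implicit Types (f g : T -> R) (A : set T) (r : R).

Definition aem f :=
  exists2 g, measurable_fun setT g & {ae m, forall t, f t = g t}.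

(* Bounded and measurable for the completion of m; the Lebesgue integral is then
   computed on a Borel version. *)
Definition bam f := (exists B : R, forall t, `|f t| <= B) /\ aem f.

Lemma aem_measurable f : measurable_fun setT f -> aem f.
Proof. by move=> mf; exists f => //; exact: nearW. Qed.

Lemma aem_comp (u : R -> R) f : measurable_fun setT u -> aem f -> aem (u \o f).
Proof.
move=> mu [f' mf' ff']; exists (u \o f'); first exact: measurableT_comp.
by apply: filterS ff' => t /= ->.
Qed.

Lemma aem_comp2 (u : R * R -> R) f g : measurable_fun setT u ->
  aem f -> aem g -> aem (fun t => u (f t, g t)).
Proof.
move=> mu [f' mf' ff'] [g' mg' gg']; exists (fun t => u (f' t, g' t)).
  by apply: (measurableT_comp mu); exact: measurable_fun_pair.
by apply: filterS2 ff' gg' => t /= -> ->.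
Qed.

Local Notation I f := (\int[m]_t f t).

Lemma bam_version f : bam f -> exists g (B : R), [/\ measurable_fun setT g,
  (forall t, `|g t| <= B) & {ae m, forall t, f t = g t}].
Proof.
move=> [[B fB] [g mg fg]]; exists (fun t => Num.max (- B) (Num.min B (g t))),
    `|B|.
split.
- by apply: measurable_maxr => //; exact: measurable_minr.
- move=> t; have B0 := le_trans (normr_ge0 _) (fB t).
  rewrite (ger0_norm B0) ler_norml le_max lexx /= ge_max ge_min lexx andbT.
  by rewrite (le_trans _ B0)// oppr_le0.
- apply: filterS fg => t fg; have := fB t;
    rewrite -fg ler_norml => /andP[h1 h2].
  by rewrite min_r// max_r.
Qed.

Lemma bam_measurable f (B : R) : (forall t, `|f t| <= B) ->
  measurable_fun setT f -> bam f.
Proof. by move=> fB mf; split; [exists B|exists f => //; exact: nearW]. Qed.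

Lemma bam_cst r : bam (fun=> r).
Proof. exact: (@bam_measurable _ `|r|). Qed.

Lemma bam_indic A : measurable A -> bam (\1_A).
Proof.
move=> mA; apply: (@bam_measurable _ 1); last exact: measurable_indic.
by move=> t; rewrite indicE; case: (_ \in _); rewrite ?normr1 ?normr0.
Qed.

Lemma bamD f g : bam f -> bam g -> bam (fun t => f t + g t).
Proof.
move=> [[B fB] [f' mf' ff']] [[C gC] [g' mg' gg']]; split.
  by exists (B + C) => t; apply: le_trans (ler_normD _ _) _; exact: lerD.
exists (f' \+ g'); first exact: measurable_funD.
by apply: filterS2 ff' gg' => t /= -> ->.
Qed.

Lemma bamM f g : bam f -> bam g -> bam (fun t => f t * g t).
Proof.
move=> [[B fB] [f' mf' ff']] [[C gC] [g' mg' gg']]; split.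
  by exists (B * C) => t; rewrite normrM; exact: ler_pM.
exists (f' \* g'); first exact: measurable_funM.
by apply: filterS2 ff' gg' => t /= -> ->.
Qed.

Lemma bamZ r f : bam f -> bam (fun t => r * f t).
Proof. by move=> bf; apply: bamM => //; exact: bam_cst. Qed.

Lemma bamN f : bam f -> bam (fun t => - f t).
Proof.
by move=> /(bamZ (-1)) h; under eq_fun do rewrite -mulN1r.
Qed.

Lemma bamB f g : bam f -> bam g -> bam (fun t => f t - g t).
Proof. by move=> bf bg; apply: bamD => //; exact: bamN. Qed.

Lemma bam_min f g : bam f -> bam g -> bam (fun t => Num.min (f t) (g t)).
Proof.
move=> [[B fB] [f' mf' ff']] [[C gC] [g' mg' gg']]; split.
  exists (Num.max B C) => t; rewrite le_max.
  by rewrite /Num.min; case: ifP => _; rewrite ?fB ?gC ?orbT.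
exists (fun t => Num.min (f' t) (g' t)); first exact: measurable_minr.
by apply: filterS2 ff' gg' => t /= -> ->.
Qed.

Lemma bam_norm f : bam f -> bam (fun t => `|f t|).
Proof.
move=> [[B fB] [f' mf' ff']]; split; first by exists B => t; rewrite normr_id.
by exists (Num.norm \o f'); [exact: measurableT_comp|apply: filterS ff' => t /=
    ->].
Qed.

(** Borel versions of the [f n] agree with them off one common null set N. Set to 0 on N, they
    converge everywhere, and their limit is a version of [g]. *)
Lemma bam_lim (f : nat -> T -> R) g (B : R) : (forall n, bam (f n)) ->
  (forall t, `|g t| <= B) -> (forall t, f n t @[n --> \oo] --> g t) -> bam g.
Proof.
move=> bf gB fg; split; first by exists B.
have /choice[f' hf'] : forall n, exists h, measurable_fun setT h /\
    {ae m, forall t, f n t = h t}.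
  by move=> n; have [_ [h mh fh]] := bf n; exists h.
have hae : {ae m, forall t, forall n, f n t = f' n t}.
  by apply: ae_foralln => n; have [] := hf' n.
case: hae => N [mN N0 hN].
pose h n := (f' n) \_ (~` N).
exists (g \_ (~` N)).
  apply: (@measurable_fun_cvg _ _ _ setT h) => [n|t _].
    apply: (measurable_restrictT (f' n) (measurableC mN)).1.
    by have [mf' _] := hf' n; exact: measurable_funTS.
  rewrite /h /patch; case: ifPn => tN; last exact: cvg_cst.
  have Nt : forall n, f n t = f' n t.
    by apply: contrapT => ht; have := set_mem tN; apply; exact: hN.
  by under eq_fun do rewrite -Nt; exact: fg.
exists N; split=> // t /= ht; apply: contrapT => Nt; apply: ht.
by rewrite patchE mem_set.
Qed.

Lemma integrable_version g (B : R) : measurable_fun setT g ->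
  (forall t, `|g t| <= B) -> m.-integrable setT (EFin \o g).
Proof.
move=> mg gB; apply: measurable_bounded_integrable => //.
  by rewrite -ge0_fin_numE// fin_num_measure.
exists B; split; first by rewrite num_real.
by move=> x Bx t _ /=; apply: le_trans (gB t) (ltW Bx).
Qed.

Lemma Rintegral_ae f g : {ae m, forall t, f t = g t} -> I f = I g.
Proof.
move=> fg; rewrite /Rintegral (@ae_eq_integralT _ _ _ m _ (fun t => (g
    t)%:E))//.
by apply: filterS fg => t ->.
Qed.

Lemma bam_integralE f : bam f -> (\int[m]_t (f t)%:E)%E = (I f)%:E.
Proof.
move=> /bam_version[g [B [mg gB fg]]].
rewrite /Rintegral (@ae_eq_integralT _ _ _ m _ (fun t => (g t)%:E)); last first.
  by apply: filterS fg => t ->.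
rewrite fineK//; apply: integrable_fin_num => //; exact: integrable_version gB.
Qed.

Lemma RintegralD_bam f g : bam f -> bam g -> I (fun t => f t + g t) = I f + I g.
Proof.
move=> /bam_version[f' [B [mf' fB ff']]] /bam_version[g' [C [mg' gC gg']]].
rewrite (Rintegral_ae ff') (Rintegral_ae gg') -RintegralD//; last 2 first.
- exact: integrable_version fB.
- exact: integrable_version gC.
by apply: Rintegral_ae; apply: filterS2 ff' gg' => t -> ->.
Qed.

Lemma RintegralZ_bam r f : bam f -> I (fun t => r * f t) = r * I f.
Proof.
move=> /bam_version[f' [B [mf' fB ff']]].
rewrite (Rintegral_ae ff') -RintegralZl//; last exact: integrable_version fB.
by apply: Rintegral_ae; apply: filterS ff' => t ->.
Qed.

Lemma RintegralN_bam f : bam f -> I (fun t => - f t) = - I f.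
Proof.
move=> bf; rewrite -mulN1r -RintegralZ_bam//.
by apply: eq_Rintegral => t _; rewrite mulN1r.
Qed.

Lemma RintegralB_bam f g : bam f -> bam g -> I (fun t => f t - g t) = I f - I g.
Proof. by move=> bf bg; rewrite RintegralD_bam ?RintegralN_bam//;
    exact: bamN. Qed.

Lemma Rintegral_sum_bam n (f : nat -> T -> R) : (forall i, bam (f i)) ->
  bam (fun t => \sum_(i < n) f i t) /\
  I (fun t => \sum_(i < n) f i t) = \sum_(i < n) I (f i).
Proof.
move=> bf; elim: n => [|n [b ih]].
  rewrite big_ord0; split.
    by under eq_fun do rewrite big_ord0; exact: bam_cst.
  by under eq_Rintegral do rewrite big_ord0; rewrite Rintegral_cst// mul0r.
split; first by under eq_fun do rewrite big_ord_recr /=; exact: bamD.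
under eq_Rintegral do rewrite big_ord_recr /=.
by rewrite RintegralD_bam// ih big_ord_recr.
Qed.

Lemma ae_le_Rintegral f g : bam f -> bam g ->
  {ae m, forall t, f t <= g t} -> I f <= I g.
Proof.
move=> bf bg fg; rewrite -subr_ge0 -RintegralB_bam//.
(* The positive part changes the integrand on a null set only and makes it nonnegative at every
   point. *)
have -> : I (fun t => g t - f t) = I (fun t => Num.max 0 (g t - f t)).
  by apply: Rintegral_ae; apply: filterS fg => t fg; rewrite max_r// subr_ge0.
by apply: Rintegral_ge0 => t _; rewrite le_max lexx.
Qed.

Lemma le_Rintegral_bam f g : bam f -> bam g -> (forall t, f t <= g t) -> I f <=
    I g.
Proof. by move=> bf bg fg; apply: ae_le_Rintegral => //; exact: nearW. Qed.

Lemma le_norm_Rintegral_bam f : bam f -> `|I f| <= I (fun t => `|f t|).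
Proof.
move=> bf; rewrite ler_norml -RintegralN_bam; last exact: bam_norm.
have bnf := bam_norm bf; apply/andP; split; apply: le_Rintegral_bam => //.
- exact: bamN.
- by move=> t; rewrite lerNl -normrN ler_norm.
- by move=> t; rewrite ler_norm.
Qed.

Lemma Rintegral_indic_bam A : measurable A -> I (\1_A) = fine (m A).
Proof. by move=> mA; rewrite /Rintegral integral_indic// setIT. Qed.

Lemma dominated_Rintegral (f : nat -> T -> R) g (B : R) : (forall n, bam (f n))
    ->
  (forall n t, `|f n t| <= B) -> (forall t, `|g t| <= B) ->
  (forall t, f n t @[n --> \oo] --> g t) ->
  I (f n) @[n --> \oo] --> I g.
Proof.
move=> bf fB gB fg.
have bg := bam_lim bf gB fg.
have /choice[f' hf'] : forall n, exists h, measurable_fun setT h /\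
    {ae m, forall t, f n t = h t}.
  by move=> n; have [_ [h mh fh]] := bf n; exists h.
have hae : {ae m, forall t, forall n, f n t = f' n t}.
  by apply: ae_foralln => n; have [] := hf' n.
have [_ [g' mg' gg']] := bg.
have [|||||_ _ h] := @dominated_convergence _ T R m setT measurableT
    (fun n => EFin \o f' n) (EFin \o g') (cst B%:E).
- by move=> n; apply/measurable_EFinP; have [] := hf' n.
- exact/measurable_EFinP.
- apply: filterS2 hae gg' => t ht gt _ /=; rewrite -gt.
  apply: cvg_EFin; first exact: nearW.
  by under eq_fun do rewrite /= -ht; exact: fg.
- apply: measurable_bounded_integrable => //.
    by rewrite -ge0_fin_numE// fin_num_measure.
  exact: bounded_cst.
- by apply: filterS hae => t ht n _ /=; rewrite -ht lee_fin.
have -> : (fun n => I (f n)) = fine \o (fun n => \int[m]_t (EFin \o f' n) t)%E.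
  by apply/funext => n; apply: Rintegral_ae; have [] := hf' n.
rewrite (Rintegral_ae gg').
apply: (@fine_cvg _ _ _ _ (fun n => \int[m]_t (EFin \o f' n) t)%E).
rewrite /Rintegral fineK; first exact: h.
have [g2 [C [mg2 gC gg2]]] := bam_version bg.
rewrite (@ae_eq_integralT _ _ _ m _ (fun t => (g2 t)%:E)).
  by apply: integrable_fin_num => //; exact: integrable_version gC.
by apply: filterS2 gg' gg2 => t <- <-.
Qed.

(** The test set is the one where a Borel version g is positive: the nonnegative function equal to g
    there and 0 elsewhere has integral at most 0, so it vanishes almost everywhere. *)
Lemma ae_le0 f : bam f ->
  (forall A, measurable A -> I (fun t => \1_A t * f t) <= 0) ->
  {ae m, forall t, f t <= 0}.
Proof.
move=> /bam_version[g [B [mg gB fg]]] h.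
have mA : measurable [set t | 0 < g t].
  by rewrite -[X in measurable X]setTI; exact: measurable_fun_ltr.
have h0 := h _ mA.
have bg : bam (fun t => \1_[set t | 0 < g t] t * g t).
  by apply: bamM; [exact: bam_indic|exact: bam_measurable gB mg].
have g0 t : 0 <= \1_[set t | 0 < g t] t * g t.
  rewrite indicE; have [gt|gt] := pselect (0 < g t).
    by rewrite mem_set// mul1r ltW.
  by rewrite memNset// mul0r.
have : {ae m, forall t, setT t -> (\1_[set t | 0 < g t] t * g t)%:E = 0%E}.
  apply/(@ae_eq_integral_abs _ _ _ m _ measurableT (fun t => (\1_[set t | 0 < g
      t] t * g t)%:E)).
    apply/measurable_EFinP; apply: measurable_funM => //;
        exact: measurable_indic.
  under eq_integral do rewrite gee0_abs ?lee_fin//.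
  rewrite bam_integralE//; congr (_%:E); apply/eqP;
      rewrite eq_le Rintegral_ge0// andbT.
  rewrite -(@Rintegral_ae (fun t => \1_[set t | 0 < g t] t * f t))//.
  by apply: filterS fg => t ->.
apply: filterS2 fg => t -> /(_ Logic.I)[]; rewrite indicE leNgt.
have [gt|//] := boolP (0 < g t).
by rewrite mem_set// mul1r => g0t; rewrite g0t ltxx in gt.
Qed.

(** [f] and the indicator of A differ only on U minus C, by at most 1. The sets C' and U' come from
    the regularity of one measure; C and U may be closer to A, so that the same [f] serves a second
    measure too. *)
Lemma Rintegral_separator f A C U C' U' (e : R) :
  measurable_fun setT f -> (forall t, 0 <= f t <= 1) ->
  (forall t, C t -> f t = 1) -> (forall t, ~ U t -> f t = 0) ->
  measurable A -> measurable C' -> measurable U' ->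
  C `<=` A -> A `<=` U -> C' `<=` C -> U `<=` U' -> (m (U' `\` C') < e%:E)%E ->
  I (fun t => `|f t - \1_A t|) <= e.
Proof.
move=> mf f01 f1 f0 mA mC' mU' CA AU CC UU me.
have mUC : measurable (U' `\` C') by exact: measurableD.
apply: (@le_trans _ _ (fine (m (U' `\` C')))); last first.
  by apply: ltW; rewrite -lte_fin fineK// fin_num_measure.
have bf : bam f.
  apply: (@bam_measurable _ 1) => // t.
  by have /andP[? ?] := f01 t; rewrite ger0_norm.
rewrite -Rintegral_indic_bam//; apply: le_Rintegral_bam.
- by apply: bam_norm; apply: bamB => //; exact: bam_indic.
- exact: bam_indic.
move=> t; have /andP[ft0 ft1] := f01 t; rewrite !indicE.
have [Ct|Ct] := pselect (C t).
  by rewrite f1// (mem_set (CA _ Ct)) subrr normr0 ler0n.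
have [Ut|Ut] := pselect (U t).
  have UCt : (U' `\` C') t by split; [exact: UU|move=> /CC].
  by rewrite (mem_set UCt) ler_norml; case: (_ \in _) => /=; lra.
by rewrite f0// (memNset (fun h => Ut (AU _ h))) subrr normr0 ler0n.
Qed.

End BoundedAeMeasurable.

(** * Integration against a vector measure *)

Section Layers.
Context {R : realType} {T : Type}.

(** The sum counts the integers from 1 to N that are at most x. It is the integer part of x, except
    at x = N + 1, where it is N; hence the non-strict upper bound. *)
Lemma count_le (N : nat) (x : R) : 0 <= x -> x <= N.+1%:R ->
  let c := \sum_(j < N) (j.+1%:R <= x)%R%:R in c <= x <= c + 1.
Proof.
elim: N => [|N ih] x0 xN /=; first by rewrite big_ord0 x0 add0r.
rewrite big_ord_recr /=; case: (leP N.+1%:R x) => Nx; last first.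
  by rewrite addr0; apply: ih => //; exact: ltW.
have -> : \sum_(j < N) (j.+1%:R <= x)%R%:R = N%:R :> R.
  rewrite (eq_bigr (fun=> 1)); last first.
    move=> j _; rewrite (le_trans _ Nx)// ler_nat ltnS.
    exact: ltnW (ltn_ord j).
  by rewrite sumr_const card_ord.
by rewrite natr1 Nx /= natr1.
Qed.

(** For values in [0, 1], the indicators of the layers j < N + 1, summed and divided by N + 1, round
    f down to a multiple of 1/(N + 1). *)
Definition layer (f : T -> R) (N j : nat) : set T :=
  [set t | j.+1%:R / N.+1%:R <= f t].

Lemma layer_approx (f : T -> R) N t : 0 <= f t <= 1 ->
  `|f t - \sum_(j < N.+1) N.+1%:R^-1 * \1_(layer f N j) t| <= N.+1%:R^-1.
Proof.
move=> /andP[f0 f1].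
have N0 : 0 < N.+1%:R :> R by rewrite ltr0n.
have := @count_le N.+1 (N.+1%:R * f t); rewrite mulr_ge0// => /(_ isT).
rewrite /= => /(_ _)/andP[].
  by rewrite (@le_trans _ _ N.+1%:R)// ?ler_nat// ler_piMr.
have -> : \sum_(j < N.+1) (j.+1%:R <= N.+1%:R * f t)%R%:R =
          N.+1%:R * \sum_(j < N.+1) N.+1%:R^-1 * \1_(layer f N j) t :> R.
  rewrite big_distrr /=; apply: eq_bigr => j _.
  rewrite mulVKf ?gt_eqF// indicE /layer; congr (nat_of_bool _)%:R.
  rewrite -ler_pdivrMl// mulrC.
  by apply/idP/idP; [move/mem_set|move/set_mem].
set s := \sum_(_ < _) _ => h1 h2.
rewrite ler_norml; apply/andP; split.
  by rewrite -(ler_pM2l N0) mulrN mulfV ?gt_eqF// mulrBr; lra.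
by rewrite -(ler_pM2l N0) mulfV ?gt_eqF// mulrBr; lra.
Qed.

End Layers.

Lemma measurable_layer d (T : measurableType d) (R : realType) (f : T -> R) N j
    :
  measurable_fun setT f -> measurable (layer f N j).
Proof.
by move=> mf; rewrite -[X in measurable X]setTI; exact: measurable_fun_ler.
Qed.

(** Concatenation of m terms of [f] with [g]. It turns the difference of two simple functions, with
    unrelated sets, into a single simple function to which [simple_boundT] applies. *)
Definition glue T m (f g : nat -> T) (i : nat) : T :=
  if (i < m)%N then f i else g (i - m)%N.

Lemma big_glue S T (V : nmodType) m p (G : S -> T -> V) (a b : nat -> S)
    (x y : nat -> T) :
  \sum_(i < m + p) G (glue m a b i) (glue m x y i) =
  \sum_(i < m) G (a i) (x i) + \sum_(i < p) G (b i) (y i).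
Proof.
rewrite big_split_ord /=; congr (_ + _); apply: eq_bigr => i _.
  by rewrite /glue ltn_ord.
by rewrite /glue ltnNge leq_addr /= addKn.
Qed.

Section VectorIntegral.
Context {R : realType} {k : scalar_kind} {X : ptopologicalType}.
Local Notation F := (sfield R k).
Context {V : zmodType} {W : normedModType F}.
Variables (n : V -> R) (nu : set (borel X) -> V) (pair : V -> W -> F).
Hypothesis nD : forall v w, n (v + w) <= n v + n w.
Hypothesis nN : forall v, n (- v) = n v.
Hypothesis n_eq0 : forall v, n v = 0 <-> v = 0.
Hypothesis nu_reg : is_regular_measure n nu.
Hypothesis pairDl : forall v1 v2 w, pair (v1 + v2) w = pair v1 w + pair v2 w.
Hypothesis pairDr : forall v w1 w2, pair v (w1 + w2) = pair v w1 + pair v w2.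
Hypothesis pair_le : forall v w, rnorm (pair v w : F^o) <= n v * rnorm w.
Variable M : {finite_measure set (borel X) -> \bar R}.
Hypothesis ME : M = Defs.variation (n \o nu) :> (set (borel X) -> \bar R).

Let nu_sigma := let: And3 h _ _ := nu_reg in h.
Let nu_fin := let: And3 _ h _ := nu_reg in h.

Lemma n_le_variation A : measurable A -> n (nu A) <= fine (M A).
Proof.
move=> mA; rewrite -lee_fin fineK ?fin_num_measure// ME.
exact: variation_ge.
Qed.

(* The sets A j may overlap: splitting D along A m replaces w0 by w0 + x m on
   one of the two pieces. *)
Lemma simple_bound m (A : nat -> set (borel X)) (x : nat -> W) D w0 b :
  measurable D -> (forall j, measurable (A j)) -> bam M b ->
  (forall t, D t -> rnorm (w0 + \sum_(j < m) (\1_(A j) t : F) *: x j) <= b t) ->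
  rnorm (pair (nu D) w0 + \sum_(j < m) pair (nu (A j `&` D)) (x j) : F^o) <=
    \int[M]_t (\1_D t * b t).
Proof.
move=> mD mA bb; elim: m D mD w0 => [|m ih] D mD w0 h.
  rewrite big_ord0 addr0; apply: le_trans (pair_le _ _) _.
  rewrite mulrC; apply: le_trans (ler_wpM2l (rnorm_ge0 _) (n_le_variation mD))
      _.
  rewrite -Rintegral_indic_bam// -RintegralZ_bam; last exact: bam_indic.
  apply: le_Rintegral_bam; [exact/bamZ/bam_indic|by apply: bamM => //;
      exact: bam_indic|].
  move=> t; rewrite indicE; have [Dt|Dt] := pselect (D t).
    by rewrite mem_set// mulr1 mul1r; have := h _ Dt; rewrite big_ord0 addr0.
  by rewrite memNset// mulr0 mul0r.
have mD1 : measurable (D `&` A m) by exact: measurableI.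
have mD2 : measurable (D `\` A m) by exact: measurableD.
have := ih _ mD2 w0; have := ih _ mD1 (w0 + x m).
move=> ih1 ih2.
have {}ih1 := ih1 _; have {}ih2 := ih2 _.
have -> : \int[M]_t (\1_D t * b t) =
    \int[M]_t (\1_(D `&` A m) t * b t) + \int[M]_t (\1_(D `\` A m) t * b t).
  rewrite -RintegralD_bam; [|by apply: bamM => //; exact: bam_indic..].
  apply: eq_Rintegral => t _; rewrite -mulrDl; congr (_ * _).
  rewrite !indicE in_setI in_setD.
  by case: (_ \in D); case: (_ \in _) => /=; rewrite ?addr0 ?add0r.
have -> : pair (nu D) w0 + \sum_(j < m.+1) pair (nu (A j `&` D)) (x j) =
  (pair (nu (D `&` A m)) (w0 + x m) +
    \sum_(j < m) pair (nu (A j `&` (D `&` A m))) (x j)) +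
  (pair (nu (D `\` A m)) w0 +
    \sum_(j < m) pair (nu (A j `&` (D `\` A m))) (x j)).
  rewrite big_ord_recr /= (vmeasure_split nD nN n_eq0 nu_sigma mD (mA m))
      pairDl pairDr.
  rewrite (eq_bigr (fun j : 'I_m => pair (nu (A j `&` (D `&` A m))) (x j) +
      pair (nu (A j `&` (D `\` A m))) (x j))); last first.
    move=> j _; rewrite -pairDl; congr (pair _ _).
    have mAD : measurable (A j `&` D) by exact: measurableI.
    by rewrite (vmeasure_split nD nN n_eq0 nu_sigma mAD (mA m)) setIA setIDA.
  rewrite big_split /= [A m `&` D]setIC.
  set a := pair _ _; set a1 := pair _ _; set a2 := pair _ _.
  by set s1 := \sum_(_ < _) _; set s2 := \sum_(_ < _) _; ring.
apply: le_trans (ler_rnormD _ _) _; apply: lerD.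
  apply: ih1 => t [Dt At]; have := h t Dt;
      rewrite big_ord_recr /= indicE mem_set//.
  by rewrite scale1r addrA addrAC.
apply: ih2 => t [Dt At]; have := h t Dt; rewrite big_ord_recr /= [X in X *:
    _]indicE memNset//.
by rewrite scale0r addr0.
Qed.

Lemma simple_boundT m (A : nat -> set (borel X)) (x : nat -> W) b :
  (forall j, measurable (A j)) -> bam M b ->
  (forall t, rnorm (\sum_(j < m) (\1_(A j) t : F) *: x j) <= b t) ->
  rnorm (\sum_(j < m) pair (nu (A j)) (x j) : F^o) <= \int[M]_t b t.
Proof.
move=> mA bb h; have := @simple_bound m A x setT 0 b measurableT mA bb.
have -> : pair (nu setT) 0 = 0.
  by apply: (addrI (pair (nu setT) 0)); rewrite -pairDr !addr0.
rewrite add0r; under eq_bigr do rewrite setIT.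
have -> : \int[M]_t (\1_setT t * b t) = \int[M]_t b t.
  by apply: eq_Rintegral => t _; rewrite indicE in_setT mul1r.
by apply => t _; rewrite add0r; exact: h.
Qed.

(** The approximating simple functions of the integral are compared with the given one by
    [simple_boundT]. The case p = 0 bounds an integral by that of [b] against the variation; the
    case p = 1 compares an integral with the value of [nu] on a set. *)
Lemma integral_bound (f : X -> W) (v : F) p (C : nat -> set (borel X))
    (y : nat -> W) b :
  is_integral pair nu f v -> (forall j, measurable (C j)) -> bam M b ->
  (forall t, rnorm (f t - \sum_(j < p) (\1_(C j) t : F) *: y j) <= b t) ->
  rnorm (v - \sum_(j < p) pair (nu (C j)) (y j) : F^o) <= \int[M]_t b t.
Proof.
move=> [m [A [x [mA fx /cvg_rnormP vx]]]] mC bb h.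
have pairN v' w : pair v' (- w) = - pair v' w.
  have p0 : pair v' 0 = 0.
    by apply: (addrI (pair v' 0)); rewrite -pairDr !addr0.
  by apply/eqP; rewrite -addr_eq0 -pairDr addNr p0.
apply/ler_addgt0Pr => e e0.
pose c := fine (M setT); have c0 : 0 <= c by exact: fine_ge0.
(* The error e' occurs once in [v - S] and once integrated against the total mass c, which makes e'
   (c + 1) = e. *)
pose e' := e / (c + 1); have e'0 : 0 < e' by rewrite divr_gt0// ltr_pwDr.
near \oo => N.
have hf : forall t, rnorm (f t - \sum_(j < m N) (\1_(A N j) t : F) *: x N j) <=
    e'.
  by near: N; exact: fx.
have hv : rnorm (v - \sum_(j < m N) pair (nu (A N j)) (x N j) : F^o) < e'.
  by near: N; exact: vx.
set S := \sum_(j < m N) _ in hv; set S' := \sum_(j < p) _.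
have hb : rnorm (S - S' : F^o) <= \int[M]_t (b t + e').
  have -> : S - S' = \sum_(i < m N + p) pair (nu (glue (m N) (A N) C i))
      (glue (m N) (x N) (fun j => - y j) i).
    rewrite (big_glue _ _ (fun B z => pair (nu B) z)); congr (_ + _).
    by rewrite -sumrN; apply: eq_bigr => i _; rewrite pairN.
  apply: simple_boundT => [j||t]; first by rewrite /glue; case: ifP.
    by apply: bamD => //; exact: bam_cst.
  rewrite (big_glue _ _ (fun (B : set (borel X)) z => (\1_B t : F) *: z)).
  under [X in _ + X]eq_bigr do rewrite scalerN.
  rewrite sumrN; set s := \sum_(j < m N) _; set s' := \sum_(j < p) _.
  have -> : s - s' = (f t - s') + - (f t - s).
    by rewrite opprB [RHS]addrC addrA subrK.
  apply: le_trans (ler_rnormD _ _) _; rewrite rnormN.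
  by apply: lerD; [exact: h|exact: hf].
have -> : v - S' = (v - S) + (S - S') by rewrite addrA subrK.
apply: le_trans (ler_rnormD (v - S : F^o) _) _.
apply: le_trans (lerD (ltW hv) hb) _.
rewrite RintegralD_bam//; last exact: bam_cst.
rewrite Rintegral_cst// -/c addrCA lerD2l.
have -> : e = e' * (c + 1) by rewrite /e' divfK// gt_eqF// ltr_pwDr.
lra.
Unshelve. all: by end_near. Qed.

End VectorIntegral.

Section ScalarIntegral.
Context {R : realType} {k : scalar_kind} {X : ptopologicalType}.
Local Notation F := (sfield R k).
Variables (nu : set (borel X) -> F).
Hypothesis nu_reg : scalar_measure nu.
Variable M : {finite_measure set (borel X) -> \bar R}.
Hypothesis ME : M = svar nu :> (set (borel X) -> \bar R).

Lemma rnorm_seminorm : [/\ forall v w : F, rnorm (v + w : F^o) <= rnorm (v :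
    F^o) + rnorm (w : F^o),
  forall v : F, rnorm (- v : F^o) = rnorm (v : F^o) &
  forall v : F, rnorm (v : F^o) = 0 <-> v = 0].
Proof.
split; [exact: ler_rnormD|exact: rnormN|move=> v; split].
  exact: (@rnorm_eq0 _ _ F^o).
by move=> ->; exact: (rnorm0 F^o).
Qed.

(** [sintegral_of] takes the default value 0 when no integral exists, so existence has to be
    established. The layer sums approximate [f] uniformly, which by [simple_boundT] makes their
    integrals a Cauchy sequence. *)
Lemma scalar_integral_exists (f : X -> R) :
  measurable_fun setT (f : borel X -> R) -> (forall t, 0 <= f t <= 1) ->
  exists v : F, is_integral (W := F^o) *%R nu (fun t => sreal (f t)) v.
Proof.
move=> mf f01; have [nD nN n0] := rnorm_seminorm.
pose A N j := layer (f : borel X -> R) N j.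
have mA N j : measurable (A N j) by exact: measurable_layer.
pose x N (j : nat) : F^o := sreal N.+1%:R^-1.
pose s N : F := \sum_(j < N.+1) nu (A N j) * x N j.
have xA N t : rnorm (sreal (f t) - \sum_(j < N.+1) (\1_(A N j) t : F) *: x N j
    : F^o)
    <= N.+1%:R^-1.
  have -> : sreal (f t) - \sum_(j < N.+1) (\1_(A N j) t : F) *: x N j =
    sreal (f t - \sum_(j < N.+1) N.+1%:R^-1 * \1_(A N j) t) :> F^o.
    rewrite srealD srealN; congr (_ - _).
    rewrite (big_morph sreal (@srealD _ k) (@sreal0 _ k)).
    apply: eq_bigr => j _; rewrite srealM mulrC !indicE.
    by case: (_ \in _); rewrite ?sreal0 ?sreal1.
  by rewrite rnorm_sreal; exact: layer_approx.
have sN N N' : rnorm (s N - s N' : F^o) <= (N.+1%:R^-1 + N'.+1%:R^-1) * fine (M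
    setT).
  have pairDr (v w1 w2 : F) : v * (w1 + w2) = v * w1 + v * w2 by exact: mulrDr.
  have pair_le (v w : F) : rnorm (v * w : F^o) <= rnorm (v : F^o) * rnorm (w :
      F^o).
    by rewrite rnormM.
  have -> : s N - s N' = \sum_(i < N.+1 + N'.+1)
      nu (glue N.+1 (A N) (A N') i) * glue N.+1 (x N) (fun j => - x N' j) i.
    rewrite (big_glue _ _ (fun B z => nu B * z)); congr (_ + _).
    by rewrite -sumrN; apply: eq_bigr => i _; rewrite mulrN.
  rewrite -Rintegral_cst//.
  apply: (@simple_boundT R k X F F^o _ nu *%R nD nN n0 nu_reg
    (fun _ _ _ => mulrDl _ _ _) pairDr pair_le M ME).
  + by move=> j; rewrite /glue; case: ifP.
  + exact: bam_cst.
  + move=> t; rewrite (big_glue _ _ (fun (B : set (borel X)) z => (\1_B t : F)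
      *: z)).
    under [X in _ + X]eq_bigr do rewrite scalerN.
    rewrite sumrN; set a := \sum_(j < N.+1) _; set a' := \sum_(j < N'.+1) _.
    have -> : a - a' = - (sreal (f t) - a) + (sreal (f t) - a') :> F^o.
      by rewrite opprB addrA subrK.
    apply: le_trans (ler_rnormD _ _) _; rewrite rnormN.
    by apply: lerD; exact: xA.
pose c := fine (M setT); have c0 : 0 <= c by exact: fine_ge0.
(* Completeness is invoked in R, with [g] being [sre] and then [sim]: both are additive and bounded
   by [rnorm]. *)
have sC (g : F -> R) : {morph g : x y / x - y} -> (forall z, `|g z| <= rnorm (z
    : F^o)) ->
    cvgn (g \o s).
  move=> gB gle; apply/cauchy_cvgP/cauchy_exP => e e0.
  have e2 : 0 < e / 2 / (c + 1) by rewrite !divr_gt0// ltr_pwDr.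
  have /cvgrPdist_lt/(_ _ e2)[N0 _ hN] := @cvg_harmonic R.
  exists (g (s N0)); exists N0 => // N' /= N0N'.
  rewrite -ball_normE /= -gB; apply: le_lt_trans (gle _) _.
  apply: le_lt_trans (sN _ _) _.
  have := hN N0 (leqnn _); have := hN N' N0N'.
  rewrite /harmonic /= !sub0r !normrN !ger0_norm// => h1 h2.
  rewrite -/c (@le_lt_trans _ _ ((N0.+1%:R^-1 + N'.+1%:R^-1) * (c + 1)))//.
    by rewrite ler_wpM2l ?addr_ge0// lerDl.
  rewrite -ltr_pdivlMr ?ltr_pwDr//.
  have -> : e / (c + 1) = e / 2 / (c + 1) + e / 2 / (c + 1) by rewrite -mulrDl
      -splitr.
  exact: ltrD.
have /cvg_ex[/= a sa] : cvgn (sre \o s).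
  by apply: sC; [move=> z w; rewrite sreD sreN|exact: normr_sre].
have /cvg_ex[/= b sb] : cvgn (sim \o s).
  by apply: sC; [move=> z w; rewrite simD simN|exact: normr_sim].
exists (smk a b), (fun N => N.+1), A, x; split.
- by [].
- move=> e e0; have /cvgrPdist_lt/(_ _ e0) := @cvg_harmonic R.
  apply: filterS => N; rewrite sub0r normrN ger0_norm ?invr_ge0//= => hN t.
  exact: le_trans (xA N t) (ltW hN).
- apply/cvg_rnormP => e e0.
  have e20 : 0 < e / 2 by rewrite divr_gt0.
  move/cvgrPdist_lt : sa => /(_ _ e20) sa;
      move/cvgrPdist_lt : sb => /(_ _ e20) sb.
  apply: filterS2 sa sb => N /= sa sb.
  apply: le_lt_trans (ler_rnorm_resim _) _.
  rewrite sreD sreN sre_smk [e]splitr ltrD//.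
  exact: le_lt_trans (normr_sim_smkB _ _ _) sb.
Qed.

End ScalarIntegral.

(** * Borel sets of a compact space *)

Lemma open_borel (X : ptopologicalType) (U : set (borel X)) :
  open (U : set X) -> measurable U.
Proof. by move=> oU; exact: sub_sigma_algebra. Qed.

Lemma compact_borel (X : ptopologicalType) (C : set X) : hausdorff_space X ->
  compact C -> measurable (C : set (borel X)).
Proof.
move=> hX cC; rewrite -[C]setCK; apply: measurableC; apply: open_borel.
by apply: closed_openC; exact: compact_closed.
Qed.

Lemma measurable_fun_gt d (T : measurableType d) (R : realType) (f : T -> R)
    (D : set T) :
  (forall x : R, measurable (D `&` [set t | x < f t])) -> measurable_fun D f.
Proof.
move=> h; apply: (measurability _ (RGenOInfty.measurableE R)) => //.
move=> _ [_ [x ->] <-]; rewrite (_ : f @^-1` _ = [set t | x < f t])//.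
by apply/seteqP; split=> t /=; rewrite in_itv /= andbT.
Qed.

Lemma continuous_borel (X : ptopologicalType) (R : realType) (f : X -> R) :
  continuous f -> measurable_fun setT (f : borel X -> R).
Proof.
move=> cf; apply: measurable_fun_gt => x; rewrite setTI; apply: open_borel.
move/continuousP : cf => /(_ [set y | x < y]); apply; exact: open_gt.
Qed.

Lemma continuous_borel_map (X Y : ptopologicalType) (f : X -> Y) :
  continuous f -> measurable_fun setT (f : borel X -> borel Y).
Proof.
move=> cf; refine (@measurability _ _ (borel X) (borel Y) setT f (@open Y)
    erefl _).
move=> _ [U oU <-].
by rewrite setTI; apply: open_borel; move/continuousP : cf; exact.
Qed.

(** Every superlevel set at a rational q is a Borel set A q up to a null set. Off one null set for
    all q, f(t) > x holds exactly when t lies in A q for some rational q >= x. *)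
Lemma completed_ae d (T : measurableType d) (R : realType)
    (m : {measure set T -> \bar R}) (f : T -> R) :
  (forall x : R, completed_algebra_gen m [set t | x < f t]) ->
  exists2 g, measurable_fun setT g & {ae m, forall t, f t = g t}.
Proof.
move=> h.
have /choice[A hA] : forall q : rat, exists A, measurable A /\
    {ae m, forall t, A t <-> (ratr q : R) < f t}.
  move=> q; have [A mA [N [B [mB B0 NB]] AN]] := h (ratr q).
  exists A; split=> //; exists B; split=> // t /= hB; apply: contrapT => nB;
      apply: hB.
  have ANt : (A `|` N) t <-> ratr q < f t by rewrite AN.
  by split=> [At|/ANt[//|/NB//]]; apply/ANt; left.
(* The rationals are enumerated through [unpickle], as [ae_foralln] merges null sets indexed by
   natural numbers. *)
have {}hA : (forall q, measurable (A q)) /\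
    {ae m, forall t, forall n q, unpickle n = Some q -> (A q t <-> (ratr q : R)
        < f t)}.
  split; first by move=> q; have [] := hA q.
  apply: ae_foralln => n; case: (unpickle n) => [q|]; last exact: nearW.
  by have [_] := hA q; apply: filterS => t ht _ [<-].
have [mA [N [mN N0 hN]]] := hA.
exists (f \_ (~` N)); last first.
  exists N; split=> // t /= ht; apply: contrapT => Nt; apply: ht.
  by rewrite patchE mem_set.
apply: (measurable_restrictT f (measurableC mN)).1.
apply: measurable_fun_gt => x.
have -> : ~` N `&` [set t | x < f t] =
    \bigcup_(q in [set: rat]) (if x <= ratr q then ~` N `&` A q else set0).
  apply/seteqP; split=> [t [Nt /= /rat_in_itvoo[q]]|t [q _]].
    rewrite in_itv /= => /andP[xq qf]; exists q => //; rewrite (ltW xq);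
        split=> //.
    have : ~ ~ (forall n q, unpickle n = Some q -> (A q t <-> (ratr q : R) < f
        t)).
      by move=> /hN.
    by move=> /contrapT/(_ (pickle q) q (pickleK q))[_]; apply.
  case: ifP => // xq [Nt At]; split=> //=; apply: le_lt_trans xq _.
  have : ~ ~ (forall n q, unpickle n = Some q -> (A q t <-> (ratr q : R) < f
      t)).
    by move=> /hN.
  by move=> /contrapT/(_ (pickle q) q (pickleK q))[+ _]; apply.
apply: bigcupT_measurable_rat => q; case: ifP => // _.
by apply: measurableI => //; exact: measurableC.
Qed.

(** * Continuous approximation of indicator functions *)

Section CompactApproximation.
Context {R : realType} {K : ptopologicalType}.
Hypothesis Kcompact : compact [set: K].
Hypothesis Khausdorff : hausdorff_space K.

Lemma urysohn_compact_open (C U : set K) : compact C -> open U -> C `<=` U ->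
  exists f : K -> R, [/\ continuous f, forall t, 0 <= f t <= 1,
    forall t, C t -> f t = 1 & forall t, ~ U t -> f t = 0].
Proof.
move=> cC oU CU.
have : uniform_separator (~` U) C.
  apply: normal_uniform_separator.
  - exact: compact_normal.
  - exact: open_closedC.
  - exact: compact_closed.
  - by apply/seteqP; split=> // t [nU /CU].
move=> /(@uniform_separatorP _ R)[f [cf f01 f0 f1]]; exists f; split=> //.
- by move=> t; have := f01 (f t) (imageT _ _); rewrite /= in_itv.
- by move=> t Ct; apply: f1; exists t.
- by move=> t Ut; apply: f0; exists t.
Qed.

Variables P L : {finite_measure set (borel K) -> \bar R}.
Hypotheses (Preg : regular P) (Lreg : regular L).

(** One [f] has to be good for both measures: the union of the two compact sets and the intersection
    of the two open sets given by regularity are separated. *)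
Lemma approx_indic (A : set (borel K)) (e : R) : measurable A -> 0 < e ->
  exists f : K -> R, [/\ continuous f, forall t, 0 <= f t <= 1,
    \int[P]_t `|f t - \1_A t| <= e & \int[L]_t `|f t - \1_A t| <= e].
Proof.
move=> mA e0.
have [C1 [U1 [cC1 oU1 CA1 AU1 h1]]] := Preg mA e0.
have [C2 [U2 [cC2 oU2 CA2 AU2 h2]]] := Lreg mA e0.
pose C := C1 `|` C2; pose U := U1 `&` U2.
have cC : compact C by exact: compactU.
have oU : open U by exact: openI.
have CA : C `<=` A by rewrite subUset.
have AU : A `<=` U by rewrite subsetI.
have mo (V : set K) : open V -> measurable (V : set (borel K)) by exact:
    open_borel.
have mc (D : set K) : compact D -> measurable (D : set (borel K)).
  exact: compact_borel.
have [f [cf f01 f1 f0]] := urysohn_compact_open cC oU (subset_trans CA AU).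
have mf := continuous_borel cf.
exists f; split=> //.
  apply: (Rintegral_separator mf f01 f1 f0 mA (mc _ cC1) (mo _ oU1) CA AU) h1.
    exact: subsetUl.
  exact: subIsetl.
apply: (Rintegral_separator mf f01 f1 f0 mA (mc _ cC2) (mo _ oU2) CA AU) h2.
  exact: subsetUr.
exact: subIsetr.
Qed.

End CompactApproximation.

(** * Absolute continuity of the variation *)

Lemma bounded_on_compact (R : realType) (k : scalar_kind) (K : ptopologicalType)
    (E : normedModType (sfield R k)) (u : K -> E) :
  compact [set: K] -> continuous u ->
  exists2 c : R, 0 <= c & forall t, rnorm (u t) <= c.
Proof.
move=> Kc cu.
have cn : continuous (fun t => rnorm (u t)).
  by move=> t; apply: continuous_comp; [exact: cu|exact: continuous_rnorm].
have /compact_bounded[M [_ hM]] : compact ((fun t => rnorm (u t) : R^o) @`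
    [set: K]).
  by apply: continuous_compact => //; exact: continuous_subspaceT.
exists (`|M| + 1); first by rewrite addr_ge0.
move=> t; apply: le_trans (ler_norm _) _; apply: hM; last by exists t.
by rewrite (le_lt_trans (ler_norm _))// ltrDl.
Qed.

Lemma cvgn_le_cst (R : realType) (u : nat -> R) (l c : R) :
  u n @[n --> \oo] --> l -> (forall n, u n <= c) -> l <= c.
Proof.
move=> ul uc; rewrite -(cvg_lim (@Rhausdorff R) ul).
by apply: limr_le; [apply/cvg_ex; exists l|exact: nearW].
Qed.

Lemma cvgn_ge_cst (R : realType) (u : nat -> R) (l c : R) :
  u n @[n --> \oo] --> l -> (forall n, c <= u n) -> c <= l.
Proof.
move=> ul uc; rewrite -(cvg_lim (@Rhausdorff R) ul).
by apply: limr_ge; [apply/cvg_ex; exists l|exact: nearW].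
Qed.

Section MaxEval.
Context {R : realType} {k : scalar_kind} {E : normedModType (sfield R k)}.
Variable d : nat -> E.

(** The s_n of the overview; the recursion lets boundedness, measurability and lattice membership go
    through by induction. *)
Fixpoint max_eval n (x : dual E) : R :=
  if n is m.+1 then Num.max (max_eval m x) (sre (x (d m))) else 0.

Lemma max_eval_ge0 n x : 0 <= max_eval n x.
Proof. by elim: n => //= n ih; rewrite le_max ih. Qed.

Lemma max_eval_zero n : max_eval n 0 = 0.
Proof.
elim: n => // n ih; transitivity (Num.max (max_eval n 0) (sre (0 : sfield R
    k))).
  by [].
by rewrite ih sre0 maxxx.
Qed.

End MaxEval.

Section Density.
Context {R : realType} {k : scalar_kind} {K : ptopologicalType}
  {E : normedModType (sfield R k)}.
Hypothesis Kcompact : compact [set: K].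
Hypothesis Khausdorff : hausdorff_space K.
Variables P L : {finite_measure set (borel K) -> \bar R}.
Hypotheses (Preg : regular P) (Lreg : regular L).
Variables (h : K -> dball E) (l : (K -> E) -> R).

(** In this section [P] stands for the image of |nu| on K, [L] for |mu|, and [l u] for the real part
    of the integral of u against mu. *)
Definition dens (u : K -> E) (t : K) : R := sre (dball_val (h t) (u t)).

Hypothesis dens_ae : forall u, continuous u ->
  exists2 g, measurable_fun setT (g : borel K -> R) & {ae P, forall t, dens u t
      = g t}.
Hypothesis l_dens : forall u, continuous u -> l u = \int[P]_t dens u t.
Hypothesis l_bound : forall u b, continuous u -> bam L b ->
  (forall t, rnorm (u t) <= b t) -> l u <= \int[L]_t b t.

Lemma dens_le u t : `|dens u t| <= rnorm (u t).
Proof. exact: dball_sre. Qed.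

Lemma bam_dens u : continuous u -> bam P (dens u).
Proof.
move=> cu; split; last exact: dens_ae.
have [c _ hc] := bounded_on_compact Kcompact cu.
by exists c => t; apply: le_trans (dens_le _ _) (hc t).
Qed.

Lemma bam_dom (M : {finite_measure set (borel K) -> \bar R}) (f : K -> R) :
  continuous f -> (forall t, 0 <= f t <= 1) -> bam M (f : borel K -> R).
Proof.
move=> cf f01; apply: (@bam_measurable _ _ _ _ _ 1);
    last exact: continuous_borel.
by move=> t; have /andP[? ?] := f01 t; rewrite ger0_norm.
Qed.

Lemma continuous_scale (f : K -> R) (u : K -> E) : continuous f -> continuous u
    ->
  continuous (fun t => (sreal (f t) : sfield R k) *: u t).
Proof.
move=> cf cu t; apply: cvgZ; last exact: cu.
apply: (@cvg_comp _ _ _ f sreal); first exact: cf.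
exact: (@continuous_sreal R k (f t)).
Qed.

Lemma dens_scale (f : K -> R) u t :
  dens (fun t => (sreal (f t) : sfield R k) *: u t) t = f t * dens u t.
Proof. by rewrite /dens dualZ sreMreal. Qed.

Lemma dens_le_variation (A : set (borel K)) u (c : R) : measurable A ->
  continuous u -> 0 <= c -> (forall t, rnorm (u t) <= c) ->
  \int[P]_t (\1_A t * dens u t) <= c * fine (L A).
Proof.
move=> mA cu c0 uc; apply/ler_addgt0Pr => e e0.
(* Replacing the indicator by [f] costs c e' under P and again c e' under L; the extra 1 keeps the
   denominator positive when c = 0. *)
pose e' := e / (2 * c + 1).
have c1 : 0 < 2 * c + 1 by rewrite ltr_wpDl// mulr_ge0.
have e'0 : 0 < e' by rewrite divr_gt0.
have [f [cf f01 fP fL]] := approx_indic Kcompact Khausdorff Preg Lreg mA e'0.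
have bf M : bam M (f : borel K -> R) by exact: bam_dom.
have bd := bam_dens cu.
have b1 M : bam M (\1_A : borel K -> R) by exact: bam_indic.
have bn (M : {finite_measure set (borel K) -> \bar R}) :
    bam M (fun t : borel K => `|f t - \1_A t|) by apply: bam_norm; exact: bamB.
have h1 : \int[P]_t (\1_A t * dens u t) <= \int[P]_t (f t * dens u t) + c * e'.
  apply: le_trans (_ : _ <= \int[P]_t (f t * dens u t + c * `|f t - \1_A t|)) _.
    apply: le_Rintegral_bam => [|| t]; [exact: bamM| |].
      by apply: bamD; [exact: bamM|exact: bamZ].
    rewrite -lerBlDl -mulrBl; apply: le_trans (ler_norm _) _.
    rewrite normrM distrC mulrC; apply: ler_wpM2r => //.
    exact: le_trans (dens_le _ _) (uc t).
  rewrite RintegralD_bam; [|exact: bamM|exact: bamZ].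
  by rewrite RintegralZ_bam// lerD2l ler_wpM2l.
have h2 : \int[P]_t (f t * dens u t) <= \int[L]_t (c * f t).
  have cfu := continuous_scale cf cu.
  rewrite (_ : \int[P]_t _ = l (fun t => (sreal (f t) : sfield R k) *: u t)).
    apply: l_bound => //; first exact: bamZ.
    move=> t; rewrite rnormZ rnorm_sreal; have /andP[f0 f1] := f01 t.
    by rewrite ger0_norm// mulrC ler_wpM2r.
  by rewrite l_dens//; apply: eq_Rintegral => t _; rewrite dens_scale.
have h3 : \int[L]_t (c * f t) <= c * fine (L A) + c * e'.
  rewrite RintegralZ_bam// -mulrDr ler_wpM2l// -Rintegral_indic_bam//.
  rewrite -lerBlDl -RintegralB_bam//.
  apply: le_trans fL; apply: le_Rintegral_bam => //; first exact: bamB.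
  by move=> t; exact: ler_norm.
apply: le_trans h1 _; apply: le_trans (lerD (le_trans h2 h3) (lexx _)) _.
have -> : e = (2 * c + 1) * e' by rewrite /e' mulrC divfK// gt_eqF.
lra.
Qed.

Variables (d : nat -> E) (rho : K -> R).
Hypothesis d_le1 : forall i, rnorm (d i) <= 1.
Hypothesis rho_lim : forall t, max_eval d n (dball_val (h t)) @[n --> \oo] -->
    rho t.
Hypothesis rho_total : \int[P]_t rho t = fine (L setT).

Let s n t := max_eval d n (dball_val (h t)).

Lemma max_eval_le1 n (x : dball E) : max_eval d n (dball_val x) <= 1.
Proof.
elim: n => [|n ih] /=; first exact: ler01.
rewrite ge_max ih /=; apply: le_trans (ler_norm _) _.
exact: le_trans (dball_sre _ _) (d_le1 _).
Qed.

Lemma rho_itv t : 0 <= rho t <= 1.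
Proof.
apply/andP; split.
  by apply: (cvgn_ge_cst (@rho_lim t)) => n; exact: max_eval_ge0.
by apply: (cvgn_le_cst (@rho_lim t)) => n; exact: max_eval_le1.
Qed.

Lemma s_norm n t : `|s n t| <= 1.
Proof. by rewrite ger0_norm ?max_eval_ge0// max_eval_le1. Qed.

Lemma bam_max (f g : K -> R) : bam P f -> bam P g ->
  bam P (fun t => Num.max (f t) (g t)).
Proof.
move=> bf bg; have := bamN (bam_min (bamN bf) (bamN bg)).
by under eq_fun do rewrite oppr_min !opprK.
Qed.

Lemma bam_s n : bam P (s n).
Proof.
elim: n => [|n ih]; first exact: bam_cst.
apply: bam_max => //; apply: (bam_dens (u := fun=> d n)) => t; exact: cvg_cst.
Qed.

Lemma bam_rho : bam P rho.
Proof.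
apply: (bam_lim (B := 1) bam_s) => // t.
by have /andP[? ?] := rho_itv t; rewrite ger0_norm.
Qed.

(** Induction on n: A is cut along the set where the new term exceeds the previous maximum. On that
    part [dens_le_variation] applies with c = 1, on the rest the induction hypothesis, and [L] adds
    up. *)
Lemma s_le_variation n (A : set (borel K)) : measurable A ->
  \int[P]_t (\1_A t * s n t) <= fine (L A).
Proof.
elim: n A => [|n ih] A mA.
  under eq_Rintegral do rewrite mulr0.
  by rewrite Rintegral_cst// mul0r fine_ge0.
have bd : bam P (dens (fun=> d n)) by apply: bam_dens => t; exact: cvg_cst.
have [g [B [mg gB dg]]] := bam_version (bamB bd (bam_s n)).
pose D := [set t | 0 < g t].
have mD : measurable (D : set (borel K)).
  by rewrite -[X in measurable X]setTI; exact: measurable_fun_ltr.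
have bi (C : set (borel K)) : measurable C -> bam P (\1_C : borel K -> R).
  exact: bam_indic.
have mAD : measurable (A `&` D : set (borel K)) by exact: measurableI.
have mAD' : measurable (A `\` D : set (borel K)) by exact: measurableD.
rewrite (@Rintegral_ae _ _ _ P _ (fun t => \1_(A `&` D) t * dens (fun=> d n) t +
    \1_(A `\` D) t * s n t)); last first.
  apply: filterS dg => t dg; rewrite /s /= !indicE in_setI in_setD.
  case: (_ \in A) => /=; last by rewrite !mul0r addr0.
  have [Dt|Dt] := pselect (D t).
    rewrite mem_set// mul0r addr0 !mul1r max_r// -subr_ge0.
    by rewrite [leRHS]dg ltW.
  rewrite memNset// mul0r add0r !mul1r max_l// -subr_le0.
  by rewrite [leLHS]dg leNgt; apply/negP.
rewrite RintegralD_bam; [|by apply: bamM => //; exact: bi|by apply: bamM;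
    [exact: bi|exact: bam_s]].
have -> : fine (L A) = fine (L (A `&` D)) + fine (L (A `\` D)).
  rewrite -fineD ?fin_num_measure// -measureU//; last first.
    by apply/seteqP; split=> // t [[_ Dt] [_ /(_ Dt)]].
  by rewrite setUIDK.
apply: lerD; last exact: ih.
rewrite -[leRHS]mul1r; apply: dens_le_variation => //.
by move=> t; exact: cvg_cst.
Qed.

Lemma rho_le_variation (A : set (borel K)) : measurable A ->
  \int[P]_t (\1_A t * rho t) <= fine (L A).
Proof.
move=> mA.
have h1 : \int[P]_t (\1_A t * s n t) @[n --> \oo] --> \int[P]_t (\1_A t * rho
    t).
  apply: (dominated_Rintegral (B := 1)).
  - by move=> n; apply: bamM; [exact: bam_indic|exact: bam_s].
  - move=> n t; rewrite normrM indicE.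
    case: (_ \in _); rewrite ?normr1 ?normr0 ?mul1r ?mul0r ?ler01//;
        exact: s_norm.
  - move=> t; have /andP[r0 r1] := rho_itv t;
      rewrite normrM indicE (ger0_norm r0).
    by case: (_ \in _); rewrite ?normr1 ?normr0 ?mul1r ?mul0r ?ler01.
  - by move=> t; apply: cvgM; [exact: cvg_cst|exact: rho_lim].
by apply: (cvgn_le_cst h1) => n; exact: s_le_variation.
Qed.

(** The inequality [rho_le_variation] holds for A and for its complement, and both sides have the
    same total by [rho_total]; so neither inequality is strict. *)
Lemma variationE (A : set (borel K)) : measurable A ->
  fine (L A) = \int[P]_t (\1_A t * rho t).
Proof.
move=> mA; apply/eqP; rewrite eq_le rho_le_variation// andbT.
have := rho_le_variation (measurableC mA).
suff : fine (L A) + fine (L (~` A)) = \int[P]_t (\1_A t * rho t) +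
  \int[P]_t (\1_(~` A) t * rho t) by lra.
rewrite -RintegralD_bam; first last.
- by apply: bamM; [apply: bam_indic; exact: measurableC|exact: bam_rho].
- by apply: bamM; [exact: bam_indic|exact: bam_rho].
rewrite -fineD ?fin_num_measure//; last exact: measurableC.
rewrite -measureU//; [|exact: measurableC|exact: setICr].
rewrite setUCr -rho_total; apply: eq_Rintegral => t _.
by rewrite -mulrDl !indicE in_setC; case: (_ \in _);
    rewrite ?addr0 ?add0r mul1r.
Qed.

(** On Z = {rho = 0} the measure L = rho P vanishes, so [dens_le_variation] makes every integral of
    the density over a Borel part of Z at most 0. The same for -u gives the equality. *)
Lemma dens_rho0 u : continuous u -> {ae P, forall t, rho t = 0 -> dens u t = 0}.
Proof.
suff main v : continuous v -> {ae P, forall t, rho t = 0 -> dens v t <= 0}.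
  move=> cu; have cNu : continuous (fun t => - u t).
    by move=> t; apply: cvgN; exact: cu.
  apply: (@filterS2 _ (almost_everywhere P) _ _ _ _ _ (main _ cu) (main _ cNu))
      => t h1 h2 r0.
  apply/eqP; rewrite eq_le h1//=; have := h2 r0.
  by rewrite /dens dualN sreN oppr_le0.
move=> cv; have [c c0 vc] := bounded_on_compact Kcompact cv.
have [r [B [mr rB rho_r]]] := bam_version bam_rho.
pose Z := [set t | r t = 0].
have mZ : measurable (Z : set (borel K)).
  rewrite (_ : Z = r @^-1` [set 0]) // -[X in measurable X]setTI.
  by apply: mr => //; exact: measurable_set1.
have hZ : {ae P, forall t, \1_Z t * dens v t <= 0}.
  apply: ae_le0; first by apply: bamM; [exact: bam_indic|exact: bam_dens].
  move=> A mA.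
  have mAZ : measurable (A `&` Z : set (borel K)) by exact: measurableI.
  have -> : \int[P]_t (\1_A t * (\1_Z t * dens v t)) =
      \int[P]_t (\1_(A `&` Z) t * dens v t).
    apply: eq_Rintegral => t _; rewrite mulrA !indicE in_setI.
    by case: (_ \in _); case: (_ \in _); rewrite ?mulr1 ?mulr0.
  apply: le_trans (dens_le_variation mAZ cv c0 vc) _.
  rewrite variationE// (@Rintegral_ae _ _ _ P _ (fun=> 0)).
    by rewrite Rintegral_cst// mul0r mulr0.
  apply: filterS rho_r => t ->; rewrite indicE in_setI.
  have [Zt|Zt] := pselect (Z t); first by rewrite Zt mulr0.
  by rewrite [t \in Z]memNset// andbF mul0r.
apply: (@filterS2 _ (almost_everywhere P) _ _ _ _ _ rho_r hZ) => t rt {}hZ r0;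
    move: hZ.
by rewrite indicE mem_set ?mul1r// /Z /= -rt.
Qed.

Lemma ae_variation (Q : K -> Prop) : {ae P, forall t, Q t} -> {ae L, forall t,
    Q t}.
Proof.
move=> [N [mN N0 QN]]; exists N; split=> //.
rewrite -[LHS]fineK ?fin_num_measure//; congr (_%:E).
rewrite variationE//; rewrite (@Rintegral_ae _ _ _ P _ (fun=> 0)).
  by rewrite Rintegral_cst// mul0r.
exists N; split=> // t /= ht; apply: contrapT => Nt; apply: ht.
by rewrite indicE memNset// mul0r.
Qed.

(** On a single layer this is [variationE]. The layer sums approximate a version of [G] uniformly,
    with errors 1/(N + 1) times the masses of L and of P. *)
Lemma change_of_density (G : K -> R) : bam P G -> (forall t, 0 <= G t <= 1) ->
  \int[L]_t G t = \int[P]_t (G t * rho t).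
Proof.
move=> bG G01.
have [g0 [B [mg0 _ Gg0]]] := bam_version bG.
(* [g0] may leave [0, 1] on the exceptional null set, whereas [layer_approx] asks for these bounds
   at every point. *)
pose g t := Num.max 0 (Num.min 1 (g0 t)).
have mg : measurable_fun setT (g : borel K -> R).
  by apply: measurable_maxr => //; exact: measurable_minr.
have g01 t : 0 <= g t <= 1.
  by rewrite /g le_max lexx /= ge_max ler01 /= ge_min lexx.
have Gg : {ae P, forall t, G t = g t}.
  apply: filterS Gg0 => t Gg0; have := G01 t; rewrite /g -Gg0 => /andP[h0 h1].
  by rewrite min_r// max_r.
have bg M : bam M (g : borel K -> R).
  apply: (@bam_measurable _ _ _ _ _ 1) => // t.
  by have /andP[? ?] := g01 t; rewrite ger0_norm.
rewrite (@Rintegral_ae _ _ _ L _ g); last exact: ae_variation.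
rewrite (@Rintegral_ae _ _ _ P _ (fun t => g t * rho t)); last first.
  by apply: (@filterS _ (almost_everywhere P) _ _ _ _ Gg) => t ->.
apply/eqP; rewrite -subr_eq0 -normr_eq0 eq_le normr_ge0 andbT.
apply/ler_addgt0Pr => e e0; rewrite add0r.
pose c := fine (L setT) + fine (P setT).
have c0 : 0 <= c by rewrite addr_ge0// fine_ge0.
have e'0 : 0 < e / (c + 1) by rewrite divr_gt0// ltr_wpDl.
have /cvgrPdist_lt/(_ _ e'0)[N _ /(_ N (leqnn N))] := @cvg_harmonic R.
rewrite /harmonic /= sub0r normrN ger0_norm ?invr_ge0// => hN.
pose f j t : R := N.+1%:R^-1 * \1_(layer (g : borel K -> R) N j) t.
have bf M j : bam M (f j : borel K -> R).
  by apply: bamZ; apply: bam_indic; exact: measurable_layer.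
pose S t := \sum_(j < N.+1) f j t.
have bS M : bam M (S : borel K -> R) by have [] := Rintegral_sum_bam N.+1 (bf
    M).
have gS t : `|g t - S t| <= N.+1%:R^-1 by exact: layer_approx.
have brho := bam_rho.
have SE : \int[L]_t S t = \int[P]_t (S t * rho t).
  have [_ ->] := Rintegral_sum_bam N.+1 (bf L).
  have bfr j : bam P (fun t => f j t * rho t) by exact: bamM.
  have -> : \int[P]_t (S t * rho t) = \int[P]_t (\sum_(j < N.+1) f j t * rho t).
    by apply: eq_Rintegral => t _; rewrite mulr_suml.
  have [_ ->] := Rintegral_sum_bam N.+1 bfr.
  apply: eq_bigr => j _; have mj := measurable_layer N j mg.
  rewrite RintegralZ_bam; last exact: bam_indic.
  rewrite Rintegral_indic_bam// variationE// -RintegralZ_bam.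
    by apply: eq_Rintegral => t _; rewrite mulrA.
  by apply: bamM => //; exact: bam_indic.
have h1 : `|\int[L]_t g t - \int[L]_t S t| <= N.+1%:R^-1 * fine (L setT).
  rewrite -RintegralB_bam//; apply: le_trans (le_norm_Rintegral_bam _) _.
    exact: bamB.
  rewrite -Rintegral_cst//; apply: le_Rintegral_bam => //; last exact: bam_cst.
  by apply: bam_norm; exact: bamB.
have h2 : `|\int[P]_t (g t * rho t) - \int[P]_t (S t * rho t)| <=
    N.+1%:R^-1 * fine (P setT).
  rewrite -RintegralB_bam; [|exact: bamM|exact: bamM].
  have bB : bam P (fun t => g t * rho t - S t * rho t) by apply: bamB;
      exact: bamM.
  apply: le_trans (le_norm_Rintegral_bam bB) _.
  rewrite -Rintegral_cst//; apply: le_Rintegral_bam; first exact: bam_norm.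
    exact: bam_cst.
  move=> t; rewrite -mulrBl normrM -[leRHS]mulr1; apply: ler_pM => //.
  by have /andP[r0 r1] := rho_itv t; rewrite ger0_norm.
rewrite -SE in h2.
set a := \int[L]_t g t in h1 *; set b := \int[P]_t _ in h2 *.
set x := \int[L]_t S t in h1 h2.
have -> : a - b = (a - x) - (b - x) by rewrite opprB addrA subrK.
apply: le_trans (ler_normB _ _) _; apply: le_trans (lerD h1 h2) _.
rewrite -mulrDr -/c; apply: le_trans (_ : _ <= e / (c + 1) * (c + 1)) _.
  by apply: ler_pM; rewrite ?invr_ge0 ?lerDl// ltW.
by rewrite divfK// gt_eqF// ltr_wpDl.
Qed.

End Density.

(** * The functional p_f on minima of linear functions *)

Lemma ler_norm_minB (R : realDomainType) (a b c e : R) :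
  `|Num.min a b - Num.min c e| <= `|a - c| + `|b - e|.
Proof.
have hab x y z w : x <= y -> Num.min x y - Num.min z w <= `|x - z| + `|y - w|
    :> R.
  move=> xy; rewrite min_l//; case: (leP z w) => zw.
    by apply: le_trans (ler_norm _) _; rewrite lerDl.
  have := ler_norm (y - w); have := normr_ge0 (x - z); lra.
have hle x y z w : Num.min x y - Num.min z w <= `|x - z| + `|y - w| :> R.
  case: (leP x y) => xy; first by have := hab x y z w xy; rewrite min_l.
  rewrite [Num.min z w]minC [leRHS]addrC.
  by have := hab y x w z (ltW xy); rewrite (min_l (ltW xy)).
rewrite ler_norml hle andbT.
by have := hle c e a b; rewrite [`|c - a|]distrC [`|e - b|]distrC; lra.
Qed.

Section Classes.
Context {R : realType} {k : scalar_kind} {K : ptopologicalType}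
  {E : normedModType (sfield R k)}.
Local Notation F := (sfield R k).
Hypothesis Kcompact : compact [set: K].
Hypothesis Khausdorff : hausdorff_space K.
Variable P : {finite_measure set (borel K) -> \bar R}.
Hypothesis Preg : regular P.
Variables (h : K -> dball E) (l : (K -> E) -> R) (rho : K -> R).
Hypothesis dens_ae : forall u, continuous u -> aem P (dens h u).
Hypothesis l_dens : forall u, continuous u -> l u = \int[P]_t dens h u t.
Hypothesis dens_rho0 : forall u, continuous u ->
  {ae P, forall t, rho t = 0 -> dens h u t = 0}.

Variable W : {finite_measure set (borel (K * dball E)%type) -> \bar R}.

Definition on_ball (f : K * dual E -> R) (p : K * dball E) : R :=
  f (p.1, dball_val p.2).

Definition along (f : K * dual E -> R) (t : K) : R := f (t, dball_val (h t)).

Hypothesis W_batty : forall f, batty_class f ->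
  (\int[W]_p (on_ball f p)%:E)%E = ereal_inf [set (l u)%:E | u in
    [set u : K -> E | continuous u /\
       forall t (x : dual E), f (t, x) <= sre (x (u t))]].

(* An abstract form of "minimum of finitely many functions [lin f e]": closed
   under sums and minima, with sel_sel giving p_f(mu) <= \int f(t, h(t)) dP. *)
Record selectable (f : K * dual E -> R) : Prop := Selectable {
  sel_cont : continuous (on_ball f);
  sel_bounded : exists M : R, forall p, `|on_ball f p| <= M;
  sel_superadd : forall t x y, f (t, x) + f (t, y) <= f (t, x + y);
  sel_hom : forall t (r : R) x, 0 <= r -> f (t, sreal r *: x) = r * f (t, x);
  sel_aem : aem P (along f);
  sel_zero : {ae P, forall t, rho t = 0 -> along f t = 0};
  sel_sel : forall e : R, 0 < e -> exists u : K -> E, [/\ continuous u,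
    forall t (x : dual E), f (t, x) <= sre (x (u t)) &
    \int[P]_t `|dens h u t - along f t| <= e] }.

Lemma bam_along f : selectable f -> bam P (along f).
Proof.
move=> sf; split; last exact: sel_aem.
by have [M hM] := sel_bounded sf; exists M => t; exact: (hM (t, h t)).
Qed.

Lemma bam_on_ball f : selectable f -> bam W (on_ball f).
Proof.
move=> sf; have [M hM] := sel_bounded sf.
apply: (@bam_measurable _ _ _ _ _ M) => //; apply: continuous_borel;
    exact: sel_cont.
Qed.

Lemma selectable_batty f : selectable f -> batty_class f.
Proof.
move=> sf; split; [|exact: sel_bounded|exact: sel_superadd|exact: sel_hom].
apply/lower_semicontinuousP => a.
rewrite (_ : [set _ | _] = [set p | a < - on_ball f p]); last first.
  by apply/seteqP; split=> p /=; rewrite lte_fin.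
have /continuousP/(_ [set y | a < y]) : continuous (fun p => - on_ball f p).
  by move=> p; apply: cvgN; exact: sel_cont.
by apply; exact: open_gt.
Qed.

Lemma selectable_integral f : selectable f ->
  \int[W]_p on_ball f p = \int[P]_t along f t.
Proof.
move=> sf; rewrite /Rintegral W_batty; last exact: selectable_batty.
rewrite -[RHS]/(\int[P]_t along f t).
set S := [set _ | _ in _].
have ba := bam_along sf.
have bd u : continuous u -> bam P (dens h u) by exact: bam_dens.
suff -> : ereal_inf S = (\int[P]_t along f t)%:E by [].
apply/eqP; rewrite eq_le; apply/andP; split.
  apply/lee_addgt0Pr => e e0.
  have [u [cu fu he]] := sel_sel sf e0.
  apply: ereal_inf_le; exists (l u)%:E; first by exists u.
  rewrite lee_fin l_dens// -lerBlDl -RintegralB_bam//; last exact: bd.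
  have bB : bam P (fun t => dens h u t - along f t) by apply: bamB => //;
      exact: bd.
  apply: le_trans he; apply: le_Rintegral_bam => //; first exact: bam_norm.
  by move=> t; exact: ler_norm.
apply: le_ereal_inf_tmp => _ [u [cu fu] <-].
rewrite lee_fin l_dens//; apply: le_Rintegral_bam => //; first exact: bd.
by move=> t; exact: fu.
Qed.

(* Only elementary tensors u(t) = f(t) e: for a general continuous u the function
   (t, x) |-> x(u(t)) need not be continuous on K x E^* with its weak* topology. *)
Definition lin (f : K -> R) (e : E) (y : K * dual E) : R := f y.1 * sre (y.2 e).

Lemma continuous_sre_eval (e : E) : continuous (fun x : dual E => sre (x e)).
Proof.
move=> x; apply: (@cvg_comp _ _ _ (fun x : dual E => x e : F^o) sre).
  exact: continuous_eval.
exact: (@continuous_sre R k (x e)).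
Qed.

Lemma continuous_sre_dball (e : E) :
  continuous (fun x : dball E => sre (dball_val x e)).
Proof.
move=> x; apply: (@cvg_comp _ _ _ (@dball_val R k E) (fun x : dual E => sre (x
    e))).
  exact: continuous_dball_val.
exact: continuous_sre_eval.
Qed.

Lemma continuous_lin f e : continuous f -> continuous (lin f e).
Proof.
move=> cf y; apply: cvgM.
  by apply: (@cvg_comp _ _ _ fst f); [exact: cvg_fst|exact: cf].
by apply: (@cvg_comp _ _ _ snd (fun x : dual E => sre (x e)));
  [exact: cvg_snd|exact: continuous_sre_eval].
Qed.

Lemma selectable_lin f e : continuous f -> selectable (lin f e).
Proof.
move=> cf; pose u t : E := sreal (f t) *: e.
have cu : continuous u by apply: continuous_scale => // t; exact: cvg_cst.
have linE t (x : dual E) : lin f e (t, x) = sre (x (u t)).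
  by rewrite /lin /u dualZ sreMreal.
have alE : along (lin f e) = dens h u.
  by apply/funext => t; rewrite /along linE.
split.
- move=> p; apply: cvgM.
    by apply: (@cvg_comp _ _ _ fst f); [exact: cvg_fst|exact: cf].
  by apply: (@cvg_comp _ _ _ snd (fun x : dball E => sre (dball_val x e)));
    [exact: cvg_snd|exact: continuous_sre_dball].
- have [c _ hc] := bounded_on_compact Kcompact cu.
  exists c => -[t x]; rewrite /on_ball linE /=.
  exact: le_trans (dball_sre _ _) (hc t).
- by move=> t x y; rewrite -mulrDr -sreD; exact: lexx.
- by move=> t r x _; rewrite mulrCA -sreMreal.
- by rewrite alE; exact: dens_ae.
- by rewrite alE; exact: dens_rho0.
- move=> r r0; exists u; split=> //; first by move=> t x; rewrite linE.
  rewrite alE; under eq_Rintegral do rewrite subrr normr0.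
  by rewrite Rintegral_cst// mul0r ltW.
Qed.

Lemma selectableD f g : selectable f -> selectable g ->
  selectable (fun y => f y + g y).
Proof.
move=> sf sg; split.
- by move=> p; apply: cvgD; exact: sel_cont.
- have [M hM] := sel_bounded sf; have [N hN] := sel_bounded sg.
  by exists (M + N) => p; apply: le_trans (ler_normD _ _) _;
      exact: lerD (hM p) (hN p).
- move=> t x y; rewrite addrACA.
  by apply: lerD; exact: sel_superadd.
- by move=> t r x r0; rewrite !sel_hom// mulrDr.
- apply: (aem_comp2 (u := fun z => z.1 + z.2)); [|exact: sel_aem..].
  exact: measurable_funD.
- apply: (@filterS2 _ (almost_everywhere P) _ _ _ _ _ (sel_zero sf) (sel_zero
    sg)).
  by move=> t h1 h2 r0; rewrite /along -/(along f t) -/(along g t) h1// h2//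
      addr0.
- move=> e e0; have e20 : 0 < e / 2 by rewrite divr_gt0.
  have [u [cu fu ue]] := sel_sel sf e20; have [v [cv gv ve]] := sel_sel sg e20.
  exists (fun t => u t + v t); split.
  + by move=> t; apply: cvgD; [exact: cu|exact: cv].
  + by move=> t x; rewrite dualD sreD lerD.
  have b1 : bam P (fun t => dens h u t - along f t).
    by apply: bamB; [exact: bam_dens|exact: bam_along].
  have b2 : bam P (fun t => dens h v t - along g t).
    by apply: bamB; [exact: bam_dens|exact: bam_along].
  rewrite [leRHS]splitr; apply: le_trans (lerD ue ve).
  rewrite -RintegralD_bam; [|exact: bam_norm..].
  have dE t : dens h (fun t => u t + v t) t - along (fun y => f y + g y) t =
      (dens h u t - along f t) + (dens h v t - along g t).
    by rewrite /dens dualD sreD /along; ring.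
  under eq_Rintegral do rewrite dE.
  apply: le_Rintegral_bam; [by apply: bam_norm; exact: bamD| |].
    by apply: bamD; exact: bam_norm.
  by move=> t; exact: ler_normD.
Qed.

Lemma selectableZ f (r : R) : 0 <= r -> selectable f ->
  selectable (fun y => r * f y).
Proof.
move=> r0 sf; split.
- by move=> p; apply: cvgM; [exact: cvg_cst|exact: sel_cont].
- have [M hM] := sel_bounded sf; exists (r * M) => p.
  by rewrite /on_ball normrM ger0_norm// ler_wpM2l//; exact: hM.
- by move=> t x y; rewrite -mulrDr ler_wpM2l//; exact: sel_superadd.
- by move=> t s x s0; rewrite sel_hom// mulrCA.
- apply: (aem_comp (u := fun z => r * z)); last exact: sel_aem.
  exact: measurable_funM.
- apply: (@filterS _ (almost_everywhere P) _ _ _ _ (sel_zero sf)).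
  by move=> t h1 rt; rewrite /along -/(along f t) h1// mulr0.
- move=> e e0.
  have e'0 : 0 < e / (r + 1) by rewrite divr_gt0// ltr_wpDl.
  have [u [cu fu ue]] := sel_sel sf e'0.
  exists (fun t => (sreal r : F) *: u t); split.
  + by apply: continuous_scale => // t; exact: cvg_cst.
  + by move=> t x; rewrite dualZ sreMreal ler_wpM2l.
  have b1 : bam P (fun t => `|dens h u t - along f t|).
    by apply: bam_norm; apply: bamB; [exact: bam_dens|exact: bam_along].
  rewrite (@eq_Rintegral _ _ _ _ _ (fun t : borel K => r * `|dens h u t - along
      f t|)).
    rewrite RintegralZ_bam//; apply: le_trans (ler_wpM2l r0 ue) _.
    by rewrite mulrCA ler_piMr ?(ltW e0)// ler_pdivrMr ?ltr_wpDl// mul1r lerDl.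
  move=> t _; rewrite /dens dualZ sreMreal /along -mulrBr normrM.
  by rewrite ger0_norm.
Qed.

Lemma selectable_min f g : selectable f -> selectable g ->
  selectable (fun y => Num.min (f y) (g y)).
Proof.
move=> sf sg; split.
- by move=> p; apply: (@continuous_min _ _ (on_ball f) (on_ball g));
    exact: sel_cont.
- have [M hM] := sel_bounded sf; have [N hN] := sel_bounded sg.
  exists (Num.max M N) => p; rewrite le_max.
  move: (hM p) (hN p).
  by rewrite /on_ball /Num.min; case: ifP => _ h1 h2; rewrite ?h1 ?h2 ?orbT.
- move=> t x y; rewrite le_min; apply/andP; split.
    apply: le_trans (sel_superadd sf _ _ _).
    by apply: lerD; rewrite ge_min lexx.
  apply: le_trans (sel_superadd sg _ _ _).
  by apply: lerD; rewrite ge_min lexx orbT.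
- by move=> t r x r0; rewrite !sel_hom// minr_pMr.
- apply: (aem_comp2 (u := fun z => Num.min z.1 z.2)); [|exact: sel_aem..].
  exact: measurable_minr.
- apply: (@filterS2 _ (almost_everywhere P) _ _ _ _ _ (sel_zero sf) (sel_zero
    sg)).
  by move=> t h1 h2 r0; rewrite /along -/(along f t) -/(along g t) h1// h2//
      minxx.
- move=> e e0; have e30 : 0 < e / 3 by rewrite divr_gt0.
  have [u [cu fu ue]] := sel_sel sf e30; have [v [cv gv ve]] := sel_sel sg e30.
  have bu : bam P (dens h u) by exact: bam_dens.
  have bv : bam P (dens h v) by exact: bam_dens.
  have buv := bamB bv bu.
  have [g0 [_ [mg0 _ dg0]]] := bam_version buv.
  have [[C hC] _] := bam_norm buv.
  have C0 : 0 <= C by exact: le_trans (normr_ge0 _) (hC point).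
  (* [g0] is a Borel version of [dens h v - dens h u]: up to a null set, A is where u gives the
     smaller value, and the ideal weight of u is the indicator of A. *)
  pose A := [set t | 0 <= g0 t].
  have mA : measurable (A : set (borel K)).
    by rewrite -[X in measurable X]setTI; exact: measurable_fun_ler.
  (* [C] bounds the difference of the two densities, so this error in the weight costs at most e/3.
     The other two thirds pay for u against f and for v against g. *)
  have e'0 : 0 < e / 3 / (C + 1) by rewrite divr_gt0// ltr_wpDl.
  have [f1 [cf1 f101 hf1 _]] := approx_indic Kcompact Khausdorff Preg Preg mA
      e'0.
  have cf1' : continuous (fun t => 1 - f1 t).
    by move=> t; apply: cvgB; [exact: cvg_cst|exact: cf1].
  pose w t : E := (sreal (f1 t) : F) *: u t + (sreal (1 - f1 t) : F) *: v t.
  have cw : continuous w.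
    by move=> t; apply: cvgD; [exact: (continuous_scale cf1 cu)|exact:
        (continuous_scale cf1' cv)].
  have wE t (x : dual E) : sre (x (w t)) =
      f1 t * sre (x (u t)) + (1 - f1 t) * sre (x (v t)).
    by rewrite /w dualD !dualZ sreD !sreMreal.
  exists w; split=> //.
    move=> t x; rewrite wE; have /andP[h0 h1] := f101 t.
    set m := Num.min _ _.
    have -> : m = f1 t * m + (1 - f1 t) * m by ring.
    have fm : m <= sre (x (u t)) by apply: le_trans (fu t x);
        rewrite ge_min lexx.
    have gm : m <= sre (x (v t)) by apply: le_trans (gv t x);
        rewrite ge_min lexx orbT.
    by apply: lerD; rewrite ler_wpM2l// subr_ge0.
  have b1 : bam P (fun t => `|dens h u t - along f t|).
    by apply: bam_norm; apply: bamB => //; exact: bam_along.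
  have b2 : bam P (fun t => `|dens h v t - along g t|).
    by apply: bam_norm; apply: bamB => //; exact: bam_along.
  have bf1 : bam P (f1 : borel K -> R) by exact: bam_dom.
  have b3 : bam P (fun t : borel K => `|f1 t - \1_A t|).
    by apply: bam_norm; apply: bamB => //; exact: bam_indic.
  have bm : bam P (fun t => Num.min (along f t) (along g t)).
    by apply: bam_min; exact: bam_along.
  have bw : bam P (dens h w) by exact: bam_dens.
  apply: le_trans (_ : _ <= \int[P]_t (C * `|f1 t - \1_A t| +
    (`|dens h u t - along f t| + `|dens h v t - along g t|))) _; last first.
    rewrite RintegralD_bam; [|exact: bamZ|exact: bamD].
    rewrite RintegralD_bam// RintegralZ_bam//.
    have -> : e = e / 3 + (e / 3 + e / 3) by field.
    apply: lerD; last exact: lerD.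
    apply: le_trans (ler_wpM2l C0 hf1) _.
    by rewrite mulrCA ler_piMr ?(ltW e30)// ler_pdivrMr ?ltr_wpDl// mul1r lerDl.
  apply: ae_le_Rintegral.
  + by apply: bam_norm; apply: bamB.
  + by apply: bamD; [exact: bamZ|exact: bamD].
  apply: (@filterS _ (almost_everywhere P) _ _ _ _ dg0) => t dt.
  set a := dens h u t in dt *; set b := dens h v t in dt *.
  have -> : dens h w t = f1 t * a + (1 - f1 t) * b by exact: wE.
  have hm : Num.min a b = \1_A t * a + (1 - \1_A t) * b.
    rewrite indicE; have [At|At] := pselect (A t).
      rewrite mem_set// subrr mul1r mul0r addr0 min_l//.
      by move: At; rewrite /A /= -dt subr_ge0.
    rewrite memNset// subr0 mul1r mul0r add0r min_r//.
    by move: At; rewrite /A /= -dt subr_ge0 => /negP; rewrite -ltNge => /ltW.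
  (* The deviation is the error of the weight times a - b, plus a difference of two minima. *)
  have -> : f1 t * a + (1 - f1 t) * b - along (fun y => Num.min (f y) (g y)) t =
      (f1 t - \1_A t) * (a - b) + (Num.min a b - Num.min (along f t) (along g
          t)).
    by rewrite hm /along; ring.
  apply: le_trans (ler_normD _ _) _; apply: lerD; last exact: ler_norm_minB.
  rewrite normrM mulrC; apply: ler_wpM2r => //.
  by have := hC t; rewrite normr_id distrC.
Qed.

(* Differences of selectable functions form a vector lattice. *)
Definition dc (f : K * dual E -> R) : Prop := exists p q,
  [/\ selectable p, selectable q & forall y, f y = p y - q y].

Lemma dc_ext f g : f =1 g -> dc f -> dc g.
Proof. by move=> fg [p [q [sp sq fE]]]; exists p, q; split=> // y;
    rewrite -fg. Qed.

Lemma dc_lin f e : continuous f -> dc (lin f e).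
Proof.
move=> cf; exists (lin f e), (lin f 0); split; [exact: selectable_lin..|].
by move=> y; rewrite /lin dual0 sre0 mulr0 subr0.
Qed.

Lemma dcD f g : dc f -> dc g -> dc (fun y => f y + g y).
Proof.
move=> [p [q [sp sq fE]]] [p' [q' [sp' sq' gE]]].
exists (fun y => p y + p' y), (fun y => q y + q' y); split;
    [exact: selectableD..|].
by move=> y; rewrite fE gE; ring.
Qed.

Lemma dcN f : dc f -> dc (fun y => - f y).
Proof.
move=> [p [q [sp sq fE]]]; exists q, p; split=> // y; by rewrite fE opprB.
Qed.

Lemma dcZ (r : R) f : dc f -> dc (fun y => r * f y).
Proof.
move=> df; wlog r0 : r / 0 <= r => [hw|].
  case: (leP 0 r) => [/hw//|r0].
  apply: dc_ext (dcN (hw (- r) _)); last by rewrite oppr_ge0 ltW.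
  by move=> y; rewrite mulNr opprK.
have [p [q [sp sq fE]]] := df.
exists (fun y => r * p y), (fun y => r * q y); split; [exact: selectableZ..|].
by move=> y; rewrite fE mulrBr.
Qed.

(** Adding q + q' to both terms of min(p - q, p' - q') gives min(p + q', p' + q), a minimum of sums
    of selectable functions. *)
Lemma dc_min f g : dc f -> dc g -> dc (fun y => Num.min (f y) (g y)).
Proof.
move=> [p [q [sp sq fE]]] [p' [q' [sp' sq' gE]]].
exists (fun y => Num.min (p y + q' y) (p' y + q y)), (fun y => q y + q' y).
split; [by apply: selectable_min; exact: selectableD|exact: selectableD|].
move=> y; rewrite fE gE addr_minl; congr Num.min; ring.
Qed.

Lemma dc_max f g : dc f -> dc g -> dc (fun y => Num.max (f y) (g y)).
Proof.
move=> df dg; apply: dc_ext (dcN (dc_min (dcN df) (dcN dg))).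
by move=> y; rewrite oppr_min !opprK.
Qed.

Lemma dc_max_eval d n : dc (fun y => max_eval d n y.2).
Proof.
elim: n => [|n ih].
  apply: dc_ext (dc_lin 0 (f := fun=> 1) _); last by move=> t; exact: cvg_cst.
  by move=> y; rewrite /lin dual0 sre0 mulr0.
apply: (dc_max ih); apply: dc_ext (dc_lin (d n) (f := fun=> 1) _).
  by move=> y; rewrite /lin mul1r.
by move=> t; exact: cvg_cst.
Qed.

Lemma dc_zero f : dc f -> {ae P, forall t, rho t = 0 -> along f t = 0}.
Proof.
move=> [p [q [sp sq fE]]].
apply: (@filterS2 _ (almost_everywhere P) _ _ _ _ _ (sel_zero sp) (sel_zero
    sq)).
by move=> t h1 h2 r0; rewrite /along fE -/(along p t) -/(along q t) h1// h2//
    subr0.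
Qed.

Lemma dc_bam f : dc f -> bam W (on_ball f) /\ bam P (along f).
Proof.
move=> [p [q [sp sq fE]]].
rewrite (_ : f = fun y => p y - q y); last exact/funext.
by split; apply: bamB; [exact: bam_on_ball|exact: bam_on_ball|exact:
    bam_along|exact: bam_along].
Qed.

Lemma dc_integral f : dc f -> \int[W]_p on_ball f p = \int[P]_t along f t.
Proof.
move=> [p [q [sp sq fE]]].
rewrite (_ : f = fun y => p y - q y); last exact/funext.
rewrite RintegralB_bam; [|exact: bam_on_ball..].
rewrite RintegralB_bam; [|exact: bam_along..].
by rewrite !selectable_integral.
Qed.

End Classes.

(** * Homogenization *)

Section Perspective.
Context {R : realType} {k : scalar_kind} {K : ptopologicalType}
  {E : normedModType (sfield R k)}.
Local Notation F := (sfield R k).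
Hypothesis Kcompact : compact [set: K].
Hypothesis Khausdorff : hausdorff_space K.
Variable P : {finite_measure set (borel K) -> \bar R}.
Hypothesis Preg : regular P.
Variables (h : K -> dball E) (l : (K -> E) -> R) (rho : K -> R).
Hypothesis dens_ae : forall u, continuous u -> aem P (dens h u).
Hypothesis l_dens : forall u, continuous u -> l u = \int[P]_t dens h u t.
Hypothesis dens_rho0 : forall u, continuous u ->
  {ae P, forall t, rho t = 0 -> dens h u t = 0}.
Variable W : {finite_measure set (borel (K * dball E)%type) -> \bar R}.
Hypothesis W_batty : forall f, batty_class f ->
  (\int[W]_p (on_ball f p)%:E)%E = ereal_inf [set (l u)%:E | u in
    [set u : K -> E | continuous u /\
       forall t (x : dual E), f (t, x) <= sre (x (u t))]].
Variable d : nat -> E.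
Hypothesis d_le1 : forall i, rnorm (d i) <= 1.
Hypothesis rho_lim : forall t, max_eval d n (dball_val (h t)) @[n --> \oo] -->
    rho t.
Hypothesis rho_bam : bam P rho.
Hypothesis W_total : fine (W setT) = \int[P]_t rho t.

Local Notation dc := (dc P h rho).

(* f(t, x, c) is the homogenization of the function (t, x) |-> f(t, x, 1), which
   may involve constants. *)
Record perspective (f : K -> dual E -> R -> R) : Prop := Perspective {
  psp_dc : forall s, dc s -> dc (fun y => f y.1 y.2 (s y));
  psp_lip : exists2 C : R, 0 <= C & forall t x c c',
    `|f t x c - f t x c'| <= C * `|c - c'|;
  psp_cont : continuous (fun y : K * dual E => f y.1 y.2 1);
  psp_hom : forall t (r : R) x c, 0 <= r ->
    f t (sreal r *: x) (r * c) = r * f t x c;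
  psp_aem : forall (x : K -> dual E) (c : K -> R),
    (forall e : E, aem P (fun t : borel K => sre (x t e))) ->
    aem P (c : borel K -> R) ->
    aem P (fun t : borel K => f t (x t) (c t)) }.

Lemma perspective_lin (f : K -> R) e : continuous f ->
  perspective (fun t x _ => f t * sre (x e)).
Proof.
move=> cf; split.
- by move=> s _; exact: (dc_lin Kcompact dens_ae dens_rho0 e cf).
- by exists 0 => // t x c c'; rewrite subrr normr0 mul0r.
- exact: (continuous_lin (e := e) cf).
- by move=> t r x c _; rewrite [RHS]mulrCA -[r * sre _]sreMreal.
- move=> x c hx _; apply: (aem_comp2 (u := fun z => z.1 * z.2)) => //.
    exact: measurable_funM.
  by apply: aem_measurable; exact: continuous_borel.
Qed.

Lemma perspective_cst (r : R) : perspective (fun _ _ c => r * c).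
Proof.
split.
- by move=> s ds; exact: (dcZ Kcompact dens_ae).
- exists `|r| => // t x c c'; by rewrite -mulrBr normrM.
- by move=> y; exact: cvg_cst.
- by move=> t s x c _; rewrite mulrCA.
- by move=> x c _ hc; apply: (aem_comp (u := fun z => r * z)) => //;
    exact: measurable_funM.
Qed.

Lemma perspectiveD f g : perspective f -> perspective g ->
  perspective (fun t x c => f t x c + g t x c).
Proof.
move=> qf qg; split.
- move=> s ds.
  apply: (dcD Kcompact dens_ae (f := fun y => f y.1 y.2 (s y)) (g := fun y => g
      y.1 y.2 (s y)));
  exact: psp_dc.
- have [C C0 hC] := psp_lip qf; have [D D0 hD] := psp_lip qg.
  exists (C + D); first exact: addr_ge0.
  move=> t x c c'.
  have -> : f t x c + g t x c - (f t x c' + g t x c') =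
    (f t x c - f t x c') + (g t x c - g t x c') by ring.
  by apply: le_trans (ler_normD _ _) _; rewrite mulrDl; exact: lerD.
- by move=> y; apply: cvgD; [exact: psp_cont qf _|exact: psp_cont qg _].
- by move=> t r x c r0; rewrite !psp_hom// mulrDr.
- move=> x c hx hc; apply: (aem_comp2 (u := fun z => z.1 + z.2)).
  + exact: measurable_funD.
  + exact: psp_aem.
  + exact: psp_aem.
Qed.

Lemma perspectiveN f : perspective f -> perspective (fun t x c => - f t x c).
Proof.
move=> qf; split.
- by move=> s ds; apply: (dcN (f := fun y => f y.1 y.2 (s y))); exact: psp_dc.
- have [C C0 hC] := psp_lip qf; exists C => // t x c c'.
  by rewrite -opprD normrN; exact: hC.
- by move=> y; apply: cvgN; exact: psp_cont qf _.
- by move=> t r x c r0; rewrite psp_hom// mulrN.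
- move=> x c hx hc; apply: (aem_comp (u := fun z => - z)); last exact: psp_aem.
  by apply: measurable_funN.
Qed.

Lemma perspective_min f g : perspective f -> perspective g ->
  perspective (fun t x c => Num.min (f t x c) (g t x c)).
Proof.
move=> qf qg; split.
- move=> s ds.
  apply: (dc_min Kcompact Khausdorff Preg dens_ae (f := fun y => f y.1 y.2 (s
      y))
    (g := fun y => g y.1 y.2 (s y))); exact: psp_dc.
- have [C C0 hC] := psp_lip qf; have [D D0 hD] := psp_lip qg.
  exists (C + D); first exact: addr_ge0.
  move=> t x c c'.
  by apply: le_trans (ler_norm_minB _ _ _ _) _; rewrite mulrDl; exact: lerD.
- by move=> y; apply: (@continuous_min _ _ (fun y : K * dual E => f y.1 y.2 1)
    (fun y => g y.1 y.2 1));
    [exact: psp_cont qf _|exact: psp_cont qg _].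
- by move=> t r x c r0; rewrite !psp_hom// minr_pMr.
- move=> x c hx hc; apply: (aem_comp2 (u := fun z => Num.min z.1 z.2)).
  + exact: measurable_minr.
  + exact: psp_aem.
  + exact: psp_aem.
Qed.

Lemma perspective_ext f g : (forall t x c, f t x c = g t x c) ->
  perspective f -> perspective g.
Proof.
by move=> fg; rewrite (_ : f = g)//; apply/funext => t; apply/funext => x;
    apply/funext.
Qed.

Lemma perspectiveB f g : perspective f -> perspective g ->
  perspective (fun t x c => f t x c - g t x c).
Proof. by move=> qf qg; apply: perspectiveD => //; exact: perspectiveN. Qed.

Lemma perspective_max f g : perspective f -> perspective g ->
  perspective (fun t x c => Num.max (f t x c) (g t x c)).
Proof.
move=> qf qg.
apply: perspective_ext (perspectiveN (perspective_min (perspectiveN qf)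
    (perspectiveN qg))).
by move=> t x c; rewrite oppr_min !opprK.
Qed.

Lemma perspective_norm f : perspective f -> perspective (fun t x c => `|f t x
    c|).
Proof.
move=> qf; apply: perspective_ext (perspective_max qf (perspectiveN qf)).
by move=> t x c; rewrite maxrN.
Qed.

Let s n (y : K * dual E) := max_eval d n y.2.

Let dc_s n : dc (s n). Proof. exact: dc_max_eval. Qed.

Let rho_itv t : 0 <= rho t <= 1 := rho_itv d_le1 rho_lim t.

(** At c = 0 the function belongs to the lattice and is bounded on the ball; the Lipschitz bound
    covers the other c in [0, 1]. *)
Lemma psp_bounded f : perspective f -> exists M : R,
  forall t (x : dball E) c, 0 <= c <= 1 -> `|f t (dball_val x) c| <= M.
Proof.
move=> qf; have [C C0 hC] := psp_lip qf.
have dc0 : dc (fun=> 0).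
  apply: dc_ext (dcZ Kcompact dens_ae 0 (dc_s 0%N)).
  by move=> y; rewrite mul0r.
have [[[M hM] _] _] := dc_bam W (psp_dc qf dc0).
exists (M + C) => t x c /andP[c0 c1].
have -> : f t (dball_val x) c =
  f t (dball_val x) 0 + (f t (dball_val x) c - f t (dball_val x) 0) by ring.
apply: le_trans (ler_normD _ _) _; apply: lerD; first exact: (hM (t, x)).
by apply: le_trans (hC _ _ _ _) _; rewrite subr0 ger0_norm// ler_piMr.
Qed.

Lemma continuous_ball_incl :
  continuous (fun p : K * dball E => (p.1, dball_val p.2)).
Proof.
move=> p.
have h1 : q.1 @[q --> p] --> p.1 by exact: cvg_fst.
have h2 : dball_val q.2 @[q --> p] --> dball_val p.2.
  by apply: (@cvg_comp _ _ _ snd (@dball_val R k E));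
      [exact: cvg_snd|exact: continuous_dball_val].
exact: (cvg_pair h1 h2).
Qed.

Lemma psp_bam_ball f : perspective f ->
  bam W (fun p => f p.1 (dball_val p.2) 1).
Proof.
move=> qf; have [M hM] := psp_bounded qf.
apply: (@bam_measurable _ _ _ _ _ M).
  by move=> p; apply: hM; rewrite ler01 lexx.
apply: continuous_borel => p.
apply: (@cvg_comp _ _ _ (fun p : K * dball E => (p.1, dball_val p.2))
  (fun y : K * dual E => f y.1 y.2 1)); last exact: (@psp_cont _ qf (p.1,
      dball_val p.2)).
exact: continuous_ball_incl.
Qed.

Lemma aem_eval (e : E) : aem P (fun t : borel K => sre (dball_val (h t) e)).
Proof. by apply: (dens_ae (u := fun=> e)) => t; exact: cvg_cst. Qed.

Lemma psp_bam_rho f : perspective f ->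
  bam P (fun t => f t (dball_val (h t)) (rho t)).
Proof.
move=> qf; have [M hM] := psp_bounded qf; split.
  by exists M => t; apply: hM; exact: rho_itv.
by apply: psp_aem => //; [exact: aem_eval|have [] := rho_bam].
Qed.

(** The L^1 distance from s_n(h) to rho under P. By [W_total] and [dc_integral] it is also the L^1
    distance from s_n to 1 under W. *)
Let gap n := \int[P]_t rho t - \int[P]_t along h (s n) t.

Lemma gap_cvg : gap n @[n --> \oo] --> (0 : R).
Proof.
rewrite -(subrr (\int[P]_t rho t)); apply: cvgB; first exact: cvg_cst.
apply: (dominated_Rintegral (B := 1)).
- by move=> n; have [] := dc_bam W (dc_s n).
- move=> n t; rewrite ger0_norm ?max_eval_ge0//; exact: max_eval_le1.
- by move=> t; have /andP[r0 r1] := rho_itv t; rewrite ger0_norm.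
- by move=> t; exact: (@rho_lim t).
Qed.

(** Substituting s_n for c yields a lattice function with equal integrals on the two sides; the
    Lipschitz bound keeps each side within [C * gap n] of that common value. *)
Lemma psp_integral f : perspective f ->
  \int[W]_p f p.1 (dball_val p.2) 1 = \int[P]_t f t (dball_val (h t)) (rho t).
Proof.
move=> qf; have [C C0 hC] := psp_lip qf.
have bW := psp_bam_ball qf; have bP := psp_bam_rho qf.
have b1 n : bam W (on_ball (fun y => f y.1 y.2 (s n y))).
  by have [] := dc_bam W (psp_dc qf (dc_s n)).
have b2 n : bam P (along h (fun y => f y.1 y.2 (s n y))).
  by have [] := dc_bam W (psp_dc qf (dc_s n)).
have bsW n : bam W (on_ball (s n)) by have [] := dc_bam W (dc_s n).
have bsP n : bam P (along h (s n)) by have [] := dc_bam W (dc_s n).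
have dI f0 : dc f0 -> \int[W]_p on_ball f0 p = \int[P]_t along h f0 t.
  exact: (dc_integral Kcompact dens_ae l_dens W_batty).
have h1 n : `|\int[W]_p f p.1 (dball_val p.2) 1 -
    \int[W]_p on_ball (fun y => f y.1 y.2 (s n y)) p| <= C * gap n.
  rewrite -RintegralB_bam//; apply: le_trans (le_norm_Rintegral_bam _) _;
      first exact: bamB.
  have -> : C * gap n = \int[W]_p (C * (1 - on_ball (s n) p)).
    have bc : bam W (fun=> 1) by exact: bam_cst.
    rewrite RintegralZ_bam; last exact: bamB.
    rewrite RintegralB_bam// Rintegral_cst// mul1r W_total /gap.
    by rewrite dI.
  apply: le_Rintegral_bam; first by apply: bam_norm; exact: bamB.
    by apply: bamZ; apply: bamB => //; exact: bam_cst.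
  move=> p; apply: le_trans (hC _ _ _ _) _; apply: ler_wpM2l => //.
  by rewrite ger0_norm// subr_ge0; exact: max_eval_le1.
have h2 n : `|\int[P]_t f t (dball_val (h t)) (rho t) -
    \int[P]_t along h (fun y => f y.1 y.2 (s n y)) t| <= C * gap n.
  rewrite -RintegralB_bam//; apply: le_trans (le_norm_Rintegral_bam _) _;
      first exact: bamB.
  rewrite /gap -RintegralB_bam// -RintegralZ_bam; last exact: bamB.
  apply: le_Rintegral_bam; first by apply: bam_norm; exact: bamB.
    by apply: bamZ; exact: bamB.
  move=> t; apply: le_trans (hC _ _ _ _) _; apply: ler_wpM2l => //.
  rewrite ger0_norm// subr_ge0.
  rewrite -(cvg_lim (@Rhausdorff R) (@rho_lim t)).
  apply: (@nondecreasing_cvgn_le _ (fun n => max_eval d n (dball_val (h t)))).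
    by apply/nondecreasing_seqP => m /=; rewrite le_max lexx.
  by apply/cvg_ex; exists (rho t); exact: (@rho_lim t).
have gap0 n : 0 <= C * gap n by apply: le_trans (h1 n); exact: normr_ge0.
apply/eqP; rewrite -subr_eq0 -normr_eq0 eq_le normr_ge0 andbT.
have gC : (C * gap n + C * gap n) @[n --> \oo] --> (C * 0 + C * 0 : R).
  by apply: cvgD; apply: cvgM; [exact: cvg_cst|exact: gap_cvg|exact:
      cvg_cst|exact: gap_cvg].
rewrite mulr0 addr0 in gC.
apply: (cvgn_ge_cst gC) => n.
apply: le_trans (lerD (h1 n) (h2 n)); rewrite dI; last exact: psp_dc (dc_s n).
set a := \int[W]_p _; set b := \int[P]_t f _ _ _; set c := \int[P]_t _.
have -> : a - b = (a - c) - (b - c) by ring.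
exact: ler_normB.
Qed.

(** Every s_n vanishes at x = 0 and is at most 1 on the ball, so the indicator of Z is below 1 -
    s_n, whose W-integral is [gap n]. *)
Lemma zero_fiber_null (Z : set (borel (K * dball E)%type)) : measurable Z ->
  (forall p, Z p -> dball_val p.2 = 0) -> W Z = 0%E.
Proof.
move=> mZ Z0.
have bsW n : bam W (on_ball (s n)) by have [] := dc_bam W (dc_s n).
have dI f0 : dc f0 -> \int[W]_p on_ball f0 p = \int[P]_t along h f0 t.
  exact: (dc_integral Kcompact dens_ae l_dens W_batty).
rewrite -[LHS]fineK ?fin_num_measure//; congr (_%:E).
apply/eqP; rewrite eq_le fine_ge0// andbT.
apply: (cvgn_ge_cst gap_cvg) => n.
have bc : bam W (fun=> 1) by exact: bam_cst.
have -> : gap n = \int[W]_p (1 - on_ball (s n) p).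
  by rewrite RintegralB_bam// Rintegral_cst// mul1r W_total /gap dI.
rewrite -Rintegral_indic_bam//; apply: le_Rintegral_bam; first exact: bam_indic.
  exact: bamB.
move=> p; rewrite indicE; have [Zp|Zp] := pselect (Z p).
  by rewrite mem_set// /on_ball /s /= Z0// max_eval_zero subr0.
by rewrite memNset// subr_ge0; exact: max_eval_le1.
Qed.

End Perspective.

(** * Separation by lattice functions *)

(** Im z = Re(-i z), with j = 0 over the real scalars. Thus functions built from real parts also
    control imaginary parts. *)
Lemma sim_as_sre (R : realType) (k : scalar_kind) :
  exists j : sfield R k, forall z, sim z = sre (j * z).
Proof.
case: k => [|]; first by exists 0 => z; rewrite mul0r.
exists (0 +i* (-1))%C => -[a b] /=; ring.
Qed.

Section Separation.
Context {R : realType} {k : scalar_kind} {K : ptopologicalType}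
  {E : normedModType (sfield R k)}.
Local Notation F := (sfield R k).
Hypothesis Kcompact : compact [set: K].
Hypothesis Khausdorff : hausdorff_space K.
Variable P : {finite_measure set (borel K) -> \bar R}.
Hypothesis Preg : regular P.
Variables (h : K -> dball E) (rho : K -> R).
Hypothesis dens_ae : forall u, continuous u -> aem P (dens h u).
Hypothesis dens_rho0 : forall u, continuous u ->
  {ae P, forall t, rho t = 0 -> dens h u t = 0}.
Local Notation perspective := (perspective P h rho).

Let psp_min f g : perspective f -> perspective g ->
  perspective (fun t x c => Num.min (f t x c) (g t x c)).
Proof. exact: perspective_min. Qed.

Let psp_max f g : perspective f -> perspective g ->
  perspective (fun t x c => Num.max (f t x c) (g t x c)).
Proof. exact: perspective_max. Qed.

Let pspB f g : perspective f -> perspective g ->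
  perspective (fun t x c => f t x c - g t x c).
Proof. exact: perspectiveB. Qed.

Let pspD f g : perspective f -> perspective g ->
  perspective (fun t x c => f t x c + g t x c).
Proof. exact: perspectiveD. Qed.

Let psp_norm f : perspective f -> perspective (fun t x c => `|f t x c|).
Proof. exact: perspective_norm. Qed.

Let psp_cst (r : R) : perspective (fun _ _ c => r * c).
Proof. exact: perspective_cst. Qed.

Let psp_lin (f : K -> R) e : continuous f -> perspective (fun t x _ => f t *
    sre (x e)).
Proof. exact: perspective_lin. Qed.

Lemma perspective_eval (e : E) : perspective (fun _ x _ => sre (x e)).
Proof.
have c1 : continuous (fun _ : K => 1 : R) by move=> t; exact: cvg_cst.
by apply: perspective_ext (psp_lin e c1) => t x c; rewrite mul1r.
Qed.

(* The sets separated from p0 by perspective functions form a filter; it converges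
   to p0, hence contains every neighbourhood of p0. *)
Definition minorants (p0 : K * dball E) : set_system (K * dball E) :=
  [set O | exists f, [/\ perspective f, 1 < f p0.1 (dball_val p0.2) 1 &
    forall p, ~ O p -> f p.1 (dball_val p.2) 1 <= 0]].

#[local] Instance minorants_filter p0 : Filter (minorants p0).
Proof.
split.
- exists (fun _ _ c => 2 * c); split; first exact: psp_cst.
    by rewrite mulr1 ltr1n.
  by move=> p /(_ Logic.I).
- move=> O1 O2 [f [pf f1 f0]] [g [pg g1 g0]].
  exists (fun t x c => Num.min (f t x c) (g t x c)); split;
      first exact: psp_min.
    by rewrite lt_min f1 g1.
  move=> p /not_andP[/f0|/g0] hp; rewrite ge_min hp ?orbT//.
- move=> O1 O2 sO [f [pf f1 f0]]; exists f; split=> // p nO2.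
  by apply: f0 => /sO.
Qed.

Lemma dual_neq0 (x : dual E) : x <> 0 -> exists e, x e != 0.
Proof.
move=> x0; apply: contrapT => hx; apply: x0.
apply: val_inj; apply/funext => e /=.
by apply/eqP; apply: contrapT => /negP xe; apply: hx; exists e.
Qed.

(** Convergence is tested coordinatewise. In K, the localizing function is a bump f(t) times some Re
    x(z), which can be made positive at p0 because the functional there is nonzero. In the ball,
    weak* convergence is tested at each vector e. *)
Lemma minorants_cvg p0 : dball_val p0.2 <> 0 -> minorants p0 --> p0.
Proof.
move=> p00.
have h1 : p.1 @[p --> minorants p0] --> p0.1.
  move=> V; rewrite nbhsE => -[V' [oV' V'p] V'V].
  have V'1 : [set p0.1] `<=` V' by move=> _ ->.
  have [f [cf f01 f1 f0]] := urysohn_compact_open Kcompact Khausdorff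
    (@compact_set1 K p0.1) oV' V'1 (R := R).
  have [e xe] := dual_neq0 p00.
  have [w w1 we] := rotate_rnorm (dball_val p0.2 e).
  pose a := rnorm (dball_val p0.2 e : F^o).
  have a0 : 0 < a.
    rewrite lt_neqAle rnorm_ge0 andbT eq_sym; apply: contra_neq xe.
    exact: (@rnorm_eq0 _ _ F^o).
  (* The factor 2/a gives the value 2 at p0, above the threshold 1. *)
  exists (fun t x _ => f t * sre (x ((sreal (2 / a) * w) *: e))); split.
  - exact: psp_lin.
  - rewrite f1// mul1r dualZ -mulrA we -/a -srealM sreK divfK ?gt_eqF//; lra.
  - by move=> p nV; rewrite f0 ?mul0r// => /V'V.
have [j jE] := sim_as_sre R k.
have h2 : p.2 @[p --> minorants p0] --> p0.2.
  apply: cvg_dballP => e; apply/cvg_rnormP => r r0.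
  (* The function below starts from 2 and subtracts N times the distances of the real and imaginary
     parts of x(e) to those at p0: it is 2 at p0 and at most 2 - N r = 0 once |x(e) - x0(e)| >=
     r. *)
  have [N N0 Nr] : exists2 N : R, 0 < N & N * r = 2.
    by exists (2 / r); rewrite ?divr_gt0// divfK// gt_eqF.
  pose a := sre (dball_val p0.2 e); pose b := sim (dball_val p0.2 e).
  exists (fun t x c => 2 * c - (`|sre (x ((sreal N : F) *: e)) - (N * a) * c| +
    `|sre (x ((sreal N * j : F) *: e)) - (N * b) * c|)); split.
  - apply: pspB; first exact: psp_cst.
    apply: pspD; apply: psp_norm; (apply: pspB;
        [exact: perspective_eval|exact: psp_cst]).
  - rewrite !dualZ -[sreal N * j * _]mulrA !sreMreal -jE -/a -/b !mulr1 !subrr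
      !normr0; lra.
  - move=> p /= /negP; rewrite -leNgt => hp.
    rewrite !dualZ -[sreal N * j * _]mulrA !sreMreal -jE !mulr1
      -!mulrBr !normrM (gtr0_norm N0) -mulrDr.
    have hle := le_trans hp (ler_rnorm_resim (dball_val p0.2 e - dball_val p.2
        e)).
    rewrite sreD sreN simD simN -/a -/b [`|a - _|]distrC [`|b - _|]distrC in
        hle.
    rewrite subr_le0; apply: le_trans (ler_wpM2l (ltW N0) hle).
    by rewrite Nr.
move=> O Op0.
have hO : nbhs (p0.1, p0.2) O by move: Op0; rewrite -surjective_pairing.
have mO : minorants p0 [set p | O (p.1, p.2)].
  by apply: (cvg_pair h1 h2 hO).
by apply: (@filterS _ (minorants p0) (minorants_filter p0) _ _ _ mO) => p /=;
    rewrite -surjective_pairing.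
Qed.

(** Single points of C are separated from the complement of U by [minorants_cvg]; compactness and
    maxima extend this to C, and truncation gives the values 0 and 1. *)
Lemma perspective_urysohn (C U : set (K * dball E)) : compact C -> open U ->
  C `<=` U -> (forall p, U p -> dball_val p.2 <> 0) ->
  exists f, [/\ perspective f, forall t x, 0 <= f t x 1 <= 1,
    forall p, C p -> f p.1 (dball_val p.2) 1 = 1 &
    forall p, ~ U p -> f p.1 (dball_val p.2) 1 = 0].
Proof.
move=> cC oU CU U0.
pose above (S : set (K * dball E)) := exists f, [/\ perspective f,
  forall p, S p -> 1 < f p.1 (dball_val p.2) 1 &
  forall p, ~ U p -> f p.1 (dball_val p.2) 1 <= 0].
have [f [pf fC fU]] : above C.
  (* If C could not be separated, the sets S with C minus S separable would form a proper filter
     containing C. At a cluster point p in C, a minorant f makes {f > 1} a neighbourhood of p whose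
     complement is in the filter. *)
  apply: contrapT => nC.
  pose G : set_system (K * dball E) := [set S | above (C `\` S)].
  have above_sub S T : S `<=` T -> above T -> above S.
    by move=> ST [f [pf f1 f0]]; exists f; split=> // p /ST; exact: f1.
  have FG : ProperFilter G.
    split; first by rewrite /G /= setD0.
    split.
    - exists (fun _ _ c => 0 * c); split; first exact: psp_cst.
        by move=> p [_ /(_ Logic.I)].
      by move=> p _; rewrite mul0r.
    - move=> S T [f [pf f1 f0]] [g [pg g1 g0]].
      exists (fun t x c => Num.max (f t x c) (g t x c)); split;
          first exact: psp_max.
        by move=> p [Cp /not_andP[nS|nT]]; rewrite lt_max; apply/orP;
          [left; exact: f1|right; exact: g1].
      by move=> p nU; rewrite ge_max f0// g0.
    - move=> S T ST; apply: above_sub => p [Cp nT].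
      by split=> // Sp; apply: nT; exact: ST.
  have GC : G C.
    exists (fun _ _ c => 0 * c); split; first exact: psp_cst.
      by move=> p [].
    by move=> p _; rewrite mul0r.
  have [p [Cp clp]] := cC G FG GC.
  have [f [pf f1 f0]] := minorants_cvg (U0 _ (CU _ Cp)) (open_nbhs_nbhs (conj
      oU (CU _ Cp))).
  pose B := [set q : K * dball E | 1 < f q.1 (dball_val q.2) 1].
  have nB : nbhs p B.
    apply: open_nbhs_nbhs; split=> //.
    have cf : continuous (fun q : K * dball E => f q.1 (dball_val q.2) 1).
      move=> q.
      apply: (@cvg_comp _ _ _ (fun p : K * dball E => (p.1, dball_val p.2))
        (fun y : K * dual E => f y.1 y.2 1)); first exact: continuous_ball_incl.
      exact: (@psp_cont _ _ _ _ _ _ _ _ pf (q.1, dball_val q.2)).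
    by move/continuousP : cf => /(_ [set y | 1 < y]); apply; exact: open_gt.
  have GB : G (~` B).
    by exists f; split=> // q [_ /contrapT].
  by have [q [? ?]] := clp _ _ GB nB.
(* The bounds 0 and 1 are written as multiples of c to keep homogeneity; at c = 1 the truncation
   holds on all of E^*, also outside the ball. *)
exists (fun t x c => Num.max (0 * c) (Num.min (1 * c) (f t x c))); split.
- by apply: psp_max; [exact: psp_cst|apply: psp_min => //; exact: psp_cst].
- by move=> t x; rewrite mul0r mul1r le_max lexx /= ge_max ler01 /= ge_min lexx.
- by move=> p /fC f1; rewrite mul0r mul1r min_l ?ltW// max_r.
- move=> p /fU f0; rewrite mul0r mul1r min_r; last exact: le_trans f0 ler01.
  by rewrite max_l.
Qed.

End Separation.

(** * Regular measures, norming sequences *)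

Lemma dual_seminorm (R : realType) (k : scalar_kind) (E : normedModType (sfield
    R k)) :
  [/\ forall f g : dual E, dnorm (f + g) <= dnorm f + dnorm g,
      forall f : dual E, dnorm (- f) = dnorm f &
      forall f : dual E, dnorm f = 0 <-> f = 0].
Proof.
split; [exact: ler_dnormD|exact: dnormN|move=> f; split=> [f0|->];
    last exact: dnorm_zero].
apply: val_inj; apply/funext => x /=; apply: (@rnorm_eq0 _ _ (sfield R k)^o).
by apply/eqP; rewrite eq_le rnorm_ge0 andbT (le_trans (ler_dnorm f x))// f0
    mul0r.
Qed.

Lemma svar_measure (R : realType) (k : scalar_kind) (X : ptopologicalType)
    (nu : set (borel X) -> sfield R k) : scalar_measure nu ->
  exists M : {finite_measure set (borel X) -> \bar R},
    M = svar nu :> (set (borel X) -> \bar R).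
Proof.
move=> [nu_sigma nu_fin _]; have [nD nN n0] := @rnorm_seminorm R k.
exact: (variation_measure nD nN n0 nu_sigma nu_fin).
Qed.

Lemma dvar_measure (R : realType) (k : scalar_kind) (X : ptopologicalType)
    (E : normedModType (sfield R k)) (mu : set (borel X) -> dual E) :
  dual_measure mu ->
  exists M : {finite_measure set (borel X) -> \bar R},
    M = dvar mu :> (set (borel X) -> \bar R).
Proof.
move=> [mu_sigma mu_fin _]; have [nD nN n0] := @dual_seminorm R k E.
exact: (variation_measure nD nN n0 mu_sigma mu_fin).
Qed.

(** A genuine integral obeys [integral_bound] with no pieces; the default value 0 obeys the bound
    because b is nonnegative. *)
Lemma dintegral_le (R : realType) (k : scalar_kind) (X : ptopologicalType)
    (E : normedModType (sfield R k)) (mu : set (borel X) -> dual E)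
    (L : {finite_measure set (borel X) -> \bar R}) (u : X -> E) b :
  dual_measure mu -> L = dvar mu :> (set (borel X) -> \bar R) -> bam L b ->
  (forall t, rnorm (u t) <= b t) -> sre (dintegral_of mu u) <= \int[L]_t b t.
Proof.
move=> mu_reg LE bb ub; have [nD nN n0] := @dual_seminorm R k E.
rewrite /dintegral_of; case: xgetP => [v _ hv|_].
  apply: le_trans (ler_norm _) _; apply: le_trans (normr_sre _) _.
  have := @integral_bound R k X (dual E) E (@dnorm R k E) mu (fun phi x => phi
      x)
    nD nN n0 mu_reg (fun _ _ _ => erefl) (fun v w1 w2 => dualD v w1 w2) (fun f
        x => ler_dnorm f x) L LE
    u v 0%N (fun=> set0) (fun=> 0) b hv (fun=> measurable0) bb.
  rewrite big_ord0 subr0; apply => t; rewrite big_ord0 subr0; exact: ub.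
rewrite sre0; apply: Rintegral_ge0 => t _.
exact: le_trans (rnorm_ge0 _) (ub t).
Qed.

Lemma fst_pushforward_measure (R : realType) (X Y : ptopologicalType)
    (M : {finite_measure set (borel (X * Y)%type) -> \bar R}) :
  exists P : {finite_measure set (borel X) -> \bar R},
    P = pushforward M (fst : borel (X * Y)%type -> borel X) :> (set (borel X)
        -> \bar R).
Proof.
have mf : measurable_fun setT (fst : borel (X * Y)%type -> borel X).
  by apply: continuous_borel_map => p; exact: cvg_fst.
unshelve refine (@finite_measure_of _ _ R
  (pushforward M (fst : borel (X * Y)%type -> borel X) : Measure.type _ _) _)
      => //.
by rewrite /= /pushforward preimage_setT -ge0_fin_numE// fin_num_measure.
Qed.

Lemma hausdorff_separate (T : topologicalType) : (forall x y : T, x != y ->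
    exists (T' : topologicalType) (f : T -> T'),
      [/\ hausdorff_space T', continuous f & f x != f y]) -> hausdorff_space T.
Proof.
move=> sep; rewrite open_hausdorff => x y xy.
have [T' [f [hT' /continuousP cf fxy]]] := sep _ _ xy.
move: hT'; rewrite open_hausdorff => /(_ _ _ fxy)[[A B] /= [fxA fyB] [oA oB
    AB]].
exists (f @^-1` A, f @^-1` B) => /=.
  by rewrite !inE /=; move: fxA fyB; rewrite !inE.
by split; [exact: cf|exact: cf|rewrite -preimage_setI (eqP AB) preimage_set0].
Qed.

Lemma hausdorff_dball (R : realType) (k : scalar_kind) (E : normedModType
    (sfield R k)) :
  hausdorff_space (dball E).
Proof.
apply: hausdorff_separate => x y xy.
have [e xye] : exists e, dball_val x e != dball_val y e.
  apply: contrapT => hx; move/eqP : xy; apply; apply: val_inj; apply: val_inj.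
  apply/funext => e; apply/eqP; apply: contrapT => /negP xe.
  by apply: hx; exists e.
exists (sfield R k)^o, (fun z : dball E => dball_val z e); split=> //.
move=> z; apply: (@cvg_comp _ _ _ (@dball_val R k E) (fun x : dual E => x e :
    (sfield R k)^o)).
  exact: continuous_dball_val.
exact: continuous_eval.
Qed.

Lemma hausdorff_pair (X Y : topologicalType) : hausdorff_space X ->
    hausdorff_space Y ->
  hausdorff_space (X * Y)%type.
Proof.
move=> hX hY; apply: hausdorff_separate => -[x1 y1] [x2 y2].
rewrite xpair_eqE negb_and => /orP[h|h].
  by exists X, fst; split=> // p; exact: cvg_fst.
by exists Y, snd; split=> // p; exact: cvg_snd.
Qed.

(** Projecting a compact subset of the preimage of A gives inner approximation by compact sets.
    Applied to the complement of A it gives the open set as well, compact sets being closed in K. *)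
Lemma regular_fst (R : realType) (X Y : ptopologicalType)
    (M : {finite_measure set (borel (X * Y)%type) -> \bar R}) :
  compact [set: X] -> hausdorff_space X -> hausdorff_space Y -> regular M ->
  regular (pushforward M (fst : borel (X * Y)%type -> borel X)).
Proof.
move=> cX hX hY Mreg.
have hXY := hausdorff_pair hX hY.
have mf : measurable_fun setT (fst : borel (X * Y)%type -> borel X).
  by apply: continuous_borel_map => p; exact: cvg_fst.
have mpre (B : set (borel X)) : measurable B ->
    measurable ((fst : borel (X * Y)%type -> borel X) @^-1` B).
  by move=> mB; rewrite -[X in measurable X]setTI; exact: mf.
have inner (A : set (borel X)) (e : R) : measurable A -> 0 < e -> exists C :
    set X,
    [/\ compact C, C `<=` A & (M (fst @^-1` (A `\` C)) < e%:E)%E].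
  move=> mA e0; have [C [U [cC oU CA AU MUC]]] := Mreg _ (mpre _ mA) _ e0.
  have cC1 : compact (fst @` C).
    apply: continuous_compact => //; apply: continuous_subspaceT => p.
    exact: cvg_fst.
  exists (fst @` C); split=> //; first by move=> _ [p Cp <-]; exact: CA.
  apply: le_lt_trans MUC; apply: le_measure; rewrite ?inE.
  - by apply: mpre; apply: measurableD => //; exact: compact_borel.
  - by apply: measurableD; [exact: open_borel|exact: compact_borel].
  - by move=> p [Ap nC]; split; [exact: AU|move=> Cp; apply: nC; exists p].
move=> A mA e e0; have e20 : 0 < e / 2 by rewrite divr_gt0.
have [C [cC CA hC]] := inner _ _ mA e20.
have [D [cD DA hD]] := inner _ _ (measurableC mA) e20.
have mC := compact_borel hX cC; have mD := compact_borel hX cD.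
exists C, (~` D); split=> //.
- by apply: closed_openC; exact: compact_closed.
- by move=> x Ax /DA.
have -> : e%:E = ((e / 2)%:E + (e / 2)%:E)%E by rewrite -EFinD -splitr.
apply: le_lt_trans (lteD hC hD).
rewrite /pushforward; apply: le_trans (measureU2 _ _ _); last first.
- by apply: mpre; apply: measurableD => //; exact: measurableC.
- by apply: mpre; apply: measurableD.
apply: le_measure; rewrite ?inE.
- by apply: mpre; apply: measurableD => //; exact: measurableC.
- apply: measurableU; apply: mpre; apply: measurableD => //; exact: measurableC.
- move=> p [nD nC]; have [Ap|nA] := pselect (A p.1); [left|right]; split=> //.
Qed.

(** A countable dense subset of [S], scaled into the unit ball. Real parts suffice to recover the
    norm because S is stable under multiplication by scalars. *)
Lemma norming_sequence (R : realType) (k : scalar_kind)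
    (E : normedModType (sfield R k)) (S : set E) : separable_subspace S ->
  exists d : nat -> E, (forall i, rnorm (d i) <= 1) /\
    forall x : dball E, max_eval d n (dball_val x) @[n --> \oo] -->
      dnorm_on S (dball_val x).
Proof.
move=> [S0 Slin [D [/countable_injP[f fD] DS SD]]].
(* An index that codes no element of D gets the default 0, which belongs to S. *)
pose D' i := xget 0 [set x | D x /\ f x = i].
have D'S i : S (D' i).
  by rewrite /D'; case: xgetP => [x _ [Dx _]|_ //]; exact: DS.
have D'D x : D x -> exists i, D' i = x.
  move=> Dx; exists (f x); rewrite /D'; case: xgetP => [y _ [Dy fyx]|/(_ x)];
      last by case.
  by apply: fD; rewrite ?inE.
(* Division by [m x] brings x into the unit ball and fixes the vectors already there. *)
pose m (x : E) := Num.max 1 (rnorm x).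
have m1 x : 1 <= m x by rewrite le_max lexx.
have m0 x : 0 < m x by exact: lt_le_trans ltr01 (m1 x).
pose d i : E := sreal (m (D' i))^-1 *: D' i.
have SZ (a : sfield R k) x : S x -> S (a *: x).
  by move=> Sx; rewrite -[a *: x]addr0; exact: Slin.
have d1 i : rnorm (d i) <= 1.
  rewrite rnormZ rnorm_sreal ger0_norm ?invr_ge0 ?(ltW (m0 _))// mulrC
      ler_pdivrMr// mul1r.
  by rewrite le_max lexx orbT.
exists d; split=> // x.
have nd : nondecreasing_seq (fun n => max_eval d n (dball_val x)).
  by apply/nondecreasing_seqP => n /=; rewrite le_max lexx.
have ub n : max_eval d n (dball_val x) <= dnorm_on S (dball_val x).
  elim: n => [|n ih] /=; first exact: dnorm_on_ge0.
  rewrite ge_max ih /=; apply: le_trans (ler_norm _) _.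
  by apply: le_trans (normr_sre _) _; apply: dnorm_on_ge => //; exact: SZ.
apply/cvgrPdist_lt => e e0.
have e20 : 0 < e / 2 by rewrite divr_gt0.
have e40 : 0 < e / 4 by rewrite divr_gt0.
have hS : has_sup [set rnorm (dball_val x z) | z in S `&` [set z | rnorm z <=
    1]].
  split; last exact: dnorm_on_ubound.
  by exists (rnorm (dball_val x 0)), 0 => //; split=> //=; rewrite rnorm0 ler01.
have [_ [y [Sy /= y1] <-] hy] := sup_adherent e20 hS.
rewrite -/(dnorm_on S (dball_val x)) in hy.
have [w w1 wy] := rotate_rnorm (dball_val x y).
have Sz : S (w *: y) by exact: SZ.
have xz : sre (dball_val x (w *: y)) = rnorm (dball_val x y) by rewrite dualZ
    wy sreK.
have z1 : rnorm (w *: y) <= 1 by rewrite rnormZ -[leRHS]mulr1 ler_pM ?rnorm_ge0.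
set z := w *: y in Sz xz z1.
have [v [Dv zv]] := SD _ Sz _ (near_rnorm z e40).
have [i iv] := D'D _ Dv.
(* v is within e/4 of the unit ball, so passing to [d i] = v / m v moves it by at most m v - 1 <=
   e/4. The losses are e/2 for the supremum, e/4 for density and e/4 here. *)
have mv : m v <= 1 + e / 4.
  rewrite ge_max; apply/andP; split; first by rewrite lerDl ltW.
  have -> : v = z + - (z - v) by rewrite opprB addrC subrK.
  by apply: le_trans (ler_rnormD _ _) _; rewrite rnormN; apply: lerD => //;
      exact: ltW.
have dv : rnorm (v - d i) <= e / 4.
  have -> : v - d i = (sreal (1 - (m v)^-1) : sfield R k) *: v.
    by rewrite /d iv srealD srealN sreal1 scalerBl scale1r.
  rewrite rnormZ rnorm_sreal ger0_norm; last by rewrite subr_ge0 invf_le1.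
  apply: le_trans (_ : _ <= (1 - (m v)^-1) * m v) _.
    by rewrite ler_wpM2l ?subr_ge0 ?invf_le1// le_max lexx orbT.
  by rewrite mulrBl mul1r mulVf ?gt_eqF//; lra.
have xd : dnorm_on S (dball_val x) - e < sre (dball_val x (d i)).
  have : sre (dball_val x z) - sre (dball_val x (d i)) <= rnorm (z - d i).
    rewrite -sreN -sreD -dualN -dualD; apply: le_trans (ler_norm _) _.
    exact: dball_sre.
  have : rnorm (z - d i) <= rnorm (z - v) + rnorm (v - d i).
    by apply: le_trans (ler_rnormD _ _); rewrite addrA subrK.
  rewrite xz; move: zv hy dv => /=; lra.
exists i.+1 => // n /= ni.
have := nd _ _ ni => /= hn; have := ub n.
have : sre (dball_val x (d i)) <= max_eval d n (dball_val x).
  by apply: le_trans hn; rewrite le_max lexx orbT.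
move=> h1 h2; rewrite ger0_norm ?subr_ge0//; lra.
Qed.

(** * The normalized density *)

Lemma measurable_inv (R : realType) : measurable_fun setT (fun x : R => x^-1).
Proof.
have -> : [set: R] = [set x | x != 0] `|` [set 0].
  apply/seteqP; split=> // x _; have [->|x0] := eqVneq x 0; [by right|by left].
have oN0 : open [set x : R | x != 0].
  exact: open_neq.
apply/measurable_funU; [exact: open_measurable|exact: measurable_set1|split].
  apply: open_continuous_measurable_fun => // x; rewrite inE /= => x0.
  exact: inv_continuous.
exact: measurable_fun_set1.
Qed.

Section NormalizedDensity.
Context {R : realType} {k : scalar_kind} {K : ptopologicalType}
  {E : normedModType (sfield R k)}.
Variables (S : set E) (h : K -> dball E).
Hypothesis S_sub : separable_subspace S.
Let g := normalized_density S h.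
Let rho t := dnorm_on S (dball_val (h t)).

(* Both sides vanish when rho t = 0, since 0^-1 = 0. *)
Lemma normalized_densityE t : g t = (sreal (rho t)^-1 : sfield R k) *:
    dball_val (h t).
Proof.
rewrite /g /normalized_density; case: ifPn => // /asboolPn hx.
have -> : rho t = 0; last by rewrite invr0 sreal0 scale0r.
have [S0 _ _] := S_sub.
apply/eqP; rewrite eq_le dnorm_on_ge0// andbT; apply: dnorm_on_le => // x Sx _.
suff -> : dball_val (h t) x = 0 by rewrite (rnorm0 (sfield R k)^o).
by apply/eqP; apply: contrapT => /negP xe; apply: hx; exists x.
Qed.

End NormalizedDensity.

Lemma cintegral_sreal (R : realType) (k : scalar_kind) (X : ptopologicalType)
    (m : {finite_measure set (borel X) -> \bar R}) (f : X -> R) :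
  cintegral m (fun t => sreal (f t) : sfield R k) = sreal (\int[m]_t f t).
Proof.
rewrite /cintegral /sreal; congr smk.
  by apply: eq_Rintegral => t _; exact: sreK.
rewrite -[RHS]/(0 : R) -[LHS]/(\int[m]_t sim (sreal (f t) : sfield R k)).
rewrite (@eq_Rintegral _ _ _ _ _ (fun=> 0)) ?Rintegral_cst ?mul0r//.
by move=> t _; exact: sim_sreal.
Qed.

Lemma sintegral_indic_dist (R : realType) (k : scalar_kind) (X :
    ptopologicalType)
    (nu : set (borel X) -> sfield R k) (M : {finite_measure set (borel X) ->
        \bar R})
    (f : X -> R) (A : set (borel X)) :
  scalar_measure nu -> M = svar nu :> (set (borel X) -> \bar R) ->
  continuous f -> (forall t, 0 <= f t <= 1) -> measurable A ->
  rnorm (sintegral_of nu (fun t => sreal (f t)) - nu A : (sfield R k)^o) <=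
    \int[M]_t `|f t - \1_A t|.
Proof.
move=> nu_reg ME cf f01 mA; have [nD nN n0] := @rnorm_seminorm R k.
have mf := continuous_borel cf.
have [v0 hv0] := scalar_integral_exists nu_reg ME mf f01.
have hv : is_integral (W := (sfield R k)^o) *%R nu (fun t => sreal (f t))
    (sintegral_of nu (fun t => sreal (f t))) by exact: (xgetPex 0 (ex_intro _
        v0 hv0)).
have bf : bam M (f : borel X -> R).
  apply: (@bam_measurable _ _ _ _ _ 1) => // t.
  by have /andP[? ?] := f01 t; rewrite ger0_norm.
have bb : bam M (fun t : borel X => `|f t - \1_A t|).
  by apply: bam_norm; apply: bamB => //; exact: bam_indic.
have pairDr (v w1 w2 : sfield R k) : v * (w1 + w2) = v * w1 + v * w2 by exact:
    mulrDr.
have pair_le (v w : sfield R k) :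
  rnorm (v * w : (sfield R k)^o) <= rnorm (v : (sfield R k)^o) * rnorm (w :
      (sfield R k)^o).
  by rewrite rnormM.
have := @integral_bound R k X (sfield R k) (sfield R k)^o _ nu *%R nD nN n0
    nu_reg
  (fun _ _ _ => mulrDl _ _ _) pairDr pair_le M ME
  _ _ 1%N (fun=> A) (fun=> 1) _ hv (fun=> mA) bb.
rewrite big_ord1 mulr1; apply => t; rewrite big_ord1.
have -> : (\1_A t : sfield R k) *: (1 : (sfield R k)^o) = sreal (\1_A t).
  by rewrite -[LHS]/(\1_A t * 1) mulr1 !indicE; case: (_ \in _);
      rewrite ?sreal0 ?sreal1.
by rewrite -srealN -srealD rnorm_sreal.
Qed.

(** * From W mu to the normalized density *)

Section Transport.
Context {R : realType} {k : scalar_kind} {K : ptopologicalType}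
  {E : normedModType (sfield R k)}.
Hypothesis Kcompact : compact [set: K].
Hypothesis Khausdorff : hausdorff_space K.
Variables P L : {finite_measure set (borel K) -> \bar R}.
Hypotheses (Preg : regular P) (Lreg : regular L).
Variables (h : K -> dball E) (l : (K -> E) -> R).
Hypothesis dens_ae : forall u, continuous u -> aem P (dens h u).
Hypothesis l_dens : forall u, continuous u -> l u = \int[P]_t dens h u t.
Hypothesis l_bound : forall u b, continuous u -> bam L b ->
  (forall t, rnorm (u t) <= b t) -> l u <= \int[L]_t b t.
Variable S : set E.
Hypothesis S_sub : separable_subspace S.
Let rho t := dnorm_on S (dball_val (h t)).
Hypothesis rho_total : \int[P]_t rho t = fine (L setT).
Variable W : {finite_measure set (borel (K * dball E)%type) -> \bar R}.
Hypothesis W_batty : forall f, batty_class f ->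
  (\int[W]_p (on_ball f p)%:E)%E = ereal_inf [set (l u)%:E | u in
    [set u : K -> E | continuous u /\
       forall t (x : dual E), f (t, x) <= sre (x (u t))]].
Hypothesis W_total : W setT = L setT.

(** Where rho(t) > 0, homogeneity gives f(t, h, rho) = rho f(t, g, 1), and rho is the density of L
    with respect to P. The bounds on f are asked on all of E^* since g(t) may lie outside the
    ball. *)
Lemma perspective_normalized (f : K -> dual E -> R -> R) :
  perspective P h rho f -> (forall t x, 0 <= f t x 1 <= 1) ->
  \int[W]_p f p.1 (dball_val p.2) 1 =
  \int[L]_t f t (normalized_density S h t) 1.
Proof.
move=> pf f01.
have [d [d_le1 d_lim]] := norming_sequence S_sub.
have rho_lim t : max_eval d n (dball_val (h t)) @[n --> \oo] --> rho t by
    exact: d_lim.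
have rho_bam : bam P rho by exact: (bam_rho Kcompact dens_ae d_le1 rho_lim).
have rho0 : forall u, continuous u -> {ae P, forall t, rho t = 0 -> dens h u t
    = 0}.
  exact: (dens_rho0 Kcompact Khausdorff Preg Lreg dens_ae l_dens l_bound
    d_le1 rho_lim rho_total).
have WP : fine (W setT) = \int[P]_t rho t by rewrite W_total rho_total.
rewrite (psp_integral Kcompact Khausdorff Preg dens_ae l_dens rho0 W_batty
    d_le1 rho_lim rho_bam WP pf).
have gE := normalized_densityE h S_sub.
(* Here [psp_aem] is used at x(t) = g(t): it asks only for a version of each Re g(t)(e) = Re h(t)(e)
   / rho(t). *)
have bG : bam P (fun t => f t (normalized_density S h t) 1).
  split; first by exists 1 => t; have /andP[? ?] := f01 t (normalized_density S
      h t); rewrite ger0_norm.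
  apply: (psp_aem pf (x := normalized_density S h) (c := fun=> 1)); last first.
    by have [] := bam_cst P 1.
  move=> e; rewrite (_ : (fun t => _) = fun t => (rho t)^-1 * sre (dball_val (h
      t) e)); last first.
    by apply/funext => t; rewrite gE -sreMreal.
  apply: (aem_comp2 (u := fun z => z.1 * z.2)); first exact: measurable_funM.
    apply: (aem_comp (u := fun z => z^-1)); first exact: measurable_inv.
    by have [] := rho_bam.
  by apply: (dens_ae (u := fun=> e)) => t; exact: cvg_cst.
rewrite (change_of_density Kcompact Khausdorff Preg Lreg dens_ae l_dens l_bound
    d_le1 rho_lim rho_total bG); last first.
  by move=> t; exact: f01.
have dc0 : dc P h rho (fun=> 0).
  have c1 : continuous (fun _ : K => 1 : R) by move=> t; exact: cvg_cst.
  apply: dc_ext (dc_lin Kcompact dens_ae rho0 0 c1).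
  by move=> y; rewrite /lin dual0 sre0 mulr0.
apply: Rintegral_ae.
(* Taking s = 0 in [psp_dc], f(t, x, 0) is in the lattice, so f(t, h(t), 0) = 0 for almost all t
   with rho(t) = 0. *)
apply: (@filterS _ (almost_everywhere P) _ _ _ _ (dc_zero (psp_dc pf dc0))) =>
    t hz.
have [r0|r0] := eqVneq (rho t) 0.
  by rewrite r0 mulr0; exact: hz.
rewrite mulrC -(psp_hom pf) ?dnorm_on_ge0//; last by have [] := S_sub.
by rewrite mulr1 gE scalerA -srealM divff// sreal1 scale1r.
Qed.

End Transport.

Theorem corollary4p2 (R : realType) (k : scalar_kind)
    (K : ptopologicalType) (E : completeNormedModType (sfield R k))
    (Kcompact : compact [set: K]) (Khausdorff : hausdorff_space K)
    (nu : set (borel (K * dball E)%type) -> sfield R k)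
    (nu_meas : scalar_measure nu)
    (mu : set (borel K) -> dual E) (mu_def : is_Tadjoint nu mu)
    (h : K -> dball E) (h_density : is_density (pi1_var nu) mu h)
    (F0 : set E) (F0_sep : separable_subspace F0)
    (F0_norm : (\int[pi1_var nu]_t (dnorm_on F0 (dball_val (h t)))%:E)%E =
               dvar mu setT)
    (nut : set (borel (K * dball E)%type) -> sfield R k)
    (nut_def : is_lifted_measure mu (normalized_density F0 h) nut)
    (Wmu : {measure set (borel (K * dball E)%type) -> \bar R})
    (Wmu_def : is_batty_W mu Wmu) :
  forall A : set (borel (K * dball E)%type), measurable A ->
    nut A = sreal (fine (Wmu A)).
Proof.
have [mu_meas _] := mu_def.
have [M ME] := svar_measure nu_meas.
have [P PE] := fst_pushforward_measure M.
have P1 : P = pi1_var nu :> (set (borel K) -> \bar R) by rewrite PE ME.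
have hausE : hausdorff_space (dball E) by exact: hausdorff_dball.
have Preg : regular P.
  rewrite PE; apply: regular_fst => //; rewrite ME.
  by case: nu_meas.
have [L LE] := dvar_measure mu_meas.
have Lreg : regular L by rewrite LE; case: mu_meas.
pose l u := sre (dintegral_of mu u).
rewrite -P1 in h_density F0_norm.
have dens_ae u : continuous u -> aem P (dens h u).
  move=> cu; have [hm _] := h_density u cu.
  apply: completed_ae => x.
  have := hm [set z : (sfield R k)^o | x < sre z]; apply.
  have /continuousP/(_ [set y | x < y]) := @continuous_sre R k.
  by apply; exact: open_gt.
have l_dens u : continuous u -> l u = \int[P]_t dens h u t.
  by move=> cu; rewrite /l; have [_ ->] := h_density u cu; exact: sre_smk.
have l_bound u b : continuous u -> bam L b ->
    (forall t, rnorm (u t) <= b t) -> l u <= \int[L]_t b t.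
  by move=> _; exact: dintegral_le.
have rho_total : \int[P]_t dnorm_on F0 (dball_val (h t)) = fine (L setT).
  by rewrite LE -F0_norm.
have [Wreg WT Wint] := Wmu_def.
have [W WE] : exists W : {finite_measure set (borel (K * dball E)%type) -> \bar
    R},
    W = Wmu :> (set (borel (K * dball E)%type) -> \bar R).
  apply: finite_measure_of; rewrite WT -LE -ge0_fin_numE//.
  exact: fin_num_measure.
rewrite -WE in Wreg WT Wint *.
have W_total : W setT = L setT by rewrite WT LE.
have [nut_meas nut_Z nut_int] := nut_def.
have [N NE] := svar_measure nut_meas.
have Nreg : regular N by rewrite NE; case: nut_meas.
have [d [d_le1 d_lim]] := norming_sequence F0_sep.
pose rho t := dnorm_on F0 (dball_val (h t)).
have rho_lim t : max_eval d n (dball_val (h t)) @[n --> \oo] --> rho t by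
    exact: d_lim.
have rho_bam : bam P rho by exact: (bam_rho Kcompact dens_ae d_le1 rho_lim).
have rho0 : forall u, continuous u -> {ae P, forall t, rho t = 0 -> dens h u t
    = 0}.
  exact: (dens_rho0 Kcompact Khausdorff Preg Lreg dens_ae l_dens l_bound
    d_le1 rho_lim rho_total).
have WP : fine (W setT) = \int[P]_t rho t by rewrite W_total rho_total.
have hKE : hausdorff_space (K * dball E)%type by exact: hausdorff_pair.
pose Z := [set p : K * dball E | dball_val p.2 = 0].
have oZ : open (~` Z).
  rewrite (_ : ~` Z = \bigcup_(e in [set: E]) [set p : K * dball E | dball_val
      p.2 e != 0]).
    apply: bigcup_open => e _.
    have /continuousP/(_ [set z : (sfield R k)^o | z != 0]) :
        continuous (fun p : K * dball E => dball_val p.2 e : (sfield R k)^o).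
      move=> p; apply: (@cvg_comp _ _ _ (fun p : K * dball E => dball_val p.2)
        (fun x : dual E => x e : (sfield R k)^o)); last exact: continuous_eval.
      by apply: (@cvg_comp _ _ _ snd (@dball_val R k E));
          [exact: cvg_snd|exact: continuous_dball_val].
    apply.
    rewrite (_ : [set z | _] = ~` [set 0]).
      apply: closed_openC; apply: accessible_closed_set1.
      by apply: hausdorff_accessible; exact: (@norm_hausdorff _ (sfield R k)^o).
    by apply/seteqP; split=> z /= /eqP.
  apply/seteqP; split=> p /=; first by move/dual_neq0 => [e pe]; exists e.
  move=> [e _ /eqP pe] p0; apply: pe.
  exact: (congr1 (fun x : dual E => x e : sfield R k) p0).
have mZ : measurable (Z : set (borel (K * dball E)%type)).
  by rewrite -[Z]setCK; apply: measurableC; exact: open_borel.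
have WZ (B : set (borel (K * dball E)%type)) : measurable B -> B `<=` Z -> W B
    = 0%E.
  move=> mB BZ.
  apply: (zero_fiber_null Kcompact Khausdorff Preg dens_ae l_dens rho0 Wint
      d_le1 rho_lim WP) => //.
have [nD nN n0] := @rnorm_seminorm R k.
have [nut_sigma _ _] := nut_meas.
have NZ (B : set (borel (K * dball E)%type)) : measurable B -> B `<=` Z -> nut
    B = 0.
  move=> mB BZ; apply/n0/eqP; rewrite eq_le rnorm_ge0 andbT.
  apply: le_trans (n_le_variation NE mB) _.
  rewrite (_ : N B = 0%E)//; apply/eqP; rewrite eq_le measure_ge0 andbT.
  have <- : N Z = 0%E by rewrite NE.
  by apply: le_measure; rewrite ?inE.
move=> A0 mA0.
(* The zero fibre is null for W and for |nut|; only the part of A0 off it remains to be compared. *)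
pose A := A0 `\` Z.
have mA : measurable (A : set (borel (K * dball E)%type)) by exact: measurableD.
have mAZ : measurable (A0 `&` Z : set (borel (K * dball E)%type)) by exact:
    measurableI.
have AZ0 : A0 `&` Z `<=` Z by move=> p [].
have -> : nut A0 = nut A.
  by rewrite (vmeasure_split nD nN n0 nut_sigma mA0 mZ) (NZ _ mAZ AZ0) add0r.
have -> : W A0 = W A.
  have AI0 : (A0 `&` Z) `&` A = set0.
    by apply/seteqP; split=> // p [[_ Zp] [_ /(_ Zp)]].
  have WU : W (A0 `&` Z `|` A) = (W (A0 `&` Z) + W A)%E := measureU W mAZ mA
      AI0.
  by move: WU; rewrite setUIDK (WZ _ mAZ AZ0) add0e.
apply/eqP; rewrite -subr_eq0; apply/eqP/n0/eqP; rewrite eq_le rnorm_ge0 andbT.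
apply/ler_addgt0Pr => e e0; rewrite add0r.
have e20 : 0 < e / 2 by rewrite divr_gt0.
have [C1 [U1 [cC1 oU1 CA1 AU1 h1]]] := Nreg _ mA _ e20.
have [C2 [U2 [cC2 oU2 CA2 AU2 h2]]] := Wreg _ mA _ e20.
(* Removing Z from U supplies the nonzero functionals that [perspective_urysohn] asks for and makes
   f vanish on the zero fibre, as the definition of [nut] demands. *)
pose C := C1 `|` C2; pose U := (U1 `&` U2) `&` ~` Z.
have cC : compact C by exact: compactU.
have oU : open U by apply: openI => //; exact: openI.
have CA : C `<=` A by rewrite subUset.
have AU : A `<=` U by move=> p Ap; split; [split;
    [exact: AU1|exact: AU2]|case: Ap].
have [f [pf f01 f1 f0]] := perspective_urysohn Kcompact Khausdorff Preg dens_ae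
    rho0
  cC oU (subset_trans CA AU) (fun p Up => let: conj _ h := Up in h).
pose fB (p : K * dball E) := f p.1 (dball_val p.2) 1.
have cfE : continuous (fun y : K * dual E => f y.1 y.2 1) by exact: psp_cont pf.
have cfB : continuous fB.
  move=> p; apply: (@cvg_comp _ _ _ (fun p : K * dball E => (p.1, dball_val
      p.2))
    (fun y : K * dual E => f y.1 y.2 1)); first exact: continuous_ball_incl.
  exact: (cfE (p.1, dball_val p.2)).
(* Being continuous on K x E^*, the function f(t, x, 1) is its own extension [fe]; both integrals
   equal that of f(t, g(t), 1) against |mu|. *)
have key : sintegral_of nut (fun p => sreal (fB p)) = sreal (\int[W]_p fB p).
  rewrite (perspective_normalized Kcompact Khausdorff Preg Lreg dens_ae l_dens
      l_bound
    F0_sep rho_total Wint W_total pf)//.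
  rewrite -cintegral_sreal LE.
  apply: (nut_int (fun p => sreal (fB p)) (fun y => sreal (f y.1 y.2 1))) => //.
  + move=> p; apply: (@cvg_comp _ _ _ fB sreal); first exact: cfB.
    exact: (@continuous_sreal R k (fB p)).
  + move=> p p0; rewrite /fB f0 ?sreal0// => -[_]; exact.
  + move=> y; apply: (@cvg_comp _ _ _ (fun y : K * dual E => f y.1 y.2 1)
      sreal).
      exact: cfE.
    exact: (@continuous_sreal R k _).
have mfB := continuous_borel cfB.
have fB01 p : 0 <= fB p <= 1 by exact: f01.
have mc (D : set (K * dball E)) : compact D ->
    measurable (D : set (borel (K * dball E)%type)) by exact: compact_borel.
have mo (V : set (K * dball E)) : open V ->
    measurable (V : set (borel (K * dball E)%type)) by exact: open_borel.
have hN : \int[N]_p `|fB p - \1_A p| <= e / 2.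
  apply: (Rintegral_separator mfB fB01 f1 f0 mA (mc _ cC1) (mo _ oU1) CA AU) h1.
    exact: subsetUl.
  by move=> p [[]].
have hW : \int[W]_p `|fB p - \1_A p| <= e / 2.
  apply: (Rintegral_separator mfB fB01 f1 f0 mA (mc _ cC2) (mo _ oU2) CA AU) h2.
    exact: subsetUr.
  by move=> p [[]].
have bfB : bam W (fB : borel (K * dball E)%type -> R).
  apply: (@bam_measurable _ _ _ _ _ 1) => // p.
  by have /andP[? ?] := fB01 p; rewrite ger0_norm.
have k1 : rnorm (sreal (\int[W]_p fB p) - nut A : (sfield R k)^o) <= e / 2.
  apply: le_trans hN; rewrite -key.
  exact: sintegral_indic_dist.
have k2 : `|\int[W]_p fB p - fine (W A)| <= e / 2.
  apply: le_trans hW; rewrite -Rintegral_indic_bam// -RintegralB_bam//;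
      last exact: bam_indic.
  by apply: le_norm_Rintegral_bam; apply: bamB => //; exact: bam_indic.
have -> : nut A - sreal (fine (W A)) =
    - (sreal (\int[W]_p fB p) - nut A) + sreal (\int[W]_p fB p - fine (W A)).
  by rewrite srealD srealN opprB addrA subrK.
rewrite [leRHS]splitr; apply: le_trans (nD _ _) _.
by rewrite nN rnorm_sreal; exact: lerD.
Qed.
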